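(* Let $f:M\to N$ be a $(\pm)$-holomorphic map from an almost contact metric manifold $M$ into an almost contact metric manifold or an almost Hermitian manifold $N$. (1) (i) If $M\in\mathcal A_1$ and $N\in\mathcal A_1\cup\mathcal A_4\cup\mathcal B_1\cup\mathcal C_1$, then $f$ is harmonic and also $D$-pluriharmonic. (ii) If $M\in\mathcal A_6\cup\mathcal A_7$ and $N\in\mathcal A_1\cup\mathcal A_4\cup\mathcal B_1\cup\mathcal C_1$, then $f$ is harmonic. (2) If $M\in\mathcal A_1\cup\mathcal A_6\cup\mathcal A_7$ and $N\in\mathcal A_1\cup\mathcal A_4$ and $f$ is weakly conformal, then $f$ is homothetic and harmonic with minimal image.
   Context: Manifolds and maps are smooth; $\nabla$ denotes Levi-Civita connections. An almost contact metric manifold $M=(M^{2m+1};\varphi,\xi,\eta,g)$ is a $(2m+1)$-dimensional Riemannian manifold with a $(1,1)$-tensor $\varphi$, a vector field $\xi$ and a 1-form $\eta$ such that $\varphi^2X=-X+\eta(X)\xi$, $\eta(\xi)=1$, $g(\varphi X,\varphi Y)=g(X,Y)-\eta(X)\eta(Y)$. Put $D^M=\varphi(TM)=\ker\eta$, $\Omega(X,Y)=g(X,\varphi Y)$, $P(X,Y)=(\nabla_X\varphi)Y+(\nabla_{\varphi X}\varphi)\varphi Y$, $Q(X,Y)=(\nabla_X\varphi)Y+(\nabla_Y\varphi)X$, $2\mathfrak h=\mathcal L_\xi\varphi$. Conventions: $2d\eta(X,Y)=X\eta(Y)-Y\eta(X)-\eta([X,Y])$; $\{e_i;\varphi e_i;\xi\}_{1\le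 i\le m}$ is any local orthonormal frame; $\delta\Omega(X)=g(-\varphi(\nabla_\xi\xi)+\sum_iP(e_i,e_i),X)$. $M$ is normal if $[\varphi,\varphi]+2d\eta\otimes\xi=0$, where $[\varphi,\varphi](X,Y)=\varphi^2[X,Y]+[\varphi X,\varphi Y]-\varphi[\varphi X,Y]-\varphi[X,\varphi Y]$. Classes (identities for all vector fields $X,Y$). $\mathcal A_1$: $\alpha$-contact metric manifolds ($d\eta=\alpha\Omega$, $\alpha\neq0$ a real constant); quasi-contact metric manifolds ($P(X,Y)=2g(X,Y)\xi-\eta(Y)\{X+\eta(X)\xi+\mathfrak hX\}$); quasi-$\mathcal K$-Sasakian manifolds ($P(X,Y)=2g(X,Y)\xi-2\eta(Y)X+\eta(Y)\nabla_{\varphi X}\xi$); strongly pseudoconvex CR-manifolds ($d\eta=\Omega$ and $(\nabla_X\varphi)Y=g(X+\mathfrak hX,Y)\xi-\eta(Y)(X+\mathfrak hX)$); $\alpha$-Sasakian manifolds ($d\eta=\alpha\Omega$, $\alpha\neq0$ constant, and normal). $\mathcal A_4$: quasi-Sasakian manifolds (normal, $d\Omega=0$, and $\eta\wedge(d\eta)^r\neq0$, $(d\eta)^{r+1}=0$ for some $1\le r\le m-1$). $\mathcal A_6$: nearly $\alpha$-Sasakian manifolds ($Q(X,Y)=\alpha\{2g(X,Y)\xi-\eta(Y)X-\eta(X)Y\}$, $\alpha\ne0$ constant). $\mathcal A_7$: semi-Sasakian manifolds (normal and $\delta\Omega=2m\eta$). $\mathcal B_1$: cosymplectic ($d\eta=0$,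 $d\Omega=0$, normal), almost cosymplectic ($d\eta=0$, $d\Omega=0$), nearly cosymplectic ($(\nabla_X\varphi)X=0$), nearly-$\mathcal K$-cosymplectic ($(\nabla_X\varphi)X=0$ and $(\nabla_X\varphi)\xi=0$), quasi-$\mathcal K$-cosymplectic ($P(X,Y)=\eta(Y)\nabla_{\varphi X}\xi$) manifolds. $\mathcal C_1$: almost Hermitian manifolds $(H;J,G)$ that are Kähler ($\nabla J=0$), nearly Kähler ($(\nabla_XJ)X=0$), almost Kähler ($d\Phi=0$, $\Phi(X,Y)=G(X,JY)$) or quasi-Kähler ($(\nabla_{JX}J)X-(\nabla_XJ)JX=0$). An almost contact metric target is written $N=(N^{2n+1};\phi,\gamma,\sigma,h)$, with the same notions for $(\phi,\gamma,\sigma,h,n)$ in place of $(\varphi,\xi,\eta,g,m)$. $f$ is $(\pm)$-holomorphic if $f_*\varphi=\pm\psi f_*$ (one fixed sign), where $\psi=\phi$, respectively $\psi=J$ for an almost Hermitian target. $f$ is harmonic if its tension field vanishes; $D$-pluriharmonic if $(\nabla f_* )(X,X)+(\nabla f_* )(\varphi X,\varphi X)=0$ for all $X\in\Gamma(D^M)$, $\nabla f_*$ being the second fundamental form. $f$ is weakly conformal if $h(f_*X,f_*Y)=\mu^2g(X,Y)$ for all $X,Y$ and some function $\mu\ge0$, and homothetic if moreover $\mu$ is constant.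
   Formalization: M is assumed to have dimension 2m+1 ≥ 3 (for m = 0 the class identities are void and a reparametrized Reeb curve is a counterexample), and in (2) M is assumed connected (otherwise μ may take different constant values on different components). *)

(* Defs.v *)
From HB Require Import structures.
From mathcomp Require Import all_boot all_order all_algebra all_fingroup.
From mathcomp Require Import all_classical all_reals all_analysis.

Set Implicit Arguments.
Unset Strict Implicit.
Unset Printing Implicit Defensive.

Import Order.TTheory GRing.Theory Num.Theory.
Import numFieldNormedType.Exports.

Local Open Scope classical_set_scope.
Local Open Scope ring_scope.

(* Tangent vectors in a chart are row vectors of components; a (1,1)-tensor is
   a matrix acting on the right, a 1-form is a column. *)

Section Calculus.
Variables (R : realType) (d : nat).
Implicit Types (U : set 'rV[R]_d) (X Y Z : 'rV[R]_d -> 'rV[R]_d).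

Definition basis_vec (i : 'I_d) : 'rV[R]_d := delta_mx 0 i.

Definition coord_field (i : 'I_d) : 'rV[R]_d -> 'rV[R]_d := fun=> basis_vec i.

Fixpoint iter_partial (s : seq 'I_d) (u : 'rV[R]_d -> R) : 'rV[R]_d -> R :=
  if s is i :: s' then iter_partial s' (fun x => 'D_(basis_vec i) u x) else u.

(* C^oo on an open set: all iterated partial derivatives exist and are
   continuous. *)
Definition smooth_on U (u : 'rV[R]_d -> R) : Prop :=
  forall (s : seq 'I_d) (x : 'rV[R]_d), U x ->
    {for x, continuous (iter_partial s u)} /\
    forall i, derivable (iter_partial s u) x (basis_vec i).

Definition smooth_mx_on p q U (A : 'rV[R]_d -> 'M[R]_(p, q)) : Prop :=
  forall i j, smooth_on U (fun x => A x i j).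

Definition bracket X Y : 'rV[R]_d -> 'rV[R]_d :=
  fun x => 'D_(X x) Y x - 'D_(Y x) X x.

Definition app_end (A : 'rV[R]_d -> 'M[R]_d) X : 'rV[R]_d -> 'rV[R]_d :=
  fun x => X x *m A x.

Definition inner (G : 'M[R]_d) (u v : 'rV[R]_d) : R := (u *m G *m v^T) 0 0.

Definition christoffel (G : 'rV[R]_d -> 'M[R]_d) (x : 'rV[R]_d)
    (i j k : 'I_d) : R :=
  2^-1 * \sum_l invmx (G x) k l *
    ('D_(basis_vec i) (fun y => G y j l : R) x
     + 'D_(basis_vec j) (fun y => G y i l : R) x
     - 'D_(basis_vec l) (fun y => G y i j : R) x).

Definition christoffel_form (G : 'rV[R]_d -> 'M[R]_d) (x u v : 'rV[R]_d) :
    'rV[R]_d :=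
  \row_k \sum_i \sum_j u 0 i * v 0 j * christoffel G x i j k.

(* Levi-Civita covariant derivative of Y along X for the metric G *)
Definition nabla (G : 'rV[R]_d -> 'M[R]_d) X Y : 'rV[R]_d -> 'rV[R]_d :=
  fun x => 'D_(X x) Y x + christoffel_form G x (X x) (Y x).

(* (nabla_X A) Y *)
Definition nabla_end (G A : 'rV[R]_d -> 'M[R]_d) X Y : 'rV[R]_d -> 'rV[R]_d :=
  fun x => nabla G X (app_end A Y) x - nabla G X Y x *m A x.

(* dW, in the convention in which
   2 dw(X, Y) = X w(Y) - Y w(X) - w([X, Y]) *)
Definition d_two_form
    (W : ('rV[R]_d -> 'rV[R]_d) -> ('rV[R]_d -> 'rV[R]_d) -> 'rV[R]_d -> R)
    X Y Z (x : 'rV[R]_d) : R :=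
  3^-1 * (('D_(X x) (W Y Z) x : R) + ('D_(Y x) (W Z X) x : R)
          + ('D_(Z x) (W X Y) x : R)
          - W (bracket X Y) Z x - W (bracket Z X) Y x - W (bracket Y Z) X x).

End Calculus.

Section MapCalculus.
Variables (R : realType) (d e : nat).
Variables (G : 'rV[R]_d -> 'M[R]_d) (H : 'rV[R]_e -> 'M[R]_e).
Variable F : 'rV[R]_d -> 'rV[R]_e.
Implicit Types (X Y : 'rV[R]_d -> 'rV[R]_d).

Definition push X : 'rV[R]_d -> 'rV[R]_e := fun x => 'D_(X x) F x.

(* the connection induced on sections W of F^*TN *)
Definition pull_nabla X (W : 'rV[R]_d -> 'rV[R]_e) : 'rV[R]_d -> 'rV[R]_e :=
  fun x => 'D_(X x) W x + christoffel_form H (F x) (push X x) (W x).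

Definition second_fundamental_form X Y : 'rV[R]_d -> 'rV[R]_e :=
  fun x => pull_nabla X (push Y) x - push (nabla G X Y) x.

Definition tension (x : 'rV[R]_d) : 'rV[R]_e :=
  \sum_i \sum_j invmx (G x) i j *:
    second_fundamental_form (coord_field i) (coord_field j) x.

Definition pull_metric (x : 'rV[R]_d) : 'M[R]_d :=
  \matrix_(i, j) inner (H (F x)) (push (coord_field i) x)
                                 (push (coord_field j) x).

(* The normal component of this vector is d times the mean curvature vector of
   the immersed submanifold parametrized by F. *)
Definition mean_curvature_trace (x : 'rV[R]_d) : 'rV[R]_e :=
  \sum_i \sum_j invmx (pull_metric x) i j *:
    pull_nabla (coord_field i) (push (coord_field j)) x.

End MapCalculus.

(* Smooth manifolds: Hausdorff second countable spaces with a smooth atlas.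
   [crd a] and [par a] are mutually inverse homeomorphisms between the open
   sets [dom a] of the manifold and [cod a] of R^d. *)
Record manifold (R : realType) (d : nat) := Manifold {
  point :> topologicalType;
  point_hausdorff : hausdorff_space point;
  point_second_countable : @second_countable point;
  chart : Type;
  dom : chart -> set point;
  cod : chart -> set 'rV[R]_d;
  crd : chart -> point -> 'rV[R]_d;
  par : chart -> 'rV[R]_d -> point;
  dom_open : forall a, open (dom a);
  cod_open : forall a, open (cod a);
  dom_cover : forall p, exists a, dom a p;
  crd_cod : forall a p, dom a p -> cod a (crd a p);
  par_dom : forall a x, cod a x -> dom a (par a x);
  crdK : forall a p, dom a p -> par a (crd a p) = p;
  parK : forall a x, cod a x -> crd a (par a x) = x;
  crd_continuous : forall a p, dom a p -> {for p, continuous (crd a)};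
  par_continuous : forall a x, cod a x -> {for x, continuous (par a)};
  transition_smooth : forall a b,
    smooth_mx_on [set x | cod a x /\ dom b (par a x)]
      (fun x => crd b (par a x))
}.

Definition transition (R : realType) (d : nat) (M : manifold R d)
  (a b : chart M) : 'rV[R]_d -> 'rV[R]_d := fun x => crd b (par a x).

Definition overlap (R : realType) (d : nat) (M : manifold R d)
  (a b : chart M) : set 'rV[R]_d := [set x | cod a x /\ dom b (par a x)].

(* Tensor fields are given by their components in the charts, subject to the
   transformation law under changes of charts. *)
Definition endomorphism_field (R : realType) (d : nat) (M : manifold R d)
    (A : chart M -> 'rV[R]_d -> 'M[R]_d) : Prop :=
  (forall a, smooth_mx_on (cod a) (A a)) /\
  (forall a b x, overlap a b x -> forall u,
     'D_(u *m A a x) (transition a b) x =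
     'D_u (transition a b) x *m A b (transition a b x)).

Definition vector_field (R : realType) (d : nat) (M : manifold R d)
    (X : chart M -> 'rV[R]_d -> 'rV[R]_d) : Prop :=
  (forall a, smooth_mx_on (cod a) (X a)) /\
  (forall a b x, overlap a b x ->
     'D_(X a x) (transition a b) x = X b (transition a b x)).

Definition one_form (R : realType) (d : nat) (M : manifold R d)
    (w : chart M -> 'rV[R]_d -> 'cV[R]_d) : Prop :=
  (forall a, smooth_mx_on (cod a) (w a)) /\
  (forall a b x, overlap a b x -> forall u,
     u *m w a x = 'D_u (transition a b) x *m w b (transition a b x)).

Definition riemannian_metric (R : realType) (d : nat) (M : manifold R d)
    (G : chart M -> 'rV[R]_d -> 'M[R]_d) : Prop :=
  [/\ forall a, smooth_mx_on (cod a) (G a),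
      forall a x, cod a x -> (G a x)^T = G a x,
      forall a x, cod a x -> forall u, u != 0 -> 0 < inner (G a x) u u
    & forall a b x, overlap a b x -> forall u v,
        inner (G a x) u v =
        inner (G b (transition a b x))
          ('D_u (transition a b) x) ('D_v (transition a b) x)].

Record riem_manifold (R : realType) (d : nat) := RiemManifold {
  riem_base :> manifold R d;
  metric : chart riem_base -> 'rV[R]_d -> 'M[R]_d;
  metricP : riemannian_metric metric
}.

Record acm_manifold (R : realType) (m : nat) := AcmManifold {
  acm_base :> riem_manifold R m.*2.+1;
  phi : chart acm_base -> 'rV[R]_m.*2.+1 -> 'M[R]_m.*2.+1;
  xi : chart acm_base -> 'rV[R]_m.*2.+1 -> 'rV[R]_m.*2.+1;
  eta : chart acm_base -> 'rV[R]_m.*2.+1 -> 'cV[R]_m.*2.+1;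
  phi_tensor : endomorphism_field phi;
  xi_field : vector_field xi;
  eta_form : one_form eta;
  phi_sq : forall a x, cod a x -> forall u : 'rV[R]_m.*2.+1,
    u *m phi a x *m phi a x = - u + (u *m eta a x) 0 0 *: xi a x;
  eta_xi : forall a x, cod a x -> (xi a x *m eta a x) 0 0 = 1;
  metric_phi : forall a x, cod a x -> forall u v,
    inner (metric a x) (u *m phi a x) (v *m phi a x) =
    inner (metric a x) u v - (u *m eta a x) 0 0 * (v *m eta a x) 0 0
}.

Record ah_manifold (R : realType) (n : nat) := AhManifold {
  ah_base :> riem_manifold R n.*2;
  acs : chart ah_base -> 'rV[R]_n.*2 -> 'M[R]_n.*2;
  acs_tensor : endomorphism_field acs;
  acs_sq : forall a x, cod a x -> forall u : 'rV[R]_n.*2,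
    u *m acs a x *m acs a x = - u;
  metric_acs : forall a x, cod a x -> forall u v,
    inner (metric a x) (u *m acs a x) (v *m acs a x) = inner (metric a x) u v
}.

(* An identity between vector fields is required for all smooth vector fields
   on all open subsets of all chart domains. *)
Section VectorFieldIdentities.
Variables (R : realType) (d : nat) (M : manifold R d).
Let field := 'rV[R]_d -> 'rV[R]_d.

Definition in_chart (a : chart M) (U : set 'rV[R]_d) : Prop :=
  open U /\ U `<=` cod a.

Definition for_fields1 (P : chart M -> field -> 'rV[R]_d -> Prop) : Prop :=
  forall a U, in_chart a U -> forall X : field, smooth_mx_on U X ->
  forall x, U x -> P a X x.

Definition for_fields2 (P : chart M -> field -> field -> 'rV[R]_d -> Prop) :
    Prop :=
  forall a U, in_chart a U -> forall X Y : field,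
  smooth_mx_on U X -> smooth_mx_on U Y -> forall x, U x -> P a X Y x.

Definition for_fields3
    (P : chart M -> field -> field -> field -> 'rV[R]_d -> Prop) : Prop :=
  forall a U, in_chart a U -> forall X Y Z : field,
  smooth_mx_on U X -> smooth_mx_on U Y -> smooth_mx_on U Z ->
  forall x, U x -> P a X Y Z x.

End VectorFieldIdentities.

Section AlmostContact.
Variables (R : realType) (m : nat) (M : acm_manifold R m).
Notation D := m.*2.+1.
Notation field := ('rV[R]_D -> 'rV[R]_D).
Implicit Types (a : chart M) (X Y Z : field) (x : 'rV[R]_D).

Definition g_of a X Y x : R := inner (metric a x) (X x) (Y x).
Definition phi_of a X : field := app_end (phi a) X.
Definition eta_of a X x : R := (X x *m eta a x) 0 0.
Definition Omega a X Y x : R := g_of a X (phi_of a Y) x.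
Definition nabla_acm a X Y : field := nabla (metric a) X Y.
Definition nabla_phi a X Y : field := nabla_end (metric a) (phi a) X Y.

Definition P_acm a X Y : field := fun x =>
  nabla_phi a X Y x + nabla_phi a (phi_of a X) (phi_of a Y) x.

Definition Q_acm a X Y : field := fun x => nabla_phi a X Y x + nabla_phi a Y X x.

(* 2 h X = (L_xi phi) X = [xi, phi X] - phi [xi, X] *)
Definition h_tensor a X : field := fun x =>
  2^-1 *: (bracket (xi a) (phi_of a X) x - phi_of a (bracket (xi a) X) x).

Definition d_eta a X Y x : R :=
  2^-1 * (('D_(X x) (eta_of a Y) x : R) - ('D_(Y x) (eta_of a X) x : R)
          - eta_of a (bracket X Y) x).

Definition phi_torsion a X Y : field := fun x =>
  phi_of a (phi_of a (bracket X Y)) x + bracket (phi_of a X) (phi_of a Y) x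
  - phi_of a (bracket (phi_of a X) Y) x - phi_of a (bracket X (phi_of a Y)) x.

Definition normal_acm : Prop :=
  for_fields2 (fun a X Y x =>
    phi_torsion a X Y x + (2 * d_eta a X Y x) *: xi a x = 0).

Definition d_eta_zero : Prop := for_fields2 (fun a X Y x => d_eta a X Y x = 0).

Definition d_Omega_zero : Prop :=
  for_fields3 (fun a X Y Z x => d_two_form (@Omega a) X Y Z x = 0).

Definition d_eta_Omega (alpha : R) : Prop :=
  for_fields2 (fun a X Y x => d_eta a X Y x = alpha * Omega a X Y x).

(* Wedge products are alternations normalized by 1/k!, the convention that
   goes with the factor 2 in 2 d eta. *)
Definition d_eta_power (r : nat) a (X : 'I_r.+1.*2 -> field) x : R :=
  ((r.+1.*2)`!%:R)^-1 * \sum_(s : {perm 'I_r.+1.*2}) (-1) ^+ s *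
    \prod_(i < r.+1) d_eta a (X (s (inord i.*2))) (X (s (inord i.*2.+1))) x.

Definition eta_d_eta_power (r : nat) a (X : 'I_r.*2.+1 -> field) x : R :=
  ((r.*2.+1)`!%:R)^-1 * \sum_(s : {perm 'I_r.*2.+1}) (-1) ^+ s *
    (eta_of a (X (s ord0)) x *
     \prod_(i < r) d_eta a (X (s (inord i.*2.+1))) (X (s (inord i.*2.+2))) x).

(* eta /\ (d eta)^r vanishes nowhere and (d eta)^(r+1) vanishes identically *)
Definition eta_rank (r : nat) : Prop :=
  (forall a x, cod a x -> exists2 U, in_chart a U /\ U x &
     exists2 X : 'I_r.*2.+1 -> field, forall i, smooth_mx_on U (X i) &
       eta_d_eta_power a X x != 0) /\
  (forall a U, in_chart a U -> forall X : 'I_r.+1.*2 -> field,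
     (forall i, smooth_mx_on U (X i)) -> forall x, U x ->
     d_eta_power a X x = 0).

Definition phi_frame a (U : set 'rV[R]_D) (E : 'I_m -> field) : Prop :=
  (forall i, smooth_mx_on U (E i)) /\
  forall x, U x ->
    (forall i j,
       [/\ g_of a (E i) (E j) x = (i == j)%:R,
           g_of a (phi_of a (E i)) (phi_of a (E j)) x = (i == j)%:R
         & g_of a (E i) (phi_of a (E j)) x = 0]) /\
    (forall i, g_of a (E i) (xi a) x = 0 /\
               g_of a (phi_of a (E i)) (xi a) x = 0) /\
    g_of a (xi a) (xi a) x = 1.

(* delta Omega (X), computed in the frame {E_i; phi E_i; xi} *)
Definition delta_Omega a (E : 'I_m -> field) X x : R :=
  g_of a (fun y => - phi_of a (nabla_acm a (xi a) (xi a)) y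
                   + \sum_i P_acm a (E i) (E i) y) X x.

Definition alpha_contact : Prop := exists2 alpha, alpha != 0 & d_eta_Omega alpha.

Definition quasi_contact : Prop :=
  for_fields2 (fun a X Y x =>
    P_acm a X Y x = (2 * g_of a X Y x) *: xi a x
      - eta_of a Y x *: (X x + eta_of a X x *: xi a x + h_tensor a X x)).

Definition quasi_K_Sasakian : Prop :=
  for_fields2 (fun a X Y x =>
    P_acm a X Y x = (2 * g_of a X Y x) *: xi a x - (2 * eta_of a Y x) *: X x
      + eta_of a Y x *: nabla_acm a (phi_of a X) (xi a) x).

Definition strongly_pseudoconvex_CR : Prop :=
  d_eta_Omega 1 /\
  for_fields2 (fun a X Y x =>
    let Xh := fun y => X y + h_tensor a X y in
    nabla_phi a X Y x = g_of a Xh Y x *: xi a x - eta_of a Y x *: Xh x).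

Definition alpha_Sasakian : Prop :=
  (exists2 alpha, alpha != 0 & d_eta_Omega alpha) /\ normal_acm.

Definition quasi_Sasakian : Prop :=
  [/\ normal_acm, d_Omega_zero & exists2 r, 1 <= r <= m.-1 & eta_rank r]%N.

Definition nearly_alpha_Sasakian : Prop :=
  exists2 alpha : R, alpha != 0 &
  for_fields2 (fun a X Y x =>
    Q_acm a X Y x = alpha *: ((2 * g_of a X Y x) *: xi a x
                              - eta_of a Y x *: X x - eta_of a X x *: Y x)).

Definition semi_Sasakian : Prop :=
  normal_acm /\
  forall a U, in_chart a U -> forall (E : 'I_m -> field) X,
  phi_frame a U E -> smooth_mx_on U X -> forall x, U x ->
    delta_Omega a E X x = 2 * m%:R * eta_of a X x.

Definition cosymplectic : Prop := [/\ d_eta_zero, d_Omega_zero & normal_acm].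

Definition almost_cosymplectic : Prop := d_eta_zero /\ d_Omega_zero.

Definition nearly_cosymplectic : Prop :=
  for_fields1 (fun a X x => nabla_phi a X X x = 0).

Definition nearly_K_cosymplectic : Prop :=
  nearly_cosymplectic /\
  for_fields1 (fun a X x => nabla_phi a X (xi a) x = 0).

Definition quasi_K_cosymplectic : Prop :=
  for_fields2 (fun a X Y x =>
    P_acm a X Y x = eta_of a Y x *: nabla_acm a (phi_of a X) (xi a) x).

Definition class_A1 : Prop :=
  [\/ alpha_contact, quasi_contact, quasi_K_Sasakian
    | strongly_pseudoconvex_CR \/ alpha_Sasakian].
Definition class_A4 : Prop := quasi_Sasakian.
Definition class_A6 : Prop := nearly_alpha_Sasakian.
Definition class_A7 : Prop := semi_Sasakian.
Definition class_B1 : Prop :=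
  [\/ cosymplectic, almost_cosymplectic, nearly_cosymplectic
    | nearly_K_cosymplectic \/ quasi_K_cosymplectic].

End AlmostContact.

Section AlmostHermitian.
Variables (R : realType) (n : nat) (N : ah_manifold R n).
Notation field := ('rV[R]_n.*2 -> 'rV[R]_n.*2).
Implicit Types (a : chart N) (X Y Z : field) (x : 'rV[R]_n.*2).

Definition J_of a X : field := app_end (acs a) X.
Definition nabla_J a X Y : field := nabla_end (metric a) (acs a) X Y.
Definition Kaehler_form a X Y x : R := inner (metric a x) (X x) (J_of a Y x).

Definition Kaehler : Prop := for_fields2 (fun a X Y x => nabla_J a X Y x = 0).
Definition nearly_Kaehler : Prop :=
  for_fields1 (fun a X x => nabla_J a X X x = 0).
Definition almost_Kaehler : Prop :=
  for_fields3 (fun a X Y Z x => d_two_form (@Kaehler_form a) X Y Z x = 0).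
Definition quasi_Kaehler : Prop :=
  for_fields1 (fun a X x =>
    nabla_J a (J_of a X) X x - nabla_J a X (J_of a X) x = 0).

Definition class_C1 : Prop :=
  [\/ Kaehler, nearly_Kaehler, almost_Kaehler | quasi_Kaehler].

End AlmostHermitian.

Section Maps.
Variables (R : realType) (d e : nat).
Variables (M : riem_manifold R d) (N : riem_manifold R e) (f : M -> N).

Definition local_rep (a : chart M) (b : chart N) : 'rV[R]_d -> 'rV[R]_e :=
  fun x => crd b (f (par a x)).

Definition local_dom (a : chart M) (b : chart N) : set 'rV[R]_d :=
  [set x | cod a x /\ dom b (f (par a x))].

Definition smooth_map : Prop :=
  continuous f /\ forall a b, smooth_mx_on (local_dom a b) (local_rep a b).

Definition harmonic_map : Prop :=
  forall a b x, local_dom a b x ->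
    tension (metric a) (metric b) (local_rep a b) x = 0.

Definition conformal_with (mu : M -> R) : Prop :=
  (forall p, 0 <= mu p) /\
  forall a b x, local_dom a b x -> forall u v,
    inner (metric b (local_rep a b x))
      ('D_u (local_rep a b) x) ('D_v (local_rep a b) x)
    = mu (par a x) ^+ 2 * inner (metric a x) u v.

Definition weakly_conformal : Prop := exists mu, conformal_with mu.

Definition homothetic : Prop := exists c : R, conformal_with (fun=> c).

Definition immersion : Prop :=
  forall a b x, local_dom a b x -> forall u,
    'D_u (local_rep a b) x = 0 -> u = 0.

(* A homothetic map of a connected manifold is an immersion or is constant; in
   the latter case its image is a point. *)
Definition minimal_image : Prop :=
  (exists q, forall p, f p = q) \/
  (immersion /\
   forall a b x, local_dom a b x -> forall nu : 'rV[R]_e,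
     (forall u, inner (metric b (local_rep a b x))
                  ('D_u (local_rep a b) x) nu = 0) ->
     inner (metric b (local_rep a b x))
       (mean_curvature_trace (metric b) (local_rep a b) x) nu = 0).

(* f_* A = eps B f_* *)
Definition intertwines (eps : R) (A : chart M -> 'rV[R]_d -> 'M[R]_d)
    (B : chart N -> 'rV[R]_e -> 'M[R]_e) : Prop :=
  forall a b x, local_dom a b x -> forall u,
    'D_(u *m A a x) (local_rep a b) x =
    eps *: ('D_u (local_rep a b) x *m B b (local_rep a b x)).

Definition pm_holomorphic (A : chart M -> 'rV[R]_d -> 'M[R]_d)
    (B : chart N -> 'rV[R]_e -> 'M[R]_e) : Prop :=
  intertwines 1 A B \/ intertwines (-1) A B.

End Maps.

Definition D_pluriharmonic (R : realType) (m e : nat) (M : acm_manifold R m)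
    (N : riem_manifold R e) (f : M -> N) : Prop :=
  forall (a : chart M) (b : chart N) U, in_chart a U -> U `<=` local_dom f a b ->
  forall X, smooth_mx_on U X -> (forall x, U x -> eta_of a X x = 0) ->
  forall x, U x ->
    second_fundamental_form (metric a) (metric b) (local_rep f a b) X X x
    + second_fundamental_form (metric a) (metric b) (local_rep f a b)
        (phi_of a X) (phi_of a X) x = 0.

(* Main.v *)
(** Differentiating f_* phi = eps psi f_* expresses the second fundamental form
    B of f through the covariant derivatives of phi and psi:

      B(u, phi v) = eps (nabla_{f_*u} psi) f_*v + eps psi B(u, v)
                    - f_* (nabla_u phi) v.

    Using it for (u, u) and (phi u, phi u) with u in D = ker eta, symmetry of B
    cancels the left-hand sides and leaves

      psi (B(u, u) + B(phi u, phi u)) = - P(f_*u, f_*u) + eps f_* P(u, u),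

    where P(u, u) = (nabla_u phi) u + (nabla_{phi u} phi) phi u.  In all classes
    but the semi-Sasakian one P(u, u) is a multiple of the Reeb field, which psi
    kills; for d Omega = 0 this is the almost Kaehler => quasi-Kaehler argument.
    The component along the Reeb field of the target is controlled by
    sigma o f_* = lambda eta: its derivative involves only
    (nabla_u eta) u + (nabla_{phi u} eta) phi u, which vanishes in these classes.
    Finally B(xi, xi) = (xi lambda) gamma, and d lambda vanishes on D because the
    Reeb curves are geodesics on both sides; as d eta <> 0 on D, the symmetry of
    second derivatives gives d lambda = 0.  So f is D-pluriharmonic and harmonic.

    A semi-Sasakian source satisfies these conditions in the trace only: P has
    trace 2m xi by assumption, and div xi = 0 since the double divergence of the
    skew tensor phi is zero (delta delta Omega = 0).

    If f is weakly conformal with factor mu then mu^2 = lambda^2 is locally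
    constant, so f is homothetic; being harmonic, its mean curvature vanishes. *)

From HB Require Import structures.
From mathcomp Require Import all_boot all_order all_algebra.
From mathcomp Require Import all_classical all_reals all_analysis.
From mathcomp Require Import ring lra.
Require Import Defs.

Set Implicit Arguments.
Unset Strict Implicit.
Unset Printing Implicit Defensive.

Import Order.TTheory GRing.Theory Num.Theory.
Import numFieldNormedType.Exports.

Local Open Scope classical_set_scope.
Local Open Scope ring_scope.

(** Pointwise algebra is separated from calculus. [acm_point] and [ah_point] hold structure tensors
    and their first covariant derivatives at one point, and the contact class identities are reduced
    there to four conditions: [geodesic], [quasi], [trace_free] and [twisted]. The identities are
    tensorial, so they are tested on constant fields of a chart, or on xi where the Reeb curves must
    be shown to be geodesics. Second-order information enters at three places: d d eta = 0 gives d
    Omega = 0 for alpha-contact manifolds, second derivatives of lambda commute, and the double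
    divergence of phi vanishes. [twisted] separates sources from targets: manifolds with d eta = 0
    are admissible targets, but on such a source nothing would force the Reeb derivative of lambda
    to vanish. The semi-Sasakian class is stated in local frames. It therefore requires smooth
    phi-frames, built by a Gram-Schmidt process that respects phi, and it supplies only trace
    identities. For this reason the central computation is done for a sum over a family of
    horizontal vectors: a whole frame yields the tension field, a single vector yields
    D-pluriharmonicity. *)

Section MeanValue.
Variables (R : realType) (V : normedModType R).
Implicit Types (u : V -> R) (x y v w : V).

(** * Mean values along lines and symmetry of second derivatives *)

Lemma derive_line u y v (t : R) :
  derivable u (t *: v + y) v ->
  is_derive t 1 (fun s => u (s *: v + y)) ('D_v u (t *: v + y)).
Proof.
move=> du.
have E : (fun h : R => h^-1 *: (((fun s => u (s *: v + y)) \o shift t) (h *: 1)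
            - u (t *: v + y)))
  = (fun h : R => h^-1 *: ((u \o shift (t *: v + y)) (h *: v) - u (t *: v + y))).
  by apply/funext => h /=; rewrite [h *: 1]mulr1 scalerDl addrA.
by apply: DeriveDef; rewrite /derivable /derive E.
Qed.

Lemma mean_value_line u y v (s : R) :
  (forall t, `|t| <= `|s| -> derivable u (t *: v + y) v) ->
  exists2 c, `|c| <= `|s| & u (s *: v + y) - u y = s * 'D_v u (c *: v + y).
Proof.
move=> du; pose g (t : R) := u (t *: v + y).
have dg (t : R) : `|t| <= `|s| -> is_derive t 1 g ('D_v u (t *: v + y)).
  by move=> ts; apply: derive_line; exact: du.
have g0 : g 0 = u y by rewrite /g scale0r add0r.
have cg (a b : R) : (forall t : R, t \in `[a, b]%R -> `|t| <= `|s|) ->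
    {within `[a, b], continuous g}.
  move=> ab; apply: derivable_within_continuous => t tab.
  by have [] := dg t (ab t tab).
case: (leP 0 s) => s0.
- have b (t : R) : t \in `[0, s]%R -> `|t| <= `|s|.
    by rewrite in_itv/= => /andP[? ?]; rewrite !ger0_norm.
  have [||c cs E] := @MVT_segment R g (fun t => 'D_v u (t *: v + y)) 0 s s0.
  + by move=> t ts; apply: dg; apply: b; exact: subset_itv_oo_cc.
  + exact: cg.
  + by exists c; [exact: b|rewrite -g0 E subr0 mulrC].
- have b (t : R) : t \in `[s, 0]%R -> `|t| <= `|s|.
    by rewrite in_itv/= => /andP[? ?]; rewrite !ler0_norm ?lerN2 // ltW.
  have [||c cs E] := @MVT_segment R g (fun t => 'D_v u (t *: v + y)) s 0 (ltW s0).
  + by move=> t ts; apply: dg; apply: b; exact: subset_itv_oo_cc.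
  + exact: cg.
  + exists c; [exact: b|rewrite -g0 -opprB E sub0r mulrN opprK mulrC //].
Qed.

(** The mean value theorem is applied twice: along [v] to the difference of [u] over [t *: w], then
    along [w] to ['D_v u]. The bound on [p] lets continuity of the mixed derivative at [x] take over
    as [t] tends to 0. *)
Lemma second_difference u x v w :
  (\forall y \near x, derivable u y v) ->
  (\forall y \near x, derivable ('D_v u) y w) ->
  exists2 r : R, 0 < r & forall t, `|t| < r ->
    exists2 p, `|p| <= `|t| * (`|v| + `|w|) &
      u (t *: v + (t *: w + x)) - u (t *: v + x) - u (t *: w + x) + u x
      = t * t * 'D_w ('D_v u) (p + x).
Proof.
move=> /nbhs_ballP[r1 /= r1_gt0 H1] /nbhs_ballP[r2 /= r2_gt0 H2].
pose r0 := Num.min r1 r2; have r0_gt0 : 0 < r0 by rewrite lt_min r1_gt0.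
(* The summand 1 keeps the divisor positive when [v] and [w] both vanish. *)
pose C := 1 + (`|v| + `|w|).
have C0 : 0 < C by rewrite ltr_pwDl // addr_ge0.
have near_x (t a b : R) : `|t| < r0 / C -> `|a| <= `|t| -> `|b| <= `|t| ->
    ball x r0 (a *: v + (b *: w + x)).
  move=> tr at_ bt; rewrite -ball_normE /= addrA opprD addrCA subrr addr0 normrN.
  apply: le_lt_trans (ler_normD _ _) _; rewrite !normrZ.
  apply: (@le_lt_trans _ _ (`|t| * (`|v| + `|w|))).
    by rewrite mulrDr lerD // ler_wpM2r.
  apply: (@le_lt_trans _ _ (`|t| * C)); first by rewrite ler_wpM2l // lerDr.
  by rewrite -ltr_pdivlMr.
have b1 z : ball x r0 z -> derivable u z v.
  by move=> zb; apply: H1; apply: le_ball zb; rewrite ge_min lexx.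
have b2 z : ball x r0 z -> derivable ('D_v u) z w.
  by move=> zb; apply: H2; apply: le_ball zb; rewrite ge_min lexx orbT.
exists (r0 / C); first exact: divr_gt0.
move=> t tr; pose q y := u (t *: w + y) - u y.
have sh z (c : V) : derivable u (c + z) v ->
    derivable (fun y => u (c + y)) z v /\
    'D_v (fun y => u (c + y)) z = 'D_v u (c + z).
  move=> du.
  have E : (fun h : R => h^-1 *: (((fun y => u (c + y)) \o shift z) (h *: v)
      - u (c + z))) =
    (fun h : R => h^-1 *: ((u \o shift (c + z)) (h *: v) - u (c + z))).
    by apply/funext => h /=; rewrite addrCA.
  by rewrite /derivable /derive E.
have dq (s : R) : `|s| <= `|t| -> is_derive (s *: v + x) v q
    ('D_v u (t *: w + (s *: v + x)) - 'D_v u (s *: v + x)).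
  move=> st.
  have d1 : derivable u (t *: w + (s *: v + x)) v.
    by apply: b1; rewrite addrCA; apply: (near_x t).
  have d2 : derivable u (s *: v + x) v.
    by apply: b1; rewrite -[X in _ + X]add0r -(scale0r w); apply: (near_x t);
      rewrite ?normr0.
  have [d3 <-] := sh _ _ d1.
  apply: DeriveDef; first exact: derivableB.
  by rewrite /q deriveB.
have [|c ct E1] := @mean_value_line q x v t.
  by move=> s st; have [] := dq s st.
have [|c' c't E2] := @mean_value_line ('D_v u) (c *: v + x) w t.
  by move=> s st; apply: b2; rewrite addrCA; apply: (near_x t).
exists (c' *: w + c *: v).
  apply: le_trans (ler_normD _ _) _; rewrite !normrZ addrC mulrDr lerD //;
  exact: ler_wpM2r.
have [_ dqE] := dq c ct.
rewrite -[c' *: w + _ + x]addrA -mulrA -E2 -dqE -E1 /q.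
by rewrite [t *: v + (t *: w + x)]addrCA opprB -addrA [- _ + u x]addrC.
Qed.

(** The second difference is symmetric in [v] and [w], so after division by [t * t] the two mixed
    derivatives agree at suitable points near [x]; continuity puts each within [e / 2] of its value
    at [x]. *)
Lemma derive_comm u x v w :
  (\forall y \near x, derivable u y v) ->
  (\forall y \near x, derivable u y w) ->
  (\forall y \near x, derivable ('D_v u) y w) ->
  (\forall y \near x, derivable ('D_w u) y v) ->
  {for x, continuous ('D_w ('D_v u))} -> {for x, continuous ('D_v ('D_w u))} ->
  'D_w ('D_v u) x = 'D_v ('D_w u) x.
Proof.
move=> du1 du2 dv dw cv cw.
apply/eqP; rewrite -subr_eq0 -normr_le0; apply/ler_addgt0Pr => e e0.
rewrite add0r.
have e2 : 0 < e / 2 by rewrite divr_gt0.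
have [r1 r1_gt0 S1] := second_difference du1 dv.
have [r2 r2_gt0 S2] := second_difference du2 dw.
move/cvgrPdist_le : cv => /(_ _ e2) /nbhs_ballP[r3 /= r3_gt0 H3].
move/cvgrPdist_le : cw => /(_ _ e2) /nbhs_ballP[r4 /= r4_gt0 H4].
pose C := 1 + (`|v| + `|w|).
have C0 : 0 < C by rewrite ltr_pwDl // addr_ge0.
pose r := Num.min (Num.min r1 r2) (Num.min (r3 / C) (r4 / C)).
have r_gt0 : 0 < r by rewrite !lt_min r1_gt0 r2_gt0 !divr_gt0.
pose t := r / 2.
have t0 : 0 < t by rewrite divr_gt0.
have tr : t < r by rewrite /t ltr_pdivrMr // ltr_pMr // ltr1n.
have := tr; rewrite !lt_min => /andP[/andP[t1 t2] /andP[t3 t4]].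
have [|p ps E1] := S1 t; first by rewrite gtr0_norm.
have [|p' p's E2] := S2 t; first by rewrite gtr0_norm.
have bd q rr : t < rr / C -> `|q| <= `|t| * (`|v| + `|w|) -> ball x rr (q + x).
  move=> tt qs; rewrite -ball_normE /= opprD addrCA subrr addr0 normrN.
  apply: le_lt_trans qs _; rewrite gtr0_norm //.
  apply: (@le_lt_trans _ _ (t * C)); first by rewrite ler_pM2l // lerDr.
  by rewrite -ltr_pdivlMr.
have h3 := H3 _ (bd _ _ t3 ps).
rewrite [`|w| + _]addrC in p's.
have h4 := H4 _ (bd _ _ t4 p's).
have E : 'D_w ('D_v u) (p + x) = 'D_v ('D_w u) (p' + x).
  apply: (@mulfI _ (t * t)); first by rewrite mulf_neq0 // gt_eqF.
  apply: etrans (esym E1) (etrans _ E2).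
  by rewrite [t *: w + (t *: v + x)]addrCA; congr (_ + _); exact: addrAC.
rewrite -(subrKA ('D_w ('D_v u) (p + x))) (splitr e).
apply: le_trans (ler_normD _ _) (lerD h3 _).
rewrite E distrC; exact: h4.
Qed.

End MeanValue.

(** * Continuous partial derivatives imply Frechet differentiability *)

Section Smooth.
Variables (R : realType).

Lemma differentiable_expansion (V W : normedModType R) (f : V -> W)
    (df : {linear V -> W}) x :
  continuous df -> f \o shift x = cst (f x) + df +o_ 0 id ->
  differentiable f x.
Proof. by move=> c e; apply/diff_locallyP; rewrite (diff_unique c e). Qed.

Lemma norm_basis_vec d (i : 'I_d) : `|basis_vec R i| <= 1.
Proof.
rewrite [leLHS]/Num.Def.normr/= mx_normrE; apply: bigmax_le => //= -[j k] _.
by rewrite mxE; case: (_ && _); rewrite ?normr1 ?normr0.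
Qed.

Lemma norm_coord d (h : 'rV[R]_d) i : `|h 0 i| <= `|h|.
Proof.
by rewrite [leRHS]/Num.Def.normr/= mx_normrE; exact: (le_bigmax _ _ (0, i)).
Qed.

(** The corners of the staircase path from 0 to [h] parallel to the coordinate axes. *)
Definition truncate_row d (k : nat) (h : 'rV[R]_d) : 'rV[R]_d :=
  \row_j (if (j < k)%N then h 0 j else 0).

Lemma truncate_row0 d (h : 'rV[R]_d) : truncate_row 0 h = 0.
Proof. by apply/rowP => j; rewrite !mxE. Qed.

Lemma truncate_row_full d (h : 'rV[R]_d) : truncate_row d h = h.
Proof. by apply/rowP => j; rewrite !mxE ltn_ord. Qed.

Lemma truncate_rowS d (k : 'I_d) (h : 'rV[R]_d) :
  truncate_row k.+1 h = h 0 k *: basis_vec R k + truncate_row k h.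
Proof.
apply/rowP => j; rewrite !mxE ltnS leq_eqVlt eqxx /=.
rewrite -val_eqE /=; have [/val_inj ->|jk] := eqVneq (val j) (val k).
  by rewrite /= mulr1 ltnn addr0.
by rewrite /= mulr0 add0r.
Qed.

Lemma norm_truncate_row d k (h : 'rV[R]_d) : `|truncate_row k h| <= `|h|.
Proof.
rewrite [leLHS]/Num.Def.normr/= mx_normrE; apply: bigmax_le => //= -[j l] _ /=.
by rewrite mxE; case: ifP => _; rewrite ?normr0 // norm_coord.
Qed.

Lemma near0_norm d (P : 'rV[R]_d -> Prop) (e : R) :
  0 < e -> (forall h, `|h| < e -> P h) -> nbhs (0 : 'rV[R]_d) P.
Proof.
move=> e0 eP; apply/nbhs_ballP; exists e => //= h.
by rewrite -ball_normE /= sub0r normrN; exact: eP.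
Qed.

(** The increment of [u] telescopes along the staircase. Each step is a mean value along one axis,
    at a point where the partial derivative differs from its value at [x] by at most [e']. *)
Lemma partials_differentiable d (u : 'rV[R]_d -> R) (x : 'rV[R]_d) :
  (\forall y \near x, forall i, derivable u y (basis_vec R i)) ->
  (forall i, {for x, continuous ('D_(basis_vec R i) u)}) ->
  differentiable u x.
Proof.
move=> /nbhs_ballP[r /= r_gt0 du] cu.
pose c i := 'D_(basis_vec R i) u x.
pose df (h : 'rV[R]_d) := \sum_i h 0 i * c i.
have ldf : linear df.
  move=> a y z; rewrite /df scaler_sumr -big_split /=; apply: eq_bigr => i _.
  by rewrite !mxE mulrDl -mulrA.
pose dfM := GRing.isLinear.Build _ _ _ _ _ ldf.
pose dfL : {linear 'rV[R]_d -> R} := HB.pack df dfM.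
have cdf : continuous dfL.
  have bdf : bounded_near dfL (nbhs (0 : 'rV[R]_d)).
    exists (\sum_i `|c i|); split; first exact: ger0_real (sumr_ge0 _ _).
    move=> M sM; apply: (near0_norm ltr01) => h /ltW h1.
    apply: le_trans (ler_norm_sum _ _ _) (ltW _).
    apply: le_lt_trans sM; apply: ler_sum => i _; rewrite normrM ler_piMl //.
    exact: le_trans (norm_coord _ _) h1.
  exact: bounded_linear_continuous.
apply: (@differentiable_expansion _ _ _ dfL) => //.
apply/eqaddoP => _/posnumP[e].
(* The [d] steps contribute [d * e'] times the norm of [h]; the divisor [d.+1] is nonzero even for
   [d = 0]. *)
pose e' : R := e%:num / d.+1%:R.
have e'0 : 0 < e' by rewrite divr_gt0.
have : \forall y \near x, forall i, `|c i - 'D_(basis_vec R i) u y| <= e'.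
  apply: (@filter_forall _ _ (fun i y => `|c i - 'D_(basis_vec R i) u y| <= e') (nbhs x) (nbhs_filter x)) => i.
  have /cvgrPdist_le := cu i; exact.
move=> /nbhs_ballP[r' /= r'_gt0 cu'].
(* Halved because a point on the staircase is a corner plus a multiple of a basis vector, each of
   norm below [s]. *)
pose s := Num.min r r' / 2.
have s_gt0 : 0 < s by rewrite divr_gt0 // lt_min r_gt0.
apply: (near0_norm s_gt0) => h hs.
have in_ball (k : 'I_d) t : `|t| <= `|h 0 k| ->
    ball x (Num.min r r') (t *: basis_vec R k + (truncate_row k h + x)).
  move=> th; rewrite -ball_normE /= addrA opprD addrCA subrr addr0 normrN.
  apply: le_lt_trans (ler_normD _ _) _; rewrite [ltRHS]splitr ltrD //.
    apply: le_lt_trans hs; rewrite normrZ.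
    apply: le_trans (norm_coord h k); rewrite -[leRHS]mulr1.
    by apply: ler_pM => //; exact: norm_basis_vec.
  exact: le_lt_trans (norm_truncate_row _ _) hs.
rewrite /= (_ : (_ - _) h = u (h + x) - (u x + df h)) //.
rewrite opprD addrA.
have -> : u (h + x) - u x =
    \sum_(k < d) (u (truncate_row k.+1 h + x) - u (truncate_row k h + x)).
  rewrite -(big_mkord xpredT
    (fun k => u (truncate_row k.+1 h + x) - u (truncate_row k h + x))).
  by rewrite telescope_sumr // truncate_row0 truncate_row_full add0r.
rewrite /df -sumrB; apply: le_trans (ler_norm_sum _ _ _) _.
apply: (@le_trans _ _ (\sum_(k < d) e' * `|h|)); last first.
  rewrite sumr_const card_ord -[_ *+ d]mulr_natl mulrA ler_wpM2r //.
  rewrite /e' mulrCA ler_piMr // ler_pdivrMr // mul1r ler_nat //.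
apply: ler_sum => k _.
have [|t th E] := @mean_value_line R 'rV[R]_d u (truncate_row k h + x)
   (basis_vec R k) (h 0 k).
  move=> t th; apply: du; apply: le_ball (in_ball k t th).
  by rewrite ge_min lexx.
rewrite truncate_rowS -[_ *: _ + _ + x]addrA E -mulrBr normrM mulrC.
apply: ler_pM => //; last exact: norm_coord.
rewrite distrC; apply: cu'; apply: le_ball (in_ball k t th).
by rewrite ge_min lexx orbT.
Qed.

End Smooth.

(** * Rules of differentiation, for vector and matrix valued maps *)

Section DeriveRules.
Variables (R : realType) (V W : normedModType R).

Lemma deriveDv (f : V -> W) x (u v : V) :
  differentiable f x -> 'D_(u + v) f x = 'D_u f x + 'D_v f x.
Proof. by move=> df; rewrite !deriveE // linearD. Qed.

Lemma deriveZv (f : V -> W) x a (u : V) :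
  differentiable f x -> 'D_(a *: u) f x = a *: 'D_u f x.
Proof. by move=> df; rewrite !deriveE // linearZ. Qed.

Lemma deriveNv (f : V -> W) x (u : V) :
  differentiable f x -> 'D_(- u) f x = - 'D_u f x.
Proof. by move=> df; rewrite !deriveE // linearN. Qed.

Lemma derive_compose (U : normedModType R) (f : U -> V) (g : V -> W) x v :
  differentiable f x -> differentiable g (f x) ->
  'D_v (fun y => g (f y)) x = 'D_('D_v f x) g (f x).
Proof.
move=> df dg; rewrite [LHS](_ : _ = 'D_v (g \o f) x) // deriveE; last first.
  exact: differentiable_comp.
by rewrite diff_comp // [in RHS]deriveE // [in RHS]deriveE.
Qed.

Lemma derivable_bigsum (I : finType) (f : I -> V -> W) x v :
  (forall i, derivable (f i) x v) -> derivable (fun y => \sum_i f i y) x v.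
Proof.
move=> df; have -> : (fun y => \sum_i f i y) = \sum_(i < #|I|) f (enum_val i).
  apply/funext => y; rewrite fct_sumE (reindex (@enum_val I predT)) //.
  by apply: onW_bij; exact: enum_val_bij.
exact: derivable_sum.
Qed.

Lemma derive_bigsum (I : finType) (f : I -> V -> W) x v :
  (forall i, derivable (f i) x v) ->
  'D_v (fun y => \sum_i f i y) x = \sum_i 'D_v (f i) x.
Proof.
move=> df; have -> : (fun y => \sum_i f i y) = \sum_(i < #|I|) f (enum_val i).
  apply/funext => y; rewrite fct_sumE (reindex (@enum_val I predT)) //.
  by apply: onW_bij; exact: enum_val_bij.
rewrite derive_sum // [RHS](reindex (@enum_val I predT)) //.
by apply: onW_bij; exact: enum_val_bij.
Qed.

Lemma differentiable_bigsum (I : finType) (f : I -> V -> W) x :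
  (forall i, differentiable (f i) x) ->
  differentiable (fun y => \sum_i f i y) x.
Proof.
move=> df; have -> : (fun y => \sum_i f i y) = \sum_(i < #|I|) f (enum_val i).
  apply/funext => y; rewrite fct_sumE (reindex (@enum_val I predT)) //.
  by apply: onW_bij; exact: enum_val_bij.
exact: differentiable_sum.
Qed.

End DeriveRules.

Section DeriveMatrix.
Variables (R : realType) (V : normedModType R).

Lemma differentiable_mxP p q (A : V -> 'M[R]_(p, q)) x :
  (forall i j, differentiable (fun y => A y i j) x) <-> differentiable A x.
Proof.
split=> [dA|dA i j].
  have -> : A = (fun y => \sum_(k : 'I_p * 'I_q)
                    A y k.1 k.2 *: (delta_mx k.1 k.2 : 'M[R]_(p, q))).
    apply/funext => y; rewrite [LHS]matrix_sum_delta pair_big /=.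
    by apply: eq_bigr.
  apply: differentiable_bigsum => k.
  exact: (@differentiableZl R V 'M[R]_(p, q) (fun y => A y k.1 k.2)).
have -> : (fun y => A y i j) = (fun M : 'M[R]_(p, q) => M i j) \o A by [].
exact: differentiable_comp dA (differentiable_coord _ _ _).
Qed.

Lemma derive_entry p q (A : V -> 'M[R]_(p, q)) x v i j :
  derivable A x v -> 'D_v A x i j = 'D_v (fun y => A y i j) x.
Proof. by move=> dA; rewrite derive_mx // mxE. Qed.

Lemma derivable_entry p q (A : V -> 'M[R]_(p, q)) x v i j :
  derivable A x v -> derivable (fun y => A y i j) x v.
Proof. by move/derivable_mxP; exact. Qed.

Lemma derivable_mulmx p q r (A : V -> 'M[R]_(p, q)) (B : V -> 'M[R]_(q, r)) x v :
  derivable A x v -> derivable B x v ->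
  derivable (fun y => A y *m B y) x v.
Proof.
move=> dA dB; apply/derivable_mxP => i j.
rewrite (_ : (fun y => _) = (fun y => \sum_k A y i k * B y k j)); last first.
  by apply/funext => y; rewrite mxE.
apply: derivable_bigsum => k.
by apply: derivableM; exact: derivable_entry.
Qed.

Lemma derive_mulmx p q r (A : V -> 'M[R]_(p, q)) (B : V -> 'M[R]_(q, r)) x v :
  derivable A x v -> derivable B x v ->
  'D_v (fun y => A y *m B y) x = 'D_v A x *m B x + A x *m 'D_v B x.
Proof.
move=> dA dB; apply/matrixP => i j.
rewrite derive_entry; last exact: derivable_mulmx.
rewrite (_ : (fun y => _) = (fun y => \sum_k A y i k * B y k j)); last first.
  by apply/funext => y; rewrite mxE.
rewrite derive_bigsum; last first.
  by move=> k; apply: derivableM; exact: derivable_entry.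
rewrite !mxE -big_split /=; apply: eq_bigr => k _.
rewrite (@deriveM _ _ (fun y => A y i k) (fun y => B y k j)); last 2 first.
- exact: derivable_entry.
- exact: derivable_entry.
rewrite (derive_entry _ _ dA) (derive_entry _ _ dB) addrC.
by congr (_ + _); exact: mulrC.
Qed.

Lemma derivable_trmx p q (A : V -> 'M[R]_(p, q)) x v :
  derivable A x v -> derivable (fun y => (A y)^T) x v.
Proof.
move=> dA; apply/derivable_mxP => i j.
rewrite (_ : (fun y => _) = (fun y => A y j i)); last first.
  by apply/funext => y; rewrite mxE.
exact: derivable_entry.
Qed.

Lemma derive_trmx p q (A : V -> 'M[R]_(p, q)) x v :
  derivable A x v -> 'D_v (fun y => (A y)^T) x = ('D_v A x)^T.
Proof.
move=> dA; apply/matrixP => i j; rewrite mxE derive_entry; last first.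
  exact: derivable_trmx.
rewrite derive_entry //; congr ('D_v _ x); apply/funext => y.
by rewrite mxE.
Qed.

Lemma derivable_scalar_mx p (s : V -> R) x v :
  derivable s x v -> derivable (fun y => (s y)%:M : 'M[R]_p) x v.
Proof.
move=> ds; apply/derivable_mxP => i j.
rewrite (_ : (fun y => _) = (fun y => s y *+ (i == j))); last first.
  by apply/funext => y; rewrite mxE.
by case: (i == j); [exact: ds | exact: derivable_cst].
Qed.

Lemma derive_scale p q (s : V -> R) (A : V -> 'M[R]_(p, q)) x v :
  derivable s x v -> derivable A x v ->
  'D_v (fun y => s y *: A y) x = 'D_v s x *: A x + s x *: 'D_v A x.
Proof.
move=> ds dA; have dsm := @derivable_scalar_mx p s x v ds.
rewrite (_ : (fun y => _) = (fun y => (s y)%:M *m A y)); last first.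
  by apply/funext => y; rewrite mul_scalar_mx.
rewrite derive_mulmx // mul_scalar_mx; congr (_ + _).
have -> : 'D_v (fun y => (s y)%:M : 'M[R]_p) x = ('D_v s x)%:M.
  apply/matrixP => i j; rewrite derive_entry // mxE.
  rewrite (_ : (fun y => _) = (fun y => s y *+ (i == j))); last first.
    by apply/funext => y; rewrite mxE.
  by case: (i == j) => //; rewrite derive_cst.
by rewrite mul_scalar_mx.
Qed.

End DeriveMatrix.

(** * Closure properties of smooth functions on an open set *)

Section SmoothFunctions.
Variable R : realType.

Lemma derive_coords d (W : normedModType R) (f : 'rV[R]_d -> W) x v :
  differentiable f x -> 'D_v f x = \sum_i v 0 i *: 'D_(basis_vec R i) f x.
Proof.
move=> df; rewrite [v in LHS]row_sum_delta deriveE // linear_sum.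
by apply: eq_bigr => i _; rewrite linearZ deriveE.
Qed.

(* For open [U], smoothness in the sense of continuous iterated partials amounts
   to Frechet differentiability of all iterated partials ([smooth_onP]), which is
   stable under the usual operations by a direct induction. *)
Fixpoint ndiff (k : nat) d (U : set 'rV[R]_d) (u : 'rV[R]_d -> R) : Prop :=
  if k is k'.+1 then
    (forall x, U x -> differentiable u x) /\
    forall i, ndiff k' U ('D_(basis_vec R i) u)
  else True.

Lemma ndiffS k d (U : set 'rV[R]_d) u : ndiff k.+1 U u -> ndiff k U u.
Proof.
elim: k u => [//|k IH] u [du dDu]; split=> // i; apply: IH; exact: dDu.
Qed.

Lemma smooth_on_partial d (U : set 'rV[R]_d) u i :
  smooth_on U u -> smooth_on U ('D_(basis_vec R i) u).
Proof. by move=> su s; exact: (su (i :: s)). Qed.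

Lemma smooth_on_differentiable d (U : set 'rV[R]_d) u x :
  open U -> smooth_on U u -> U x -> differentiable u x.
Proof.
move=> oU su Ux; apply: partials_differentiable.
  have nU : \forall y \near x, U y by exact: open_nbhs_nbhs.
  by apply: filterS nU => y Uy i; have [_] := su [::] y Uy; exact.
by move=> i; have [] := su [:: i] x Ux.
Qed.

Lemma smooth_onP d (U : set 'rV[R]_d) u : open U ->
  smooth_on U u <-> forall k, ndiff k U u.
Proof.
move=> oU; split=> [su k|nu s].
  elim: k u su => [//|k IH] u su; split=> [x Ux|i].
    exact: smooth_on_differentiable su Ux.
  by apply: IH; exact: smooth_on_partial.
elim: s u nu => [|i s IH] u nu x Ux /=.
  have [/(_ x Ux) du _] := nu 1%N; split; first exact: differentiable_continuous.
  by move=> i; exact: diff_derivable.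
by apply: IH => // k; have [_] := nu k.+1; apply.
Qed.

Section OpenSet.
Variables (d : nat) (U : set 'rV[R]_d).
Hypothesis oU : open U.
Implicit Types u v : 'rV[R]_d -> R.

Lemma near_in x : U x -> \forall y \near x, U y.
Proof. by move=> Ux; exact: open_nbhs_nbhs. Qed.

Lemma derive_eq_on (W : normedModType R) (f g : 'rV[R]_d -> W) x w :
  U x -> (forall y, U y -> f y = g y) -> 'D_w f x = 'D_w g x.
Proof.
move=> Ux fg; apply: near_eq_derive.
by apply: filterS (near_in Ux) => y; exact: fg.
Qed.

Lemma differentiable_eq_on (W : normedModType R) (f g : 'rV[R]_d -> W) x :
  U x -> (forall y, U y -> f y = g y) -> differentiable f x ->
  differentiable g x.
Proof.
move=> Ux fg /diff_locallyP[cf ef].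
apply: (@differentiable_expansion _ _ _ g ('d f x) x cf).
apply/eqaddoP => e e0; move/eqaddoP : ef => /(_ e e0); rewrite (fg x Ux).
have nU : nbhs (0 : 'rV[R]_d) (fun h => U (h + x)).
  have /nbhs_ballP[r /= r0 rU] := near_in Ux; apply: (near0_norm r0) => h hr.
  by apply: rU; rewrite -ball_normE /= opprD addrCA subrr addr0 normrN.
apply: filterS2 nU => h Uh.
rewrite (_ : (_ - _) h = f (h + x) - (cst (g x) + 'd f x) h) //.
by rewrite (_ : (_ - _) h = g (h + x) - (cst (g x) + 'd f x) h) // (fg _ Uh).
Qed.

(** Derivative rules compute a partial only at points of [U], so the inductions below must be able
    to replace a function by another that agrees with it on [U]. *)
Lemma ndiff_eq_on k u v :
  (forall y, U y -> u y = v y) -> ndiff k U u -> ndiff k U v.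
Proof.
elim: k u v => [//|k IH] u v uv [du dDu]; split=> [x Ux|i].
  exact: differentiable_eq_on (du x Ux).
by apply: IH (dDu i) => y Uy; exact: derive_eq_on.
Qed.

Lemma ndiff_cst k (c : R) : ndiff k U (fun=> c).
Proof.
elim: k c => [//|k IH] c; split=> [x _|i]; first exact: differentiable_cst.
by apply: ndiff_eq_on (IH 0) => y _; rewrite derive_cst.
Qed.

Lemma ndiffD k u v :
  ndiff k U u -> ndiff k U v -> ndiff k U (fun x => u x + v x).
Proof.
elim: k u v => [//|k IH] u v [du dDu] [dv dDv]; split=> [x Ux|i].
  by apply: differentiableD; [exact: du|exact: dv].
apply: ndiff_eq_on (IH _ _ (dDu i) (dDv i)) => y Uy.
by rewrite deriveD //; apply: diff_derivable; [exact: du|exact: dv].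
Qed.

Lemma ndiffM k u v :
  ndiff k U u -> ndiff k U v -> ndiff k U (fun x => u x * v x).
Proof.
elim: k u v => [//|k IH] u v nu nv.
have [[du dDu] [dv dDv]] := (nu, nv); split=> [x Ux|i].
  by apply: differentiableM; [exact: du|exact: dv].
apply: ndiff_eq_on (ndiffD (IH _ _ (ndiffS nu) (dDv i))
                           (IH _ _ (ndiffS nv) (dDu i))) => y Uy.
by rewrite (@deriveM _ _ u v) //; apply: diff_derivable; [exact: du|exact: dv].
Qed.

Lemma ndiff_sum k (I : finType) (u : I -> 'rV[R]_d -> R) :
  (forall i, ndiff k U (u i)) -> ndiff k U (fun x => \sum_i u i x).
Proof.
move=> nu; suff nus (s : seq I) : ndiff k U (fun x => \sum_(i <- s) u i x).
  exact: nus.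
elim: s => [|i s IH].
  by apply: ndiff_eq_on (ndiff_cst k 0) => y _; rewrite big_nil.
by apply: ndiff_eq_on (ndiffD (nu i) IH) => y _; rewrite big_cons.
Qed.

Lemma ndiffV k u : (forall x, U x -> u x != 0) ->
  ndiff k U u -> ndiff k U (fun x => (u x)^-1).
Proof.
move=> u0; elim: k => [//|k IH] nu.
have [du dDu] := nu; split=> [x Ux|i].
  by apply: differentiableV; [exact: du|exact: u0].
have {}IH := IH (ndiffS nu).
apply: ndiff_eq_on (ndiffM (ndiffM (ndiff_cst k (-1)) (ndiffM IH IH)) (dDu i)).
move=> y Uy; rewrite deriveV ?u0 //; last exact/diff_derivable/du.
by rewrite -exprVn mulN1r.
Qed.

Lemma ndiff_sqrt k u : (forall x, U x -> 0 < u x) ->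
  ndiff k U u -> ndiff k U (fun x => Num.sqrt (u x)).
Proof.
move=> u0; elim: k => [//|k IH] nu.
have [du dDu] := nu.
have ds y : U y -> differentiable (@Num.sqrt R) (u y).
  by move=> Uy; have [/derivable1_diffP] := is_derive1_sqrt (u0 y Uy).
split=> [x Ux|i].
  by apply: (@differentiable_comp _ _ _ _ u (@Num.sqrt R)); [exact: du|exact: ds].
have {}IH := IH (ndiffS nu).
have n0 : forall x, U x -> 2 * Num.sqrt (u x) != 0.
  by move=> x Ux; rewrite mulf_neq0 ?pnatr_eq0 // gt_eqF // sqrtr_gt0 u0.
apply: ndiff_eq_on (ndiffM (dDu i) (ndiffV n0 (ndiffM (ndiff_cst k 2) IH))).
move=> y Uy; rewrite (@derive_compose _ _ _ _ u (@Num.sqrt R)); last 2 first.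
- exact: du.
- exact: ds.
set c := 'D__ u y; rewrite [in RHS](_ : c = c *: (1 : R)); last first.
  by rewrite [RHS]mulr1.
rewrite deriveZv; last exact: ds.
by have [_ ->] := is_derive1_sqrt (u0 y Uy).
Qed.

End OpenSet.

(** By the chain rule the partials are sums of products of partials of [F] with composites of
    partials of [u], so the induction lowers [k] while [F] stays fixed. *)
Lemma ndiff_comp k d e (U : set 'rV[R]_d) (V : set 'rV[R]_e)
    (F : 'rV[R]_d -> 'rV[R]_e) (u : 'rV[R]_e -> R) :
  open U -> (forall x, U x -> V (F x)) ->
  (forall j, ndiff k U (fun x => F x 0 j)) -> ndiff k V u ->
  ndiff k U (fun x => u (F x)).
Proof.
move=> oU UV; elim: k u => [//|k IH] u nF nu.
have [du dDu] := nu.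
have dF x : U x -> differentiable F x.
  move=> Ux; apply/differentiable_mxP => i j; rewrite ord1.
  by have [/(_ _ Ux)] := nF j.
split=> [x Ux|i].
  by apply: (@differentiable_comp _ _ _ _ F u); [exact: dF|exact/du/UV].
have nF' : forall j, ndiff k U (fun x => F x 0 j) by move=> j; exact: ndiffS.
apply: ndiff_eq_on (ndiff_sum oU (fun j : 'I_e =>
  ndiffM oU (proj2 (nF j) i) (IH _ nF' (dDu j)))) => // y Uy.
rewrite derive_compose; [|exact: dF|exact/du/UV].
rewrite derive_coords; last exact/du/UV.
apply: eq_bigr => j _; rewrite derive_entry //.
exact/diff_derivable/dF.
Qed.

End SmoothFunctions.

(** * Linear algebra of almost contact and almost Hermitian structures at a point *)

Section PointAlgebra.
Variable R : realFieldType.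

Record metric_space (V : lmodType R) := MetricSpace {
  ip : V -> V -> R;
  ipP : forall a u v w, ip (a *: u + v) w = a * ip u w + ip v w;
  ipC : forall u v, ip u v = ip v u;
  ip_gt0 : forall u, u != 0 -> 0 < ip u u
}.

Section MetricSpace.
Variables (V : lmodType R) (p : metric_space V).
Implicit Types u v w : V.

Lemma ipDl u v w : ip p (u + v) w = ip p u w + ip p v w.
Proof. by rewrite -[u]scale1r ipP mul1r scale1r. Qed.

Lemma ip0l w : ip p 0 w = 0.
Proof. by apply: (addrI (ip p 0 w)); rewrite -ipDl !addr0. Qed.

Lemma ipZl a u w : ip p (a *: u) w = a * ip p u w.
Proof. by rewrite -[a *: u]addr0 ipP ip0l addr0. Qed.

Lemma ipNl u w : ip p (- u) w = - ip p u w.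
Proof. by rewrite -scaleN1r ipZl mulN1r. Qed.

Lemma ipDr u v w : ip p w (u + v) = ip p w u + ip p w v.
Proof. by rewrite ![ip p w _]ipC ipDl. Qed.

Lemma ipZr a u w : ip p w (a *: u) = a * ip p w u.
Proof. by rewrite ![ip p w _]ipC ipZl. Qed.

Lemma ipNr u w : ip p w (- u) = - ip p w u.
Proof. by rewrite ![ip p w _]ipC ipNl. Qed.

Lemma ip0r w : ip p w 0 = 0.
Proof. by rewrite ipC ip0l. Qed.

Lemma ip_sumr (I : finType) (F : I -> V) w :
  ip p w (\sum_i F i) = \sum_i ip p w (F i).
Proof. by apply: (big_morph (ip p w)) => [? ?|]; rewrite ?ip0r ?ipDr. Qed.

Lemma ip_suml (I : finType) (F : I -> V) w :
  ip p (\sum_i F i) w = \sum_i ip p (F i) w.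
Proof. by rewrite ipC ip_sumr; apply: eq_bigr => i _; rewrite ipC. Qed.

Lemma ip_eq0 u : ip p u u = 0 -> u = 0.
Proof.
by have [->//|/(ip_gt0 p) + E] := eqVneq u 0; rewrite E ltxx.
Qed.

Lemma ip_ext u v : (forall w, ip p u w = ip p v w) -> u = v.
Proof.
move=> uv; apply/subr0_eq/ip_eq0.
by rewrite ipDl ipNl uv subrr.
Qed.

End MetricSpace.

Lemma affineD (V W : lmodType R) (f : V -> W) :
  (forall a u v, f (a *: u + v) = a *: f u + f v) -> {morph f : u v / u + v}.
Proof. by move=> lf u v; have := lf 1 u v; rewrite !scale1r. Qed.

Lemma affine0 (V W : lmodType R) (f : V -> W) :
  (forall a u v, f (a *: u + v) = a *: f u + f v) -> f 0 = 0.
Proof. by move=> lf; apply: (addrI (f 0)); rewrite -(affineD lf) !addr0. Qed.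

Lemma affineZ (V W : lmodType R) (f : V -> W) :
  (forall a u v, f (a *: u + v) = a *: f u + f v) ->
  forall a, {morph f : u / a *: u}.
Proof. by move=> lf a u; rewrite -[a *: u]addr0 lf (affine0 lf) addr0. Qed.

Lemma affineN (V W : lmodType R) (f : V -> W) :
  (forall a u v, f (a *: u + v) = a *: f u + f v) -> {morph f : u / - u}.
Proof. by move=> lf u; rewrite -scaleN1r (affineZ lf) scaleN1r. Qed.

Lemma affine_sum (V W : lmodType R) (f : V -> W) (I : finType) (F : I -> V) :
  (forall a u v, f (a *: u + v) = a *: f u + f v) ->
  f (\sum_i F i) = \sum_i f (F i).
Proof.
move=> lf; apply: (big_morph f); [exact: affineD|exact: affine0].
Qed.

(* The four cyclic identities for (u,v,w), (u,fv,fw), (fu,v,fw), (fu,fv,w)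
   leave only twice the wanted relation. *)
Lemma cyclic_quasi (V : lmodType R) (f : V -> V) (H : V -> Prop)
    (Psi : V -> V -> V -> R) :
  (forall u v w, Psi u v w + Psi v w u + Psi w u v = 0) ->
  (forall u v w, H v -> H w -> Psi u (f v) w = Psi u v (f w)) ->
  (forall u v w, Psi u v (- w) = - Psi u v w) ->
  (forall u, H u -> H (f u)) -> (forall u, H u -> f (f u) = - u) ->
  forall u v w, H u -> H v -> H w -> Psi u v w + Psi (f u) (f v) w = 0.
Proof.
move=> cyc Psi_f PsiN Hf ff u v w hu hv hw.
have [hfu hfv hfw] := And3 (Hf u hu) (Hf v hv) (Hf w hw).
have E1 := cyc u v w; have E2 := cyc u (f v) (f w).
have E3 := cyc (f u) v (f w); have E4 := cyc (f u) (f v) w.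
have F1 : Psi u (f v) (f w) = - Psi u v w by rewrite Psi_f // ff.
have F3 : Psi v (f w) (f u) = - Psi v w u by rewrite Psi_f // ff.
have F4 : Psi w (f u) (f v) = - Psi w u v by rewrite Psi_f // ff.
have G2 : Psi (f u) v (f w) = Psi (f u) (f v) w by rewrite [RHS]Psi_f.
have G3 : Psi (f v) (f w) u = Psi (f v) w (f u) by rewrite [LHS]Psi_f.
have G4 : Psi (f w) u (f v) = Psi (f w) (f u) v by rewrite [RHS]Psi_f.
lra.
Qed.

(* The values at a point of an almost contact metric structure and of its first
   covariant derivatives: [nph u v] is (nabla_u phi) v and [nrb u] is nabla_u xi. *)
Record acm_point (V : lmodType R) := AcmPoint {
  acm_metric :> metric_space V;
  ph : V -> V;
  rb : V;
  nph : V -> V -> V;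
  nrb : V -> V;
  phP : forall a u v, ph (a *: u + v) = a *: ph u + ph v;
  ph_ph : forall u, ph (ph u) = - u + ip acm_metric u rb *: rb;
  ip_rb : ip acm_metric rb rb = 1;
  ip_ph : forall u v, ip acm_metric (ph u) (ph v) =
    ip acm_metric u v - ip acm_metric u rb * ip acm_metric v rb;
  nphPl : forall a u v w, nph (a *: u + v) w = a *: nph u w + nph v w;
  nphPr : forall w a u v, nph w (a *: u + v) = a *: nph w u + nph w v;
  nrbP : forall a u v, nrb (a *: u + v) = a *: nrb u + nrb v;
  nph_skew : forall u v w, ip acm_metric (nph u v) w = - ip acm_metric v (nph u w);
  nph_ph : forall u v, nph u (ph v) + ph (nph u v) =
    ip acm_metric (nrb u) v *: rb + ip acm_metric v rb *: nrb u;
  nrb_rb : forall u, ip acm_metric (nrb u) rb = 0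
}.

Section AcmPoint.
Variables (V : lmodType R) (p : acm_point V).
Local Notation xi := (rb p).
Local Notation f := (ph p).
Implicit Types u v w : V.

Definition horizontal u := ip p u xi = 0.

Lemma ph_rb : f xi = 0.
Proof.
apply: (@ip_eq0 _ p); rewrite ip_ph ip_rb; ring.
Qed.

(** The square norm of phi(phi u), computed once from metric compatibility and once from phi^2 = -1
    + eta xi, gives two values that differ by eta(phi u)^2. *)
Lemma ip_ph_rb u : ip p (f u) xi = 0.
Proof.
have : ip p (f (f u)) (f xi) = 0 by rewrite ph_rb ip0r.
rewrite ip_ph ip_rb mulr1 subrr => _.
have := ip_ph p (f u) (f u); have := ip_ph p u u.
rewrite ph_ph; rewrite !(ipDl, ipDr, ipNl, ipNr, ipZl, ipZr) ip_rb.
rewrite ![ip p xi u]ipC => -> E.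
have /eqP : ip p (f u) xi * ip p (f u) xi = 0 by lra.
by rewrite mulf_eq0 orbb => /eqP.
Qed.

Lemma ip_ph_skew u v : ip p (f u) v = - ip p u (f v).
Proof.
have := ip_ph p u (f v); rewrite ph_ph ip_ph_rb mulr0 subr0 => <-.
by rewrite ipDr ipNr ipZr ip_ph_rb mulr0 addr0 opprK.
Qed.

Lemma horizontal_ph u : horizontal (f u).
Proof. exact: ip_ph_rb. Qed.

Lemma ph_ph_horizontal u : horizontal u -> f (f u) = - u.
Proof. by move=> hu; rewrite ph_ph hu scale0r addr0. Qed.

Definition Pph u v := nph p u v + nph p (f u) (f v).

(** The case v = xi of [nph_ph]. It makes nabla xi a function of nabla phi, so that [geodesic] can
    be read off from (nabla_xi phi) xi. *)
Lemma ph_nph_rb u : f (nph p u xi) = nrb p u.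
Proof.
have := nph_ph p u xi.
by rewrite ph_rb (affine0 (nphPr p u)) nrb_rb ip_rb scale0r scale1r !add0r.
Qed.

Lemma ip_nph_rb u v : ip p (nph p u v) xi = - ip p (nrb p u) (f v).
Proof.
have z : ip p (nph p u xi) xi = 0.
  by have := nph_skew p u xi xi; rewrite [ip p xi _]ipC; lra.
by rewrite -ph_nph_rb ip_ph z mul0r subr0 nph_skew ipC.
Qed.

(** The Reeb component of P sees only nabla xi. At (u, phi u) it is the trace of nabla xi over the
    plane of u and phi u; at (u, u) it is 2 d eta(phi u, u). This is how identities for P yield
    [trace_free] and [twisted]. *)
Lemma ip_Pph_rb u v : horizontal u -> horizontal v ->
  ip p (Pph u v) xi = ip p (nrb p (f u)) v - ip p (nrb p u) (f v).
Proof.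
move=> hu hv; rewrite ipDl !ip_nph_rb ph_ph_horizontal // ipNr.
by rewrite opprK addrC.
Qed.

(* The conditions required of the source and of the target of a map: the Reeb
   curves are geodesics, [Pph u u] is proportional to the Reeb field on ker eta,
   div xi vanishes on each plane {u, phi u}, and d eta is nonzero on ker eta. *)
Definition geodesic := nrb p xi = 0.
Definition quasi := forall u, horizontal u -> f (Pph u u) = 0.
Definition trace_free := forall u, horizontal u ->
  ip p (nrb p u) u + ip p (nrb p (f u)) (f u) = 0.
Definition twisted := exists u v,
  [/\ horizontal u, horizontal v & ip p (nrb p u) v - ip p (nrb p v) u != 0].

Lemma geodesic_K : nph p xi xi = 0 -> geodesic.
Proof. by move=> K0; rewrite /geodesic -ph_nph_rb K0 (affine0 (phP p)). Qed.

Lemma geodesic_K0 : geodesic -> nph p xi xi = 0.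
Proof.
move=> N0; apply: (@ip_eq0 _ p).
have := ip_ph p (nph p xi xi) (nph p xi xi).
by rewrite ph_nph_rb N0 ip0l ip_nph_rb ph_rb ip0r oppr0 mulr0 subr0 => <-.
Qed.

(** Since xi has unit length, contracting d eta with xi leaves only g(nabla_xi xi, v); take v =
    nabla_xi xi. *)
Lemma geodesic_deta :
  (forall v, ip p (nrb p xi) v - ip p (nrb p v) xi = 0) -> geodesic.
Proof.
by move=> /(_ (nrb p xi)); rewrite nrb_rb subr0 => /ip_eq0.
Qed.

Lemma P_rb_rb : Pph xi xi = nph p xi xi.
Proof. by rewrite /Pph ph_rb (affine0 (nphPr p 0)) addr0. Qed.

Section HorizontalP.
Variable c : R.
Hypothesis PphE : forall u v, horizontal u -> horizontal v ->
  Pph u v = (c * ip p u v) *: xi.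

(** On ker eta the identities for quasi-contact and quasi-K-Sasakian manifolds (c = 2) and for
    quasi-K-cosymplectic manifolds (c = 0) all reduce to [PphE]. *)
Lemma P_quasi : quasi.
Proof. by move=> u hu; rewrite PphE // (affineZ (phP p)) ph_rb scaler0. Qed.

Lemma P_trace_free : trace_free.
Proof.
move=> u hu; have := ip_Pph_rb hu (horizontal_ph u).
rewrite PphE //; last exact: horizontal_ph.
rewrite ph_ph_horizontal // ipNr opprK ipZl ip_rb mulr1 addrC => <-.
suff -> : ip p u (f u) = 0 by rewrite mulr0.
by have := ip_ph_skew u u; rewrite ipC; lra.
Qed.

Lemma P_twisted u : c != 0 -> u != 0 -> horizontal u -> twisted.
Proof.
move=> c0 u0 hu; exists (f u), u; split=> //; first exact: horizontal_ph.
rewrite -ip_Pph_rb // PphE // ipZl ip_rb mulr1 mulf_neq0 // gt_eqF //.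
exact: ip_gt0.
Qed.

End HorizontalP.

Section Closed.
Hypothesis closed : forall u v w,
  ip p v (nph p u w) + ip p w (nph p v u) + ip p u (nph p w v) = 0.

Let Psi u v w := ip p (nph p u v) w.

Let Psi_skew u v w : Psi u v w = - Psi u w v.
Proof. by rewrite /Psi nph_skew ipC. Qed.

Let Psi_cyclic u v w : Psi u v w + Psi v w u + Psi w u v = 0.
Proof.
have := closed u w v; rewrite /Psi ![ip p (nph _ _ _) _]ipC.
by rewrite -addrA [X in _ + X]addrC addrA.
Qed.

Let Psi_ph u v w : horizontal v -> horizontal w ->
  Psi u (f v) w = Psi u v (f w).
Proof.
move=> hv hw; have /(congr1 (ip p ^~ w)) := nph_ph p u v.
rewrite !ipDl !ipZl hv [ip p xi w]ipC hw mulr0 mul0r addr0 ip_ph_skew.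
by rewrite /Psi => /eqP; rewrite subr_eq0 => /eqP.
Qed.

(** Pairing phi(P(u, u)) with w amounts to pairing P(u, u) with phi w, which is horizontal, so
    [cyclic_quasi] applies. *)
Lemma closed_quasi : quasi.
Proof.
move=> u hu; apply: (@ip_ext _ p) => w; rewrite ip0l ip_ph_skew.
apply/eqP; rewrite oppr_eq0; apply/eqP; rewrite /Pph ipDl.
apply: (@cyclic_quasi _ f horizontal Psi) => //; last exact: horizontal_ph.
- by move=> s t r; rewrite /Psi ipNr.
- by move=> s _; exact: horizontal_ph.
- exact: ph_ph_horizontal.
Qed.

(** The cyclic identity at (xi, u, phi u). The term [Psi xi u (f u)] is zero, because [f] moves
    across without a sign while [Psi] is skew in its last two arguments; the other two terms are
    Reeb components, given by [ip_nph_rb]. *)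
Lemma closed_trace_free : trace_free.
Proof.
move=> u hu; have := Psi_cyclic xi u (f u).
have -> : Psi xi u (f u) = 0.
  have := Psi_skew xi u (f u); rewrite Psi_ph //; lra.
rewrite add0r [Psi (f u) xi u]Psi_skew /Psi !ip_nph_rb ph_ph_horizontal //.
by rewrite ipNr !opprK.
Qed.

End Closed.

Section NearlyCosymplectic.
Hypothesis K0 : forall u, nph p u u = 0.

Lemma nearly_geodesic : geodesic.
Proof. exact/geodesic_K/K0. Qed.

Lemma nearly_quasi : quasi.
Proof. by move=> u hu; rewrite /Pph !K0 addr0 (affine0 (phP p)). Qed.

End NearlyCosymplectic.

(* [c = 0] is the nearly cosymplectic case. *)
Lemma nearly_trace_free c :
  (forall u v, nph p u v + nph p v u = c *: ((2 * ip p u v) *: xi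
     - ip p v xi *: u - ip p u xi *: v)) -> trace_free.
Proof.
(* Each summand vanishes separately. The identity at (xi, u) is paired with phi u: (nabla_xi phi) u
   is orthogonal to phi u, and what remains of (nabla_u phi) xi is g(nabla_u xi, u) by
   [ph_nph_rb]. *)
move=> Q; have kill u : horizontal u -> ip p (nrb p u) u = 0.
  move=> hu; have /(congr1 (ip p ^~ (f u))) := Q xi u.
  rewrite ipDl [ip p xi u]ipC hu ip_rb mulr0 !scale0r scale1r subr0 sub0r.
  rewrite ipZl ipNl.
  have -> : ip p u (f u) = 0 by have := ip_ph_skew u u; rewrite ipC; lra.
  rewrite oppr0 mulr0.
  have -> : ip p (nph p xi u) (f u) = 0.
    have /(congr1 (ip p ^~ u)) := nph_ph p xi u.
    rewrite !ipDl !ipZl hu [ip p xi u]ipC hu mulr0 mul0r addr0 ip_ph_skew nph_skew.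
    by rewrite [ip p (f u) _]ipC; lra.
  rewrite add0r -ph_nph_rb; have := ip_ph_skew (nph p u xi) u; lra.
by move=> u hu; rewrite !kill ?addr0 //; exact: horizontal_ph.
Qed.

Section NearlySasakian.
Variable c : R.
Hypothesis Q : forall u v, nph p u v + nph p v u = c *: ((2 * ip p u v) *: xi
  - ip p v xi *: u - ip p u xi *: v).

Let Kuu u : horizontal u -> nph p u u = (c * ip p u u) *: xi.
Proof.
move=> hu; have := Q u u; rewrite hu scale0r !subr0 -mulr2n scalerA => E.
apply: (@scalerI _ _ (2 : R)); first by rewrite pnatr_eq0.
by rewrite scaler_nat E scalerA; congr (_ *: _); ring.
Qed.

Lemma nearly_Sasakian_geodesic : geodesic.
Proof.
apply: geodesic_K; have := Q xi xi; rewrite ip_rb mulr1 -mulr2n scale1r.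
rewrite -scaler_nat [2 *: xi]scaler_nat mulr2n addrK subrr scaler0 => E.
by apply: (@scalerI _ _ (2 : R)); rewrite ?pnatr_eq0 // scaler0.
Qed.

Lemma nearly_Sasakian_P u : horizontal u -> Pph u u = (2 * c * ip p u u) *: xi.
Proof.
move=> hu; rewrite /Pph !Kuu //; last exact: horizontal_ph.
rewrite ip_ph hu mulr0 subr0 -scalerDl; congr (_ *: _); ring.
Qed.

Lemma nearly_Sasakian_quasi : quasi.
Proof.
by move=> u hu; rewrite nearly_Sasakian_P // (affineZ (phP p)) ph_rb scaler0.
Qed.

Lemma nearly_Sasakian_twisted u : c != 0 -> u != 0 -> horizontal u -> twisted.
Proof.
move=> c0 u0 hu; exists (f u), u; split=> //; first exact: horizontal_ph.
rewrite -ip_Pph_rb // nearly_Sasakian_P // ipZl ip_rb mulr1.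
by rewrite !mulf_neq0 ?pnatr_eq0 // gt_eqF // ip_gt0.
Qed.

End NearlySasakian.

Lemma contact_twisted c u : c != 0 -> u != 0 -> horizontal u ->
  (forall u v, ip p (nrb p u) v - ip p (nrb p v) u = 2 * c * ip p u (f v)) ->
  twisted.
Proof.
move=> c0 u0 hu E; exists (f u), u; split=> //; first exact: horizontal_ph.
rewrite E ip_ph hu mulr0 subr0.
by rewrite !mulf_neq0 ?pnatr_eq0 // gt_eqF // ip_gt0.
Qed.

End AcmPoint.

Record ah_point (W : lmodType R) := AhPoint {
  js : W -> W;
  KJ : W -> W -> W;
  jsP : forall a u v, js (a *: u + v) = a *: js u + js v;
  js_js : forall u, js (js u) = - u;
  KJPl : forall a u v w, KJ (a *: u + v) w = a *: KJ u w + KJ v w;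
  KJPr : forall w a u v, KJ w (a *: u + v) = a *: KJ w u + KJ w v;
  KJ_js : forall u v, KJ u (js v) = - js (KJ u v)
}.

Section AhPoint.
Variables (W : lmodType R) (q : ah_point W).

Definition quasi_J := forall u, KJ q u u + KJ q (js q u) (js q u) = 0.

Lemma js_inj u : js q u = 0 -> u = 0.
Proof.
move=> E; have := js_js q u; rewrite E (affine0 (jsP q)).
by move=> /eqP; rewrite eq_sym oppr_eq0 => /eqP.
Qed.

(** Apply J, which anticommutes with its covariant derivative: this passes from the antisymmetric
    form of the quasi-Kaehler identity to the one analogous to P(u, u) = 0. *)
Lemma quasi_J_alt :
  (forall u, KJ q (js q u) u - KJ q u (js q u) = 0) -> quasi_J.
Proof.
move=> E u; apply: js_inj; rewrite (affineD (jsP q)) !KJ_js.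
rewrite (affineN (jsP q)) js_js opprK addrC.
by rewrite -(E u) KJ_js opprK.
Qed.

End AhPoint.

(* [L], [B] and [eps] stand for the differential of a map, its second fundamental
   form and the sign of holomorphy. *)
Section HolomorphicPoint.
Variables (V W : lmodType R) (p : acm_point V).
Variables (L : V -> W) (B : V -> V -> W) (eps : R).
Hypothesis LP : forall a u v, L (a *: u + v) = a *: L u + L v.
Hypothesis BPl : forall a u v w, B (a *: u + v) w = a *: B u w + B v w.
Hypothesis BC : forall u v, B u v = B v u.
Hypothesis eps2 : eps * eps = 1.

Let BPr w a u v : B w (a *: u + v) = a *: B w u + B w v.
Proof. by rewrite ![B w _]BC BPl. Qed.

Lemma hess_ph (psi : W -> W) (KW : W -> W -> W)
    (psiP : forall a u v, psi (a *: u + v) = a *: psi u + psi v)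
    (KWPl : forall a u v w, KW (a *: u + v) w = a *: KW u w + KW v w)
    (KWPr : forall w a u v, KW w (a *: u + v) = a *: KW w u + KW w v)
    (Lph : forall u, L (ph p u) = eps *: psi (L u))
    (Bph : forall u v, B u (ph p v) =
       eps *: KW (L u) (L v) + eps *: psi (B u v) - L (nph p u v)) u :
  horizontal p u ->
  eps *: psi (B u u + B (ph p u) (ph p u)) =
  - (eps *: (KW (L u) (L u) + KW (psi (L u)) (psi (L u)))) + L (Pph p u u).
Proof.
move=> hu; have E1 := Bph u u; have E2 := Bph (ph p u) (ph p u).
rewrite ph_ph_horizontal // (affineN (BPr _)) BC E1 Lph in E2.
rewrite (affineZ (KWPr _)) (affineZ (fun a x y => KWPl a x y _)) scalerA in E2.
rewrite eps2 scale1r in E2.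
rewrite (affineD psiP) (affineD LP) !scalerDr.
move: E2; set a := eps *: KW _ _; set b := eps *: psi (B u u).
set c := L _; set a' := eps *: KW _ _; set b' := eps *: psi _; set c' := L _.
move=> E; have -> : b' = - a - b + c - a' + c'.
  have <- : - (a + b - c) = - a - b + c by rewrite !opprD opprK.
  by rewrite E [a' + b']addrC addrAC subrK addrK.
rewrite opprD !addrA.
by rewrite [LHS](ACl ((3*1)*(2*5*4*6))) /= addNr add0r.
Qed.


Let eps_eq0 (W' : lmodType R) (w : W') : eps *: w = 0 -> w = 0.
Proof. by move=> E; rewrite -[w]scale1r -eps2 -scalerA E scaler0. Qed.

Section ContactTarget.
Variables (q : acm_point W) (lam : R) (dlam : V -> R).
Hypothesis Lph : forall u, L (ph p u) = eps *: ph q (L u).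
Hypothesis Bph : forall u v, B u (ph p v) =
  eps *: nph q (L u) (L v) + eps *: ph q (B u v) - L (nph p u v).
Hypothesis Lrb : forall u, ip q (L u) (rb q) = lam * ip p u (rb p).
Hypothesis Brb : forall u v,
  ip q (B u v) (rb q) + ip q (nrb q (L u)) (L v) =
  dlam u * ip p v (rb p) + lam * ip p (nrb p u) v.

Lemma push_horizontal u : horizontal p u -> horizontal q (L u).
Proof. by move=> hu; rewrite /horizontal Lrb hu mulr0. Qed.

(** Since phi kills xi, the target tensor kills the image of xi, and its kernel is the Reeb line;
    [Lrb] supplies the coefficient. *)
Lemma push_rb : L (rb p) = lam *: rb q.
Proof.
have /eps_eq0 E : eps *: ph q (L (rb p)) = 0 by rewrite -Lph ph_rb (affine0 LP).
have := ph_ph q (L (rb p)); rewrite E (affine0 (phP q)) Lrb ip_rb mulr1.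
by move=> /eqP; rewrite eq_sym addrC subr_eq0 => /eqP.
Qed.

Hypothesis geo_p : geodesic p.
Hypothesis geo_q : geodesic q.

(** Compare [Brb] at (u, xi) and at (xi, u). The Hessian is symmetric, and the Reeb geodesics with
    the unit length of both Reeb fields remove every other term except [dlam u]. *)
Lemma dlam_horizontal u : horizontal p u -> dlam u = 0.
Proof.
move=> hu; have := Brb u (rb p); have := Brb (rb p) u.
rewrite push_rb (affineZ (nrbP q)) geo_q scaler0 ip0l hu geo_p ip0l !mulr0 !addr0.
by rewrite BC => ->; rewrite add0r ipZr !nrb_rb ip_rb !mulr0 addr0 mulr1.
Qed.

(** [Bph] at (xi, xi) has left-hand side 0 because phi xi = 0, and geodesic Reeb curves kill both
    derivative terms; hence B(xi, xi) lies on the target Reeb line and [Brb] gives its length. *)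
Lemma hess_rb : B (rb p) (rb p) = dlam (rb p) *: rb q.
Proof.
have := Brb (rb p) (rb p); rewrite push_rb geo_p ip0l mulr0 addr0 ip_rb mulr1.
rewrite (affineZ (nrbP q)) geo_q scaler0 ip0l addr0 => <-.
have := Bph (rb p) (rb p); rewrite ph_rb (affine0 (BPr _)) geodesic_K0 //.
rewrite (affine0 LP) subr0 push_rb (affineZ (nphPr q _)).
rewrite (affineZ (fun a x y => nphPl q a x y _)) geodesic_K0 // !scaler0 add0r.
move=> /esym /eps_eq0 E; have := ph_ph q (B (rb p) (rb p)).
rewrite E (affine0 (phP q)) => /eqP.
by rewrite eq_sym addrC subr_eq0 => /eqP.
Qed.

(** The source enters only through two sums over the family, which is all that a semi-Sasakian
    manifold provides, whereas the target conditions are needed at each image vector separately. *)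
Lemma hess_horizontal_sum (I : finType) (e : I -> V) :
  quasi q -> trace_free q -> (forall i, horizontal p (e i)) ->
  ph p (\sum_i Pph p (e i) (e i)) = 0 ->
  \sum_i (ip p (nrb p (e i)) (e i)
           + ip p (nrb p (ph p (e i))) (ph p (e i))) = 0 ->
  \sum_i (B (e i) (e i) + B (ph p (e i)) (ph p (e i))) = 0.
Proof.
move=> qq tq he s1 s2; set S := \sum_i _ in |- *.
(* One application of [ph q] leaves derivatives of the target structure along its Reeb line; the
   second removes them by [quasi]. With the Reeb component [E2] this determines [S]. *)
have E1 : ph q (ph q S) = 0.
  apply: eps_eq0; rewrite -(affineZ (phP q)) /S (affine_sum _ (phP q)).
  rewrite scaler_sumr (affine_sum _ (phP q)).
  have E i : ph q (eps *: ph q (B (e i) (e i) + B (ph p (e i)) (ph p (e i)))) =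
      ph q (L (Pph p (e i) (e i))).
    rewrite (hess_ph (phP q) (nphPl q) (nphPr q)) // (affineD (phP q)).
    rewrite (affineN (phP q)) (affineZ (phP q)) qq ?scaler0 ?oppr0 ?add0r //.
    exact: push_horizontal.
  rewrite (eq_bigr _ (fun i _ => E i)) -(affine_sum _ (phP q)).
  rewrite -(affine_sum _ LP); apply: eps_eq0.
  by rewrite -Lph s1 (affine0 LP).
have E2 : ip q S (rb q) = 0.
  rewrite /S ip_suml -[RHS](mulr0 lam) -[in RHS]s2 mulr_sumr.
  apply: eq_bigr => i _; rewrite ipDl.
  have F1 := Brb (e i) (e i); have F2 := Brb (ph p (e i)) (ph p (e i)).
  have F3 := tq _ (push_horizontal (he i)).
  rewrite Lph (affineZ (nrbP q)) ipZl ipZr mulrA eps2 mul1r in F2.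
  rewrite (he i) mulr0 add0r in F1.
  rewrite (horizontal_ph p) mulr0 add0r in F2.
  lra.
move: E1; rewrite ph_ph E2 scale0r addr0 => /eqP; rewrite oppr_eq0.
by move=> /eqP.
Qed.

End ContactTarget.

Section HermitianTarget.
Variable q : ah_point W.
Hypothesis Lph : forall u, L (ph p u) = eps *: js q (L u).
Hypothesis Bph : forall u v, B u (ph p v) =
  eps *: KJ q (L u) (L v) + eps *: js q (B u v) - L (nph p u v).

(** [js] is injective, so the map collapses the Reeb direction; no factor lambda arises for
    Hermitian targets. *)
Lemma push_rb_hermitian : L (rb p) = 0.
Proof.
by apply: (@js_inj _ q); apply: eps_eq0; rewrite -Lph ph_rb (affine0 LP).
Qed.

Lemma hess_rb_hermitian : geodesic p -> B (rb p) (rb p) = 0.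
Proof.
move=> geo; have := Bph (rb p) (rb p); rewrite ph_rb (affine0 (BPr _)).
rewrite geodesic_K0 // (affine0 LP) subr0 push_rb_hermitian.
rewrite (affine0 (KJPr q _)) scaler0 add0r => /esym/eps_eq0.
exact: js_inj.
Qed.

Lemma hess_horizontal_sum_hermitian (I : finType) (e : I -> V) :
  quasi_J q -> (forall i, horizontal p (e i)) ->
  ph p (\sum_i Pph p (e i) (e i)) = 0 ->
  \sum_i (B (e i) (e i) + B (ph p (e i)) (ph p (e i))) = 0.
Proof.
move=> qq he s1; apply: (@js_inj _ q); apply: (@js_inj _ q); apply: eps_eq0.
rewrite -(affineZ (jsP q)) (affine_sum _ (jsP q)) scaler_sumr.
have E i : eps *: js q (B (e i) (e i) + B (ph p (e i)) (ph p (e i))) =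
    L (Pph p (e i) (e i)).
  rewrite (hess_ph (jsP q) (KJPl q) (KJPr q)) //.
  by rewrite qq scaler0 oppr0 add0r.
rewrite (eq_bigr _ (fun i _ => E i)) -(affine_sum _ LP); apply: eps_eq0.
by rewrite -Lph s1 (affine0 LP).
Qed.

End HermitianTarget.

End HolomorphicPoint.
End PointAlgebra.

(** * Smooth matrix fields *)

Section SmoothMatrices.
Variables (R : realType) (d : nat) (U : set 'rV[R]_d).
Hypothesis oU : open U.

Lemma smooth_on_eq (u v : 'rV[R]_d -> R) :
  (forall y, U y -> u y = v y) -> smooth_on U u -> smooth_on U v.
Proof.
by move=> uv /(smooth_onP _ oU) su; apply/(smooth_onP _ oU) => k;
  exact: ndiff_eq_on (su k).
Qed.

Lemma smooth_on_cst (c : R) : smooth_on U (fun=> c).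
Proof. by apply/(smooth_onP _ oU) => k; exact: ndiff_cst. Qed.

Lemma smooth_onD (u v : 'rV[R]_d -> R) : smooth_on U u -> smooth_on U v ->
  smooth_on U (fun x => u x + v x).
Proof.
move=> /(smooth_onP _ oU) su /(smooth_onP _ oU) sv; apply/(smooth_onP _ oU) => k.
exact: ndiffD.
Qed.

Lemma smooth_onM (u v : 'rV[R]_d -> R) : smooth_on U u -> smooth_on U v ->
  smooth_on U (fun x => u x * v x).
Proof.
move=> /(smooth_onP _ oU) su /(smooth_onP _ oU) sv; apply/(smooth_onP _ oU) => k.
exact: ndiffM.
Qed.

Lemma smooth_onV (u : 'rV[R]_d -> R) : (forall x, U x -> u x != 0) ->
  smooth_on U u -> smooth_on U (fun x => (u x)^-1).
Proof.
move=> u0 /(smooth_onP _ oU) su; apply/(smooth_onP _ oU) => k; exact: ndiffV.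
Qed.

Lemma smooth_on_sqrt (u : 'rV[R]_d -> R) : (forall x, U x -> 0 < u x) ->
  smooth_on U u -> smooth_on U (fun x => Num.sqrt (u x)).
Proof.
move=> u0 /(smooth_onP _ oU) su; apply/(smooth_onP _ oU) => k; exact: ndiff_sqrt.
Qed.

Lemma smooth_on_sum (I : finType) (u : I -> 'rV[R]_d -> R) :
  (forall i, smooth_on U (u i)) -> smooth_on U (fun x => \sum_i u i x).
Proof.
move=> su; apply/(smooth_onP _ oU) => k; apply: ndiff_sum => // i.
by have /(smooth_onP _ oU) := su i; exact.
Qed.

Lemma smooth_on_prod (I : finType) (u : I -> 'rV[R]_d -> R) :
  (forall i, smooth_on U (u i)) -> smooth_on U (fun x => \prod_i u i x).
Proof.
move=> su; suff sus (s : seq I) : smooth_on U (fun x => \prod_(i <- s) u i x).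
  exact: sus.
elim: s => [|i s IH].
  by apply: smooth_on_eq (smooth_on_cst 1) => y _; rewrite big_nil.
by apply: smooth_on_eq (smooth_onM (su i) IH) => y _; rewrite big_cons.
Qed.

Lemma smooth_on_comp e (V : set 'rV[R]_e) (F : 'rV[R]_d -> 'rV[R]_e) u :
  open V -> (forall x, U x -> V (F x)) -> smooth_mx_on U F -> smooth_on V u ->
  smooth_on U (fun x => u (F x)).
Proof.
move=> oV UV sF /(smooth_onP _ oV) su; apply/(smooth_onP _ oU) => k.
by apply: ndiff_comp UV _ (su k) => // j; have /(smooth_onP _ oU) := sF 0 j; exact.
Qed.

Lemma smooth_mx_differentiable p q (A : 'rV[R]_d -> 'M[R]_(p, q)) x :
  smooth_mx_on U A -> U x -> differentiable A x.
Proof.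
move=> sA Ux; apply/differentiable_mxP => i j.
exact: smooth_on_differentiable (sA i j) Ux.
Qed.

Lemma smooth_mx_derivable p q (A : 'rV[R]_d -> 'M[R]_(p, q)) x v :
  smooth_mx_on U A -> U x -> derivable A x v.
Proof. by move=> sA Ux; apply/diff_derivable/smooth_mx_differentiable. Qed.

Lemma smooth_mx_eq p q (A B : 'rV[R]_d -> 'M[R]_(p, q)) :
  (forall y, U y -> A y = B y) -> smooth_mx_on U A -> smooth_mx_on U B.
Proof. by move=> AB sA i j; apply: smooth_on_eq (sA i j) => y Uy; rewrite AB. Qed.

Lemma smooth_mx_cst p q (A : 'M[R]_(p, q)) : smooth_mx_on U (fun=> A).
Proof. by move=> i j; exact: smooth_on_cst. Qed.

Lemma smooth_mxD p q (A B : 'rV[R]_d -> 'M[R]_(p, q)) :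
  smooth_mx_on U A -> smooth_mx_on U B -> smooth_mx_on U (fun x => A x + B x).
Proof.
move=> sA sB i j; apply: smooth_on_eq (smooth_onD (sA i j) (sB i j)) => y _.
by rewrite mxE.
Qed.

Lemma smooth_mxZ p q (u : 'rV[R]_d -> R) (A : 'rV[R]_d -> 'M[R]_(p, q)) :
  smooth_on U u -> smooth_mx_on U A -> smooth_mx_on U (fun x => u x *: A x).
Proof.
move=> su sA i j; apply: smooth_on_eq (smooth_onM su (sA i j)) => y _.
by rewrite mxE.
Qed.

Lemma smooth_mxN p q (A : 'rV[R]_d -> 'M[R]_(p, q)) :
  smooth_mx_on U A -> smooth_mx_on U (fun x => - A x).
Proof.
move=> sA; apply: smooth_mx_eq (smooth_mxZ (smooth_on_cst (-1)) sA) => y _.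
by rewrite scaleN1r.
Qed.

Lemma smooth_mx_sum p q (I : finType) (A : I -> 'rV[R]_d -> 'M[R]_(p, q)) :
  (forall i, smooth_mx_on U (A i)) -> smooth_mx_on U (fun x => \sum_i A i x).
Proof.
move=> sA i j; apply: smooth_on_eq (smooth_on_sum (fun k => sA k i j)) => y _.
by rewrite summxE.
Qed.

Lemma smooth_mulmx p q r (A : 'rV[R]_d -> 'M[R]_(p, q))
    (B : 'rV[R]_d -> 'M[R]_(q, r)) :
  smooth_mx_on U A -> smooth_mx_on U B -> smooth_mx_on U (fun x => A x *m B x).
Proof.
move=> sA sB i j.
apply: smooth_on_eq (smooth_on_sum (fun k => smooth_onM (sA i k) (sB k j))).
by move=> y _; rewrite mxE.
Qed.

Lemma smooth_trmx p q (A : 'rV[R]_d -> 'M[R]_(p, q)) :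
  smooth_mx_on U A -> smooth_mx_on U (fun x => (A x)^T).
Proof. by move=> sA i j; apply: smooth_on_eq (sA j i) => y _; rewrite mxE. Qed.

Lemma smooth_det n (A : 'rV[R]_d -> 'M[R]_n) :
  smooth_mx_on U A -> smooth_on U (fun x => \det (A x)).
Proof.
move=> sA; apply: smooth_on_sum => s; apply: smooth_onM; first exact: smooth_on_cst.
by apply: smooth_on_prod => i; exact: sA.
Qed.

Lemma smooth_invmx n (A : 'rV[R]_d -> 'M[R]_n) :
  (forall x, U x -> A x \in unitmx) ->
  smooth_mx_on U A -> smooth_mx_on U (fun x => invmx (A x)).
Proof.
move=> uA sA i j.
have sc : smooth_on U (fun x => cofactor (A x) j i).
  apply: smooth_onM; first exact: smooth_on_cst.
  apply: smooth_det => k l; apply: smooth_on_eq (sA (lift j k) (lift i l)) => y _.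
  by rewrite !mxE.
have dA x : U x -> \det (A x) != 0 by move=> Ux; have := uA x Ux; rewrite unitmxE unitfE.
apply: smooth_on_eq (smooth_onM (smooth_onV dA (smooth_det sA)) sc) => y Uy.
by rewrite /invmx uA // !mxE.
Qed.

Lemma smooth_mx_comp e (V : set 'rV[R]_e) p q (F : 'rV[R]_d -> 'rV[R]_e)
    (A : 'rV[R]_e -> 'M[R]_(p, q)) :
  open V -> (forall x, U x -> V (F x)) -> smooth_mx_on U F ->
  smooth_mx_on V A -> smooth_mx_on U (fun x => A (F x)).
Proof.
move=> oV UV sF sA i j.
exact: (@smooth_on_comp e V F (fun y => A y i j) oV UV sF (sA i j)).
Qed.

Lemma smooth_mx_derive p q (A : 'rV[R]_d -> 'M[R]_(p, q)) X :
  smooth_mx_on U X -> smooth_mx_on U A ->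
  smooth_mx_on U (fun x => 'D_(X x) A x).
Proof.
move=> sX sA i j.
apply: smooth_on_eq (smooth_on_sum (fun k =>
  smooth_onM (sX 0 k) (smooth_on_partial k (sA i j)))) => y Uy.
have dA := smooth_mx_differentiable sA Uy.
rewrite derive_entry; last exact: diff_derivable.
rewrite [RHS]derive_coords //.
exact: smooth_on_differentiable (sA i j) Uy.
Qed.

Lemma smooth_mx_derive_cst p q (A : 'rV[R]_d -> 'M[R]_(p, q)) v :
  smooth_mx_on U A -> smooth_mx_on U (fun x => 'D_v A x).
Proof. exact/smooth_mx_derive/smooth_mx_cst. Qed.

Lemma smooth_on_mx11 (u : 'rV[R]_d -> R) :
  smooth_on U u <-> smooth_mx_on U (fun x => (u x)%:M : 'M[R]_1).
Proof.
split=> [su i j|/(_ 0 0)]; last first.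
  by apply: smooth_on_eq => y _; rewrite mxE eqxx.
by apply: smooth_on_eq su => y _; rewrite mxE !ord1 eqxx.
Qed.

Lemma smooth_on_derive_cst (u : 'rV[R]_d -> R) v :
  smooth_on U u -> smooth_on U ('D_v u).
Proof.
move=> su; apply: smooth_on_eq (smooth_on_sum (fun k =>
  smooth_onM (smooth_on_cst (v 0 k)) (smooth_on_partial k su))) => y Uy.
by rewrite [RHS]derive_coords //; exact: smooth_on_differentiable su Uy.
Qed.

Lemma smooth_derive_comm (u : 'rV[R]_d -> R) x v w :
  smooth_on U u -> U x -> 'D_w ('D_v u) x = 'D_v ('D_w u) x.
Proof.
move=> su Ux.
have dn f a : smooth_on U f -> \forall y \near x, derivable f y a.
  move=> sf; apply: filterS (near_in oU Ux) => y Uy.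
  exact/diff_derivable/smooth_on_differentiable/Uy.
have cn f : smooth_on U f -> {for x, continuous f}.
  by move=> sf; apply/differentiable_continuous/smooth_on_differentiable/Ux.
have sD f a : smooth_on U f -> smooth_on U ('D_a f) := @smooth_on_derive_cst f a.
exact: (derive_comm (dn _ _ su) (dn _ _ su) (dn _ _ (sD _ _ su)) (dn _ _ (sD _ _ su))
  (cn _ (sD _ _ (sD _ _ su))) (cn _ (sD _ _ (sD _ _ su)))).
Qed.

Lemma smooth_mx_derive_comm p q (A : 'rV[R]_d -> 'M[R]_(p, q)) x v w :
  smooth_mx_on U A -> U x ->
  'D_w (fun y => 'D_v A y) x = 'D_v (fun y => 'D_w A y) x.
Proof.
move=> sA Ux.
have E a b i j : ('D_a (fun y => 'D_b A y) x) i j =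
                 'D_a ('D_b (fun y => A y i j)) x.
  rewrite derive_entry; last exact/smooth_mx_derivable/Ux/smooth_mx_derive_cst.
  apply: derive_eq_on Ux _ => // y Uy; rewrite derive_entry //.
  exact: smooth_mx_derivable.
apply/matrixP => i j; apply: etrans (E w v i j) (etrans _ (esym (E v w i j))).
exact: (smooth_derive_comm v w (sA i j) Ux).
Qed.

End SmoothMatrices.

(** * Inner products and the Levi-Civita connection in a chart *)

Section InnerProduct.
Variables (R : realType) (d : nat).
Implicit Types (G : 'M[R]_d) (u v w : 'rV[R]_d).

Lemma inner_mulmx G u v : inner G u v = (u *m G *m v^T) 0 0.
Proof. by []. Qed.

Lemma innerE G u v : inner G u v = \sum_i \sum_j u 0 i * G i j * v 0 j.
Proof.
rewrite /inner mxE exchange_big /=; apply: eq_bigr => j _.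
by rewrite !mxE mulr_suml.
Qed.

Lemma innerPl G a u v w : inner G (a *: u + v) w = a * inner G u w + inner G v w.
Proof. by rewrite /inner !mulmxDl -!scalemxAl !mxE. Qed.

Lemma innerDl G u v w : inner G (u + v) w = inner G u w + inner G v w.
Proof. by rewrite /inner !mulmxDl mxE. Qed.

Lemma innerDr G u v w : inner G w (u + v) = inner G w u + inner G w v.
Proof. by rewrite /inner linearD mulmxDr mxE. Qed.

Lemma innerZl G a u w : inner G (a *: u) w = a * inner G u w.
Proof. by rewrite /inner -!scalemxAl mxE. Qed.

Lemma innerZr G a u w : inner G w (a *: u) = a * inner G w u.
Proof. by rewrite /inner linearZ -scalemxAr mxE. Qed.

Lemma innerNl G u w : inner G (- u) w = - inner G u w.
Proof. by rewrite -scaleN1r innerZl mulN1r. Qed.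

Lemma innerNr G u w : inner G w (- u) = - inner G w u.
Proof. by rewrite -scaleN1r innerZr mulN1r. Qed.

Lemma inner0l G w : inner G 0 w = 0.
Proof. by rewrite -(scale0r 0) innerZl mul0r. Qed.

Lemma inner0r G w : inner G w 0 = 0.
Proof. by rewrite -(scale0r 0) innerZr mul0r. Qed.

Lemma innerC G u v : G^T = G -> inner G u v = inner G v u.
Proof.
move=> sG; rewrite /inner -[in LHS]sG -{1}(trmxK u) -!trmx_mul [LHS]mxE.
by rewrite mulmxA.
Qed.

Lemma inner_basis G u j : inner G u (basis_vec R j) = (u *m G) 0 j.
Proof. by rewrite /inner /basis_vec trmx_delta -colE mxE. Qed.

Lemma inner_mxPl c G (H : 'M[R]_d) u v :
  inner (c *: G + H) u v = c * inner G u v + inner H u v.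
Proof. by rewrite /inner mulmxDr mulmxDl -scalemxAr -scalemxAl !mxE. Qed.

Lemma posdef_unitmx G : (forall u, u != 0 -> 0 < inner G u u) -> G \in unitmx.
Proof.
move=> pG; rewrite -row_free_unit -kermx_eq0; apply/rowV0P => u /sub_kermxP E.
apply/eqP/negPn/negP => /pG; by rewrite /inner E mul0mx mxE ltxx.
Qed.

Lemma derive_inner (V : normedModType R) (G : V -> 'M[R]_d) (X Y : V -> 'rV[R]_d) x (h : V) :
  derivable G x h -> derivable X x h -> derivable Y x h ->
  'D_h (fun y => inner (G y) (X y) (Y y)) x =
  inner ('D_h G x) (X x) (Y x) + inner (G x) ('D_h X x) (Y x)
  + inner (G x) (X x) ('D_h Y x).
Proof.
move=> dG dX dY.
have dXG := derivable_mulmx dX dG; have dYt := derivable_trmx dY.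
rewrite -(@derive_entry R V 1 1); last exact: derivable_mulmx.
rewrite derive_mulmx // derive_mulmx // derive_trmx // mulmxDl.
by rewrite [LHS]mxE [X in X + _]mxE [X in X + _]addrC.
Qed.

Lemma inner_smooth n (U : set 'rV[R]_n) (G : 'rV[R]_n -> 'M[R]_d)
    (X Y : 'rV[R]_n -> 'rV[R]_d) : open U ->
  smooth_mx_on U G -> smooth_mx_on U X -> smooth_mx_on U Y ->
  smooth_on U (fun y => inner (G y) (X y) (Y y)).
Proof.
move=> oU sG sX sY.
exact: (smooth_mulmx oU (smooth_mulmx oU sX sG) (smooth_trmx oU sY)) 0 0.
Qed.

End InnerProduct.

Section LeviCivita.
Variables (R : realType) (d : nat) (U : set 'rV[R]_d) (G : 'rV[R]_d -> 'M[R]_d).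
Hypothesis oU : open U.
Hypothesis sG : smooth_mx_on U G.
Hypothesis symG : forall x, U x -> (G x)^T = G x.
Hypothesis posG : forall x, U x -> forall u, u != 0 -> 0 < inner (G x) u u.
Variable x : 'rV[R]_d.
Hypothesis Ux : U x.
Implicit Types u v w : 'rV[R]_d.

Let Gu : G x \in unitmx. Proof. exact/posdef_unitmx/posG. Qed.

Lemma symm_derive_metric w : ('D_w G x)^T = 'D_w G x.
Proof.
rewrite -derive_trmx; last exact: smooth_mx_derivable sG Ux.
exact: derive_eq_on Ux symG.
Qed.

Lemma inner_derive_metric w u v : inner ('D_w G x) u v =
  \sum_k \sum_i \sum_j
    w 0 k * u 0 i * v 0 j * 'D_(basis_vec R k) (fun y => G y i j : R) x.
Proof.
rewrite innerE exchange_big /=.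
rewrite [RHS]exchange_big /= exchange_big /=; apply: eq_bigr => i _.
rewrite [RHS]exchange_big /=; apply: eq_bigr => j _.
rewrite derive_entry; last exact: smooth_mx_derivable sG Ux.
rewrite derive_coords; last exact: smooth_on_differentiable (sG i j) Ux.
rewrite mulr_sumr mulr_suml; apply: eq_bigr => k _.
rewrite [_ *: _]mulrC; ring.
Qed.

(* The basis-free form of the Christoffel symbols, from which symmetry and
   metric compatibility follow by linear arithmetic. *)
Lemma Koszul u v w : 2 * inner (G x) (christoffel_form G x u v) w =
  inner ('D_u G x) v w + inner ('D_v G x) u w - inner ('D_w G x) u v.
Proof.
(* [T] is twice the Christoffel symbol of the first kind and [t] its contraction with [u] and [v];
   pairing with the metric undoes the inverse metric in [christoffel_form]. *)
pose T i j l := 'D_(basis_vec R i) (fun y => G y j l : R) x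
     + 'D_(basis_vec R j) (fun y => G y i l : R) x
     - 'D_(basis_vec R l) (fun y => G y i j : R) x.
pose t : 'rV[R]_d := \row_l \sum_i \sum_j u 0 i * v 0 j * T i j l.
have E : christoffel_form G x u v = 2^-1 *: (t *m (invmx (G x))^T).
  apply/rowP => k; rewrite !mxE.
  under [in RHS]eq_bigr => l _ do rewrite !mxE mulr_suml.
  rewrite [in RHS]exchange_big mulr_sumr; apply: eq_bigr => i _ /=.
  under [in RHS]eq_bigr => l _ do rewrite mulr_suml.
  rewrite [in RHS]exchange_big mulr_sumr; apply: eq_bigr => j _ /=.
  rewrite /christoffel mulrCA; congr (_ * _).
  rewrite mulr_sumr; apply: eq_bigr => l _; rewrite /T; ring.
rewrite E {1}/inner trmx_inv symG // -scalemxAl mulmxKV // -scalemxAl mxE.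
have two0 : (2 : R) != 0 by rewrite pnatr_eq0.
apply: etrans (mulVKf two0 _) _.
apply: etrans _ (esym (congr2 (fun a b : R => a - b)
  (congr2 +%R (inner_derive_metric u v w) (inner_derive_metric v u w))
  (inner_derive_metric w u v))).
rewrite mxE; under eq_bigr => l _ do rewrite !mxE mulr_suml.
rewrite exchange_big /=.
rewrite [X in _ = _ + X - _]exchange_big /=.
rewrite [X in _ = _ - X]exchange_big /=.
rewrite -big_split /= -sumrB /=; apply: eq_bigr => i _.
under eq_bigr => l _ do rewrite mulr_suml.
rewrite [X in _ = _ - X]exchange_big /=.
rewrite exchange_big -big_split /= -sumrB /=; apply: eq_bigr => j _.
rewrite -big_split /= -sumrB /=; apply: eq_bigr => l _.
by rewrite /T; ring.
Qed.

Lemma metric_ext (a b : 'rV[R]_d) :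
  (forall w, inner (G x) a w = inner (G x) b w) -> a = b.
Proof.
move=> ab; apply: (can_inj (mulmxK Gu)); apply: trmx_inj.
apply/matrixP => i j; rewrite !mxE.
have := ab (basis_vec R i).
by rewrite !ord1 /inner /basis_vec trmx_delta -!colE !mxE.
Qed.

Lemma christoffelC u v : christoffel_form G x u v = christoffel_form G x v u.
Proof.
apply: metric_ext => w.
have sum2 a b X Y Z Z' : 2 * a = X + Y - Z -> 2 * b = Y + X - Z' -> Z = Z' ->
    a = b :> R by lra.
exact: sum2 (Koszul u v w) (Koszul v u w) (innerC u v (symm_derive_metric w)).
Qed.

Lemma christoffel_compatible w u v :
  inner (G x) (christoffel_form G x w u) v
  + inner (G x) u (christoffel_form G x w v) = inner ('D_w G x) u v.
Proof.
rewrite [X in _ + X](innerC _ _ (symG Ux)).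
have S := innerC u v (symm_derive_metric w).
have sum2 a b X X' Y Z : 2 * a = X + Y - Z -> 2 * b = X' + Z - Y -> X = X' ->
    a + b = X :> R by lra.
exact: sum2 (Koszul w u v) (Koszul w v u) S.
Qed.

End LeviCivita.

Lemma christoffel_formPl (R : realType) d (G : 'rV[R]_d -> 'M[R]_d) x a u v w :
  christoffel_form G x (a *: u + v) w =
  a *: christoffel_form G x u w + christoffel_form G x v w.
Proof.
apply/rowP => k; rewrite !mxE mulr_sumr -big_split /=; apply: eq_bigr => i _.
rewrite mulr_sumr -big_split /=; apply: eq_bigr => j _; rewrite !mxE; ring.
Qed.

Lemma christoffel_formPr (R : realType) d (G : 'rV[R]_d -> 'M[R]_d) x a u v w :
  christoffel_form G x w (a *: u + v) =
  a *: christoffel_form G x w u + christoffel_form G x w v.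
Proof.
apply/rowP => k; rewrite !mxE mulr_sumr -big_split /=; apply: eq_bigr => i _.
rewrite mulr_sumr -big_split /=; apply: eq_bigr => j _; rewrite !mxE; ring.
Qed.

Section ChristoffelLinear.
Variables (R : realType) (d : nat) (G : 'rV[R]_d -> 'M[R]_d).
Implicit Types x u v w : 'rV[R]_d.

Lemma christoffel_formDr x u v w : christoffel_form G x w (u + v) =
  christoffel_form G x w u + christoffel_form G x w v.
Proof. exact: affineD (fun a u v => christoffel_formPr G x a u v w) u v. Qed.

Lemma christoffel_formZr x a u w : christoffel_form G x w (a *: u) =
  a *: christoffel_form G x w u.
Proof. exact: affineZ (fun a u v => christoffel_formPr G x a u v w) a u. Qed.

Lemma christoffel_formNr x u w : christoffel_form G x w (- u) =
  - christoffel_form G x w u.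
Proof. exact: affineN (fun a u v => christoffel_formPr G x a u v w) u. Qed.

End ChristoffelLinear.

Local Opaque derive christoffel_form inner.

Lemma addrACA_sub (V : zmodType) (a b c a' b' c' : V) :
  (a + a') + (b + b') - (c + c') = (a + b - c) + (a' + b' - c').
Proof. by rewrite opprD !addrA [LHS](ACl (1*3*5*2*4*6)). Qed.

(** * Tensoriality of covariant derivatives *)

Section Tensoriality.
Variables (R : realType) (d : nat).
Implicit Types (G A : 'rV[R]_d -> 'M[R]_d) (X Y : 'rV[R]_d -> 'rV[R]_d).

(* Values at [x] of nabla_u X and of (nabla_u A) v; they depend on [u] and [v]
   only through their values at [x]. *)
Definition cov_vec G X (x u : 'rV[R]_d) : 'rV[R]_d :=
  'D_u X x + christoffel_form G x u (X x).

Definition cov_end G A (x u v : 'rV[R]_d) : 'rV[R]_d :=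
  v *m 'D_u A x + christoffel_form G x u (v *m A x)
  - christoffel_form G x u v *m A x.

Lemma derive_app_end A Y x u : differentiable A x -> differentiable Y x ->
  'D_u (app_end A Y) x = 'D_u Y x *m A x + Y x *m 'D_u A x.
Proof. by move=> dA dY; apply: derive_mulmx; exact: diff_derivable. Qed.

(** The derivatives of [Y] cancel. This is what allows the class identities to be tested on constant
    fields. *)
Lemma nabla_endE G A X Y x : differentiable A x -> differentiable Y x ->
  nabla_end G A X Y x = cov_end G A x (X x) (Y x).
Proof.
move=> dA dY; rewrite /nabla_end /nabla derive_app_end // /cov_end mulmxDl.
by rewrite opprD !addrA [LHS](ACl ((1*4)*2*3*5)) /= subrr add0r.
Qed.

Lemma cov_vecP G X x a u v : differentiable X x ->
  cov_vec G X x (a *: u + v) = a *: cov_vec G X x u + cov_vec G X x v.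
Proof.
move=> dX; rewrite /cov_vec deriveDv // deriveZv // christoffel_formPl.
rewrite scalerDr; exact: addrACA.
Qed.

Lemma cov_endPl G A x a u v w : differentiable A x ->
  cov_end G A x (a *: u + v) w = a *: cov_end G A x u w + cov_end G A x v w.
Proof.
move=> dA; rewrite /cov_end deriveDv // deriveZv // !christoffel_formPl.
rewrite mulmxDr -scalemxAr mulmxDl -scalemxAl scalerBr scalerDr.
exact: addrACA_sub.
Qed.

Lemma cov_endPr G A x a u v w :
  cov_end G A x w (a *: u + v) = a *: cov_end G A x w u + cov_end G A x w v.
Proof.
rewrite /cov_end mulmxDl -scalemxAl [(_ + _) *m A x]mulmxDl.
rewrite -[(a *: u) *m A x]scalemxAl !christoffel_formPr.
rewrite mulmxDl -scalemxAl scalerBr scalerDr.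
exact: addrACA_sub.
Qed.

Lemma bracket_cst (u v x : 'rV[R]_d) : bracket (fun=> u) (fun=> v) x = 0.
Proof. by rewrite /bracket !derive_cst subrr. Qed.

End Tensoriality.

Section MetricPoint.
Variables (R : realType) (d : nat) (M : riem_manifold R d).
Variables (a : chart M) (x : 'rV[R]_d).
Hypothesis Ux : cod a x.
Local Notation G := (metric a).

Lemma metric_smooth : smooth_mx_on (cod a) G.
Proof. by have [+ _ _ _] := metricP M; apply. Qed.

Lemma metric_sym y : cod a y -> (G y)^T = G y.
Proof. by have [_ + _ _] := metricP M; apply. Qed.

Lemma metric_pos y : cod a y -> forall u, u != 0 -> 0 < inner (G y) u u.
Proof. by have [_ _ + _] := metricP M; apply. Qed.

Definition metric_at : metric_space 'rV[R]_d :=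
  @MetricSpace _ _ (inner (G x)) (fun c u v w => innerPl (G x) c u v w)
    (fun u v => innerC u v (metric_sym Ux)) (metric_pos Ux).

Let oU : open (cod a) := @cod_open _ _ _ a.

Lemma metric_christoffelC u v :
  christoffel_form G x u v = christoffel_form G x v u.
Proof. exact: christoffelC oU metric_smooth metric_sym metric_pos _ Ux u v. Qed.

Lemma metric_compatible w u v :
  inner ('D_w G x) u v = inner (G x) (christoffel_form G x w u) v
  + inner (G x) u (christoffel_form G x w v).
Proof.
apply: esym.
exact: christoffel_compatible oU metric_smooth metric_sym metric_pos _ Ux w u v.
Qed.

Lemma derive_metric_fields (X Y : 'rV[R]_d -> 'rV[R]_d) u :
  derivable X x u -> derivable Y x u ->
  'D_u (fun y => inner (G y) (X y) (Y y)) x =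
  inner (G x) (cov_vec G X x u) (Y x) + inner (G x) (X x) (cov_vec G Y x u).
Proof.
move=> dX dY; have dG : derivable G x u := smooth_mx_derivable oU metric_smooth Ux.
apply: etrans (derive_inner dG dX dY) _.
rewrite metric_compatible /cov_vec innerDl innerDr.
by rewrite !addrA [LHS](ACl (3*1*4*2)).
Qed.

End MetricPoint.

(** * Skew endomorphism fields and closedness of their two-forms *)

Section SkewEndomorphism.
Variables (R : realType) (d : nat) (M : riem_manifold R d) (a : chart M).
Local Notation G := (metric a).
Local Notation U := (cod a).
Variable A : 'rV[R]_d -> 'M[R]_d.
Hypothesis sA : smooth_mx_on U A.
Hypothesis skewA : forall y, U y -> forall u v,
  inner (G y) (u *m A y) v = - inner (G y) u (v *m A y).
Variables (x : 'rV[R]_d) (Ux : U x).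
Implicit Types u v w : 'rV[R]_d.

Let oU : open U := @cod_open _ _ _ a.
Let Kx := cov_end G A x.

Lemma smooth_vA v : smooth_mx_on U (fun y => v *m A y).
Proof. exact: (@smooth_mulmx _ _ _ oU _ _ _ (fun=> v) A (smooth_mx_cst oU v) sA). Qed.

Lemma derivable_vA v u : derivable (fun y => v *m A y) x u.
Proof. exact: (smooth_mx_derivable oU (smooth_vA v) Ux). Qed.

Lemma derive_inner_end u v w :
  'D_u (fun y => inner (G y) (v *m A y) w) x =
  inner (G x) (Kx u v) w + inner (G x) (christoffel_form G x u v *m A x) w
  + inner (G x) (v *m A x) (christoffel_form G x u w).
Proof.
have dA : derivable A x u := smooth_mx_derivable oU sA Ux.
apply: etrans (derive_metric_fields Ux (@derivable_vA v u) (derivable_cst _ _ _)) _.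
have -> : cov_vec G (fun=> w) x u = christoffel_form G x u w.
  by rewrite /cov_vec derive_cst add0r.
congr (_ + _); rewrite -innerDl; congr (inner _ _ _).
rewrite /Kx /cov_end subrK /cov_vec; congr (_ + _).
apply: etrans (derive_mulmx (derivable_cst v x u) dA) _.
by rewrite derive_cst mul0mx add0r.
Qed.

Let swapA y u v : U y ->
  inner (G y) (u *m A y) v = - inner (G y) (v *m A y) u.
Proof. by move=> Uy; rewrite skewA // (innerC _ _ (metric_sym Uy)). Qed.

Lemma smooth_inner_vA v w : smooth_on U (fun y => inner (G y) (v *m A y) w).
Proof.
exact: (inner_smooth oU (@metric_smooth _ _ M a) (smooth_vA v) (smooth_mx_cst oU w)).
Qed.

Let derivable_inner_vA u v w :
  derivable (fun y => inner (G y) (v *m A y) w) x u.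
Proof. exact/diff_derivable/(smooth_on_differentiable oU (smooth_inner_vA v w) Ux). Qed.

(** Differentiate the skewness of [A] on constant vectors; the Christoffel terms on the two sides
    match in pairs, again by skewness. *)
Lemma cov_end_skew u v w : inner (G x) (Kx u v) w = - inner (G x) v (Kx u w).
Proof.
have E : 'D_u (fun y => inner (G y) (v *m A y) w) x =
    - 'D_u (fun y => inner (G y) (w *m A y) v) x.
  apply: etrans _ (deriveN (@derivable_inner_vA u w v)).
  by apply: (derive_eq_on oU u Ux) => y Uy; exact: swapA.
have sum3 (e e' k k' b c b' c' : R) : e = - e' -> e = k + b + c ->
    e' = k' + b' + c' -> b = - c' -> c = - b' -> k = - k' by move=> *; lra.
apply: etrans _ (congr1 -%R (innerC (Kx u w) v (metric_sym Ux))).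
exact: sum3 E (derive_inner_end u v w) (derive_inner_end u w v)
  (swapA _ _ Ux) (swapA _ _ Ux).
Qed.

Let Q u v w := 'D_u (fun y => inner (G y) (v *m A y) w) x.

(** [Q] is a partial derivative of a component of the two-form. In the cyclic sum the Christoffel
    terms cancel, as the connection is torsion-free and [A] is skew, so partial derivatives may be
    replaced by covariant ones. *)
Lemma cyclic_closed : (forall u v w, Q u v w + Q v w u + Q w u v = 0) ->
  forall u v w, inner (G x) v (Kx u w) + inner (G x) w (Kx v u)
                + inner (G x) u (Kx w v) = 0.
Proof.
move=> cyc u v w; have E := cyc u v w.
have Q1 := derive_inner_end u v w; have Q2 := derive_inner_end v w u.
have Q3 := derive_inner_end w u v.
rewrite (metric_christoffelC Ux v u) in Q2.
rewrite (metric_christoffelC Ux w u) (metric_christoffelC Ux w v) in Q3.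
have K1 := cov_end_skew u v w; have K2 := cov_end_skew v w u.
have K3 := cov_end_skew w u v.
have S1 := swapA (christoffel_form G x u v) w Ux.
have S2 := swapA (christoffel_form G x v w) u Ux.
have S3 := swapA (christoffel_form G x u w) v Ux.
have sum (q1 q2 q3 k1 k2 k3 b1 b2 b3 c1 c2 c3 d1 d2 d3 : R) :
  q1 + q2 + q3 = 0 -> q1 = k1 + b1 + c1 -> q2 = k2 + b2 + c2 ->
  q3 = k3 + b3 + c3 -> b1 = - c2 -> b2 = - c3 -> b3 = - c1 ->
  k1 = - d1 -> k2 = - d2 -> k3 = - d3 -> d1 + d2 + d3 = 0.
  by move=> *; lra.
exact: sum E Q1 Q2 Q3 S1 S2 S3 K1 K2 K3.
Qed.

Definition fundamental_form (X Y : 'rV[R]_d -> 'rV[R]_d) y : R :=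
  inner (G y) (X y) (app_end A Y y).

Lemma derive_fundamental_form u v w :
  'D_u (fundamental_form (fun=> v) (fun=> w)) x = - Q u v w.
Proof.
have E y : U y -> fundamental_form (fun=> v) (fun=> w) y =
    - inner (G y) (v *m A y) w.
  by move=> Uy; rewrite skewA // opprK.
exact: etrans (derive_eq_on oU u Ux E) (deriveN (@derivable_inner_vA u v w)).
Qed.

Lemma d_fundamental_form_closed :
  (forall u v w, d_two_form fundamental_form (fun=> u) (fun=> v) (fun=> w) x = 0) ->
  forall u v w, inner (G x) v (Kx u w) + inner (G x) w (Kx v u)
                + inner (G x) u (Kx w v) = 0.
Proof.
move=> dO; apply: cyclic_closed => u v w; have E := dO u v w.
have B s t r : fundamental_form (bracket (fun=> s) (fun=> t)) (fun=> r) x = 0.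
  by rewrite /fundamental_form bracket_cst inner0l.
have sum (q1 q2 q3 o1 o2 o3 b1 b2 b3 : R) :
  o1 = - q1 -> o2 = - q2 -> o3 = - q3 -> b1 = 0 -> b2 = 0 -> b3 = 0 ->
  3^-1 * (o1 + o2 + o3 - b1 - b2 - b3) = 0 -> q1 + q2 + q3 = 0.
  by move=> -> -> -> -> -> -> {}E; lra.
exact: sum (derive_fundamental_form u v w) (derive_fundamental_form v w u)
  (derive_fundamental_form w u v) (B u v w) (B w u v) (B v w u) E.
Qed.

End SkewEndomorphism.

Lemma addr_cancel (V : zmodType) (a b c t l1 l2 : V) :
  l1 + (- a + b) - t + (l2 + t - (- a + c)) = l2 + l1 + b - c.
Proof.
rewrite !opprD opprK !addrA [LHS](ACl ((2*7)*(4*6)*(5*1*3*8))) /=.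
by rewrite !addNr !add0r.
Qed.

Lemma addr_reorder (V : zmodType) (a b c e : V) : a + b + c + e - a = b + (c + e).
Proof. by rewrite -!addrA addrC !addrA addrNK. Qed.

(** * The pointwise structure carried by an almost contact metric manifold *)

Section AcmAt.
Variables (R : realType) (m : nat) (M : acm_manifold R m) (a : chart M).
Notation D := m.*2.+1.
Local Notation G := (metric a).
Local Notation U := (cod a).
Implicit Types u v w y : 'rV[R]_D.

Let oU : open U := @cod_open _ _ _ a.

Lemma phi_smooth : smooth_mx_on U (phi a).
Proof. by have [+ _] := phi_tensor M; apply. Qed.

Lemma xi_smooth : smooth_mx_on U (xi a).
Proof. by have [+ _] := xi_field M; apply. Qed.

Lemma eta_smooth : smooth_mx_on U (eta a).
Proof. by have [+ _] := eta_form M; apply. Qed.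

(** phi^2 xi = 0, so phi^2 at phi xi gives phi xi = c xi with c = eta(phi xi); applying phi once
    more gives c^2 = 0. *)
Lemma xi_phi y : U y -> xi a y *m phi a y = 0.
Proof.
move=> Uy; have E := phi_sq Uy (xi a y).
rewrite (eta_xi Uy) scale1r addNr in E.
have E2 := phi_sq Uy (xi a y *m phi a y).
rewrite E mul0mx in E2; set c := (_ *m eta a y) 0 0 in E2.
have E3 : xi a y *m phi a y = c *: xi a y.
  by apply/eqP; rewrite -subr_eq0 -oppr_eq0 opprB addrC -E2.
have : c *: (xi a y *m phi a y) = 0 by rewrite scalemxAl -E3.
rewrite {1}E3 scalerA => /(congr1 (fun v => (v *m eta a y) 0 0)).
rewrite -scalemxAl mxE (eta_xi Uy) mulr1 mul0mx mxE => /eqP.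
by rewrite mulf_eq0 orbb E3 => /eqP ->; rewrite scale0r.
Qed.

Lemma eta_inner y u : U y -> (u *m eta a y) 0 0 = inner (G y) u (xi a y).
Proof.
move=> Uy; have := metric_phi Uy u (xi a y).
rewrite xi_phi // inner0r eta_xi // mulr1 => /esym/eqP.
by rewrite subr_eq0 => /eqP.
Qed.

(** The two ways of expanding phi^3 u differ by eta(phi u) xi. *)
Lemma eta_phi y u : U y -> (u *m phi a y *m eta a y) 0 0 = 0.
Proof.
move=> Uy; have := phi_sq Uy (u *m phi a y).
rewrite (phi_sq Uy u) mulmxDl mulNmx -scalemxAl xi_phi // scaler0 addr0.
rewrite -[X in X = _]addr0 => /addrI/(congr1 (fun v => (v *m eta a y) 0 0)).
rewrite mul0mx -scalemxAl [X in X = _ -> _]mxE [X in _ = X -> _]mxE (eta_xi Uy).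
by rewrite mulr1 => <-.
Qed.

Lemma inner_phi_skew y u v : U y ->
  inner (G y) (u *m phi a y) v = - inner (G y) u (v *m phi a y).
Proof.
move=> Uy; have := metric_phi Uy u (v *m phi a y).
rewrite phi_sq // innerDr innerNr innerZr -eta_inner //.
by rewrite !eta_phi // !mulr0 addr0 subr0 => <-; rewrite opprK.
Qed.


Section AtPoint.
Variables (x : 'rV[R]_D) (Ux : U x).

Let dphi : differentiable (phi a) x := smooth_mx_differentiable oU phi_smooth Ux.
Let dxi : differentiable (xi a) x := smooth_mx_differentiable oU xi_smooth Ux.

Let g := metric_at Ux.
Let Kx := cov_end G (phi a) x.
Let Nx := cov_vec G (xi a) x.

Fact phi_at_linear b u v :
  (b *: u + v) *m phi a x = b *: (u *m phi a x) + v *m phi a x.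
Proof. by rewrite mulmxDl scalemxAl. Qed.

Fact phi_at_sq u : u *m phi a x *m phi a x = - u + ip g u (xi a x) *: xi a x.
Proof. by rewrite (phi_sq Ux) (eta_inner _ Ux). Qed.

Fact xi_at_unit : ip g (xi a x) (xi a x) = 1.
Proof. by rewrite /= -(eta_inner _ Ux) (eta_xi Ux). Qed.

Fact metric_phi_at u v : ip g (u *m phi a x) (v *m phi a x) =
  ip g u v - ip g u (xi a x) * ip g v (xi a x).
Proof. by rewrite /= (metric_phi Ux) !(eta_inner _ Ux). Qed.

Let skew_phi y (Uy : U y) u v :
  inner (G y) (u *m phi a y) v = - inner (G y) u (v *m phi a y) :=
  inner_phi_skew u v Uy.

Let derivable_vphi v u : derivable (fun y => v *m phi a y) x u.
Proof. exact: (derivable_vA phi_smooth Ux). Qed.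

Fact nphi_skew u v w : ip g (Kx u v) w = - ip g v (Kx u w).
Proof. exact: (cov_end_skew phi_smooth skew_phi Ux). Qed.

Lemma derive_eta u v : 'D_u (fun y => inner (G y) v (xi a y)) x =
  inner (G x) (christoffel_form G x u v) (xi a x) + inner (G x) v (Nx u).
Proof.
have dxu : derivable (xi a) x u by exact: diff_derivable.
apply: etrans (derive_metric_fields Ux (derivable_cst v _ _) dxu) _.
by rewrite {1}/cov_vec derive_cst add0r.
Qed.

(** The covariant derivative of phi^2 = -1 + eta xi. The identity is differentiated at a constant
    [v]; the Christoffel terms then cancel or complete the derivative of xi. *)
Fact nphi_phi u v : Kx u (v *m phi a x) + Kx u v *m phi a x =
  ip g (Nx u) v *: xi a x + ip g v (xi a x) *: Nx u.
Proof.
have dpu : derivable (phi a) x u by exact: diff_derivable.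
have dxu : derivable (xi a) x u by exact: diff_derivable.
have E : 'D_u (fun y => v *m phi a y *m phi a y) x =
         'D_u (fun y => - v + inner (G y) v (xi a y) *: xi a y) x.
  apply: (derive_eq_on oU _ Ux) => y Uy.
  by rewrite (phi_sq Uy) (eta_inner _ Uy).
have ds : derivable (fun y => inner (G y) v (xi a y)) x u.
  have sm := inner_smooth oU (@metric_smooth _ _ M a) (smooth_mx_cst oU v) xi_smooth.
  exact/diff_derivable/(smooth_on_differentiable oU sm Ux).
have dsx : derivable (fun y => inner (G y) v (xi a y) *: xi a y) x u.
  by rewrite (_ : (fun y => _) = (fun y => (inner (G y) v (xi a y))%:M *m xi a y));
    [apply: derivable_mulmx => //; exact: derivable_scalar_mx
    |apply/funext => y; rewrite mul_scalar_mx].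
have E1 : 'D_u (fun y => v *m phi a y *m phi a y) x =
    v *m 'D_u (phi a) x *m phi a x + v *m phi a x *m 'D_u (phi a) x.
  apply: etrans (derive_mulmx (@derivable_vphi v u) dpu) _.
  congr (_ *m _ + _).
  apply: etrans (derive_mulmx (derivable_cst v x u) dpu) _.
  by rewrite derive_cst mul0mx add0r.
have E2 : 'D_u (fun y => - v + inner (G y) v (xi a y) *: xi a y) x =
    (inner (G x) (christoffel_form G x u v) (xi a x) + inner (G x) v (Nx u))
      *: xi a x + inner (G x) v (xi a x) *: 'D_u (xi a) x.
  apply: etrans (deriveD (derivable_cst (- v) x u) dsx) _.
  rewrite derive_cst add0r; apply: etrans (derive_scale ds dxu) _.
  by congr (_ *: _ + _); exact: derive_eta.
have {E1 E2}E := etrans (esym E1) (etrans E E2).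
rewrite /Kx /cov_end; set Gm := christoffel_form G x in E *.
set L1 := v *m phi a x *m _ in E *; set L2 := v *m 'D_u (phi a) x *m _ in E.
rewrite mulmxBl mulmxDl -/L2 (phi_sq Ux (Gm u v)) (eta_inner _ Ux).
have -> : Gm u (v *m phi a x *m phi a x) =
    - Gm u v + inner (G x) v (xi a x) *: Gm u (xi a x).
  rewrite (phi_sq Ux) (eta_inner _ Ux) /Gm christoffel_formDr.
  by rewrite christoffel_formNr christoffel_formZr.
have -> : ip g (Nx u) v = inner (G x) v (Nx u) := innerC _ _ (metric_sym Ux).
apply: etrans (addr_cancel _ _ _ _ _ _) _; rewrite E.
rewrite [ip g v _]/= {3}/Nx /cov_vec scalerDl scalerDr.
exact: addr_reorder.
Qed.


Fact nxi_xi u : ip g (Nx u) (xi a x) = 0.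
Proof.
have dxu : derivable (xi a) x u by exact: diff_derivable.
have E : 'D_u (fun y => inner (G y) (xi a y) (xi a y)) x = 0.
  rewrite -[RHS](@derive_cst _ _ _ (1 : R) x u).
  apply: (derive_eq_on oU _ Ux) => y Uy.
  by rewrite -(eta_inner _ Uy) (eta_xi Uy).
have := derive_metric_fields Ux dxu dxu; rewrite E.
rewrite [X in _ = _ + X](innerC _ _ (metric_sym Ux)) => /esym/eqP.
by rewrite -mulr2n mulrn_eq0 => /eqP.
Qed.

Definition acm_at : acm_point 'rV[R]_D :=
  @AcmPoint _ _ g (fun u => u *m phi a x) (xi a x) Kx Nx phi_at_linear phi_at_sq
    xi_at_unit metric_phi_at
    (fun b u v w => cov_endPl (metric a) b u v w dphi)
    (fun w b u v => cov_endPr (metric a) (phi a) x b u v w)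
    (fun b u v => cov_vecP (metric a) b u v dxi)
    nphi_skew nphi_phi nxi_xi.

End AtPoint.
End AcmAt.

Lemma smooth_mx_sub (R : realType) d p q (U V : set 'rV[R]_d)
    (A : 'rV[R]_d -> 'M[R]_(p, q)) :
  V `<=` U -> smooth_mx_on U A -> smooth_mx_on V A.
Proof. by move=> VU sA i j s x Vx; apply: sA; exact: VU. Qed.

(** * From the contact classes to the pointwise conditions *)

Section ClassesAtPoint.
Variables (R : realType) (m : nat) (M : acm_manifold R m) (a : chart M).
Notation D := m.*2.+1.
Local Notation G := (metric a).
Local Notation U := (cod a).
Implicit Types (u v w : 'rV[R]_D) (X Y : 'rV[R]_D -> 'rV[R]_D).

Let oU : open U := @cod_open _ _ _ a.

Lemma in_chart_cod : in_chart a U. Proof. by split. Qed.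

Variables (x : 'rV[R]_D) (Ux : U x).
Let p := acm_at Ux.

Let scst u : smooth_mx_on U (fun=> u). Proof. exact: smooth_mx_cst. Qed.

Lemma nabla_phi_at V X Y : in_chart a V -> V x -> smooth_mx_on V Y ->
  nabla_phi a X Y x = nph p (X x) (Y x).
Proof.
move=> [oV VU] Vx sY; apply: nabla_endE.
  exact: (smooth_mx_differentiable oU (@phi_smooth _ _ M a) Ux).
exact: (smooth_mx_differentiable oV sY Vx).
Qed.

Lemma phi_of_smooth V X : in_chart a V -> smooth_mx_on V X ->
  smooth_mx_on V (phi_of a X).
Proof.
move=> [oV VU] sX.
exact: (@smooth_mulmx _ _ _ oV _ _ _ X (phi a) sX (smooth_mx_sub VU (@phi_smooth _ _ M a))).
Qed.

Lemma P_acm_at V X Y : in_chart a V -> V x -> smooth_mx_on V Y ->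
  P_acm a X Y x = Pph p (X x) (Y x).
Proof.
move=> cV Vx sY; rewrite /P_acm (nabla_phi_at _ cV Vx sY).
by rewrite (nabla_phi_at _ cV Vx (phi_of_smooth cV sY)).
Qed.

Lemma Q_acm_at V X Y : in_chart a V -> V x -> smooth_mx_on V X ->
  smooth_mx_on V Y -> Q_acm a X Y x = nph p (X x) (Y x) + nph p (Y x) (X x).
Proof.
move=> cV Vx sX sY; rewrite /Q_acm (nabla_phi_at _ cV Vx sY).
by rewrite (nabla_phi_at _ cV Vx sX).
Qed.

Lemma eta_of_at X : eta_of a X x = ip p (X x) (rb p).
Proof. exact: eta_inner. Qed.

Let phi_xi y : U y -> phi_of a (xi a) y = 0.
Proof. exact: xi_phi. Qed.

Lemma bracket_phi_xi X : bracket X (phi_of a (xi a)) x = 0.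
Proof.
rewrite /bracket phi_xi // derive0 subr0.
by apply: etrans (derive_eq_on oU (X x) Ux phi_xi) _; exact: derive_cst.
Qed.

Lemma h_tensor_xi : h_tensor a (xi a) x = 0.
Proof.
rewrite /h_tensor bracket_phi_xi /phi_of /app_end {1}/bracket subrr mul0mx.
by rewrite subrr scaler0.
Qed.

(** On ker eta only the xi term survives. At (xi, xi) the right-hand side is 2 xi - (xi + xi + h xi)
    with h xi = 0, so (nabla_xi phi) xi = 0. *)
Lemma quasi_contact_at : quasi_contact M ->
  (forall u v, horizontal p u -> horizontal p v ->
     Pph p u v = (2 * ip p u v) *: rb p) /\ geodesic p.
Proof.
move=> qc; split=> [u v hu hv|].
  have := qc a _ in_chart_cod _ _ (scst u) (scst v) x Ux.
  rewrite (P_acm_at _ in_chart_cod Ux (scst v)) => ->.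
  by rewrite [eta_of a (fun=> v) x]eta_of_at hv scale0r subr0.
apply: geodesic_K; rewrite -P_rb_rb.
have sx := @xi_smooth _ _ M a.
have := qc a _ in_chart_cod _ _ sx sx x Ux.
rewrite (P_acm_at _ in_chart_cod Ux sx) h_tensor_xi addr0 => ->.
rewrite [eta_of a (xi a) x]eta_of_at [ip p _ _](ip_rb p) !scale1r.
rewrite [g_of a _ _ x](ip_rb p) mulr1 scaler_nat mulr2n; exact: subrr.
Qed.

Lemma quasi_K_Sasakian_at : quasi_K_Sasakian M ->
  (forall u v, horizontal p u -> horizontal p v ->
     Pph p u v = (2 * ip p u v) *: rb p) /\ geodesic p.
Proof.
move=> qc; split=> [u v hu hv|].
  have := qc a _ in_chart_cod _ _ (scst u) (scst v) x Ux.
  rewrite (P_acm_at _ in_chart_cod Ux (scst v)) => ->.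
  by rewrite [eta_of a (fun=> v) x]eta_of_at hv mulr0 !scale0r subr0 addr0.
apply: geodesic_K; rewrite -P_rb_rb.
have sx := @xi_smooth _ _ M a.
have := qc a _ in_chart_cod _ _ sx sx x Ux.
rewrite (P_acm_at _ in_chart_cod Ux sx) => ->.
rewrite [eta_of a (xi a) x]eta_of_at [ip p _ _](ip_rb p) scale1r.
rewrite [g_of a _ _ x](ip_rb p) subrr add0r.
apply: etrans (_ : cov_vec G (xi a) x (phi_of a (xi a) x) = 0) => //.
by rewrite phi_xi //; exact: (affine0 (nrbP p)).
Qed.

Lemma quasi_K_cosymplectic_at : quasi_K_cosymplectic M ->
  (forall u v, horizontal p u -> horizontal p v ->
     Pph p u v = (0 * ip p u v) *: rb p) /\ geodesic p.
Proof.
move=> qc; split=> [u v hu hv|].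
  have := qc a _ in_chart_cod _ _ (scst u) (scst v) x Ux.
  rewrite (P_acm_at _ in_chart_cod Ux (scst v)) => ->.
  by rewrite [eta_of a (fun=> v) x]eta_of_at hv mul0r !scale0r.
apply: geodesic_K; rewrite -P_rb_rb.
have sx := @xi_smooth _ _ M a.
have := qc a _ in_chart_cod _ _ sx sx x Ux.
rewrite (P_acm_at _ in_chart_cod Ux sx) => ->.
rewrite [eta_of a (xi a) x]eta_of_at [ip p _ _](ip_rb p) scale1r.
apply: etrans (_ : cov_vec G (xi a) x (phi_of a (xi a) x) = 0) => //.
by rewrite phi_xi //; exact: (affine0 (nrbP p)).
Qed.

Lemma nearly_cosymplectic_at : nearly_cosymplectic M -> forall u, nph p u u = 0.
Proof.
move=> nc u; have := nc a _ in_chart_cod _ (scst u) x Ux.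
by rewrite (nabla_phi_at _ in_chart_cod Ux (scst u)).
Qed.

Lemma nearly_alpha_Sasakian_at : nearly_alpha_Sasakian M ->
  exists2 c, c != 0 & forall u v, nph p u v + nph p v u =
    c *: ((2 * ip p u v) *: rb p - ip p v (rb p) *: u - ip p u (rb p) *: v).
Proof.
move=> [c c0 ns]; exists c => // u v.
have := ns a _ in_chart_cod _ _ (scst u) (scst v) x Ux.
by rewrite (Q_acm_at in_chart_cod Ux (scst u) (scst v)) !eta_of_at.
Qed.

Lemma derive_eta_at u v :
  'D_u (eta_of a (fun=> v)) x =
  inner (G x) (christoffel_form G x u v) (xi a x) + ip p (nrb p u) v.
Proof.
have E y : U y -> eta_of a (fun=> v) y = inner (G y) v (xi a y).
  by move=> Uy; exact: eta_inner.
apply: etrans (derive_eq_on oU u Ux E) _; rewrite derive_eta //.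
by congr (_ + _); exact: innerC (metric_sym Ux).
Qed.

Lemma d_eta_at u v :
  2 * d_eta a (fun=> u) (fun=> v) x = ip p (nrb p u) v - ip p (nrb p v) u.
Proof.
rewrite /d_eta [eta_of a (bracket _ _) x]eta_of_at bracket_cst ip0l subr0.
have := derive_eta_at u v; have := derive_eta_at v u.
rewrite (metric_christoffelC Ux v u).
have sum2 (c e f s t : R) : s = c + e -> t = c + f -> 2 * (2^-1 * (t - s)) = f - e.
  by move=> -> ->; field.
exact: sum2.
Qed.

Let skew_phi y (Uy : U y) u v :
  inner (G y) (u *m phi a y) v = - inner (G y) u (v *m phi a y) :=
  inner_phi_skew u v Uy.

Lemma d_Omega_zero_at : d_Omega_zero M ->
  forall u v w,
    ip p v (nph p u w) + ip p w (nph p v u) + ip p u (nph p w v) = 0.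
Proof.
move=> dO.
apply: (d_fundamental_form_closed (@phi_smooth _ _ M a) skew_phi Ux) => u v w.
exact: dO in_chart_cod _ _ _ (scst u) (scst v) (scst w) x Ux.
Qed.

Lemma d_eta_Omega_at c : d_eta_Omega M c -> forall u v,
  ip p (nrb p u) v - ip p (nrb p v) u = 2 * c * ip p u (ph p v).
Proof.
move=> dO u v; rewrite -d_eta_at -mulrA; congr (_ * _).
exact: dO in_chart_cod _ _ (scst u) (scst v) x Ux.
Qed.

(** alpha Omega = d eta is exact. The derivatives of its components are mixed second derivatives of
    the components of eta, which cancel in the cyclic sum; then divide by the nonzero constant. *)
Lemma contact_closed c : c != 0 -> d_eta_Omega M c -> forall u v w,
  ip p v (nph p u w) + ip p w (nph p v u) + ip p u (nph p w v) = 0.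
Proof.
move=> c0 dO.
apply: (cyclic_closed (@phi_smooth _ _ M a) skew_phi Ux) => u v w.
pose Q u v w := 'D_u (fun y => inner (G y) (v *m phi a y) w) x.
have se s : smooth_on U (eta_of a (fun=> s)).
  exact: (@smooth_mulmx _ _ _ oU _ _ _ (fun=> s) (eta a) (scst s) (@eta_smooth _ _ M a)) 0 0.
have E s t r : c * - Q s t r =
    2^-1 * ('D_s ('D_t (eta_of a (fun=> r))) x - 'D_s ('D_r (eta_of a (fun=> t))) x).
  rewrite /Q -(derive_fundamental_form (@phi_smooth _ _ M a) skew_phi Ux).
  have sO : smooth_on U (Omega a (fun=> t) (fun=> r)).
    apply: inner_smooth => //; first exact: metric_smooth.
    exact: phi_of_smooth in_chart_cod (scst r).
  have dOm : derivable (Omega a (fun=> t) (fun=> r)) x s :=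
    diff_derivable (smooth_on_differentiable oU sO Ux).
  have d2 b e : derivable ('D_b (eta_of a (fun=> e))) x s.
    apply/diff_derivable/(smooth_on_differentiable oU _ Ux).
    exact: (smooth_on_derive_cst oU _ (se e)).
  apply: etrans (esym (deriveZ c dOm)) _.
  apply: etrans _ (etrans (deriveZ 2^-1 (derivableB (d2 t r) (d2 r t)))
     (congr1 ( *:%R 2^-1) (deriveB (d2 t r) (d2 r t)))).
  apply: (derive_eq_on oU s Ux) => y Uy.
  have := dO a _ in_chart_cod _ _ (scst t) (scst r) y Uy.
  have Z : eta_of a (bracket (fun=> t) (fun=> r)) y = 0.
    by rewrite /eta_of bracket_cst mul0mx mxE.
  by rewrite /d_eta Z subr0 => /esym; exact.
have H1 := E u v w; have H2 := E v w u; have H3 := E w u v.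
have C1 := smooth_derive_comm oU v u (se w) Ux.
have C2 := smooth_derive_comm oU w v (se u) Ux.
have C3 := smooth_derive_comm oU u w (se v) Ux.
have sum (q1 q2 q3 d1 d1' d2 d2' d3 d3' : R) :
  c * - q1 = 2^-1 * (d1 - d3') -> c * - q2 = 2^-1 * (d2 - d1') ->
  c * - q3 = 2^-1 * (d3 - d2') -> d1 = d1' -> d2 = d2' -> d3 = d3' ->
  q1 + q2 + q3 = 0.
  move=> e1 e2 e3 f1 f2 f3.
  have : c * - q1 + c * - q2 + c * - q3 = 0 by rewrite e1 e2 e3 f1 f2 f3; ring.
  rewrite -!mulrDr => /eqP; rewrite mulf_eq0 (negPf c0) /= => /eqP E0.
  have -> : q1 + q2 + q3 = - (- q1 - q2 - q3) by rewrite !opprD !opprK.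
  by rewrite E0 oppr0.
exact: sum H1 H2 H3 C1 C2 C3.
Qed.

(** At (xi, v) every torsion term is zero or in the image of phi, so the Reeb component of normality
    is 2 d eta(xi, v) = 0, that is g(nabla_xi xi, v) = 0. *)
Lemma normal_geodesic : normal_acm M -> geodesic p.
Proof.
move=> nM; apply: (@ip_ext _ _ p) => v; rewrite ip0l.
have H := nM a _ in_chart_cod _ _ (@xi_smooth _ _ M a) (scst v) x Ux.
have B X : bracket (phi_of a (xi a)) X x = 0.
  by have := bracket_phi_xi X; rewrite /bracket -opprB => /eqP;
    rewrite oppr_eq0 => /eqP.
have ephi w : ip p (w *m phi a x) (rb p) = 0 by exact: (ip_ph_rb p).
rewrite /phi_torsion B addr0 [phi_of a (bracket _ _) x]/phi_of /app_end B in H.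
rewrite mul0mx subr0 in H.
have {}H := congr1 (fun w => ip p w (rb p)) H.
rewrite ip0l !ipDl ipNl ipZl ip_rb mulr1 !ephi oppr0 !add0r /d_eta in H.
have E1 : 'D_v (eta_of a (xi a)) x = 0.
  have E y : U y -> eta_of a (xi a) y = 1 by move=> Uy; exact: eta_xi.
  by apply: etrans (derive_eq_on oU v Ux E) _; exact: derive_cst.
have E2 := derive_eta_at (xi a x) v.
have E3 := nrb_rb p v.
(* The bracket survives because xi is not constant in the chart; the unit length of xi turns it into
   the Christoffel term that cancels the one in [E2]. *)
have E4 : eta_of a (bracket (xi a) (fun=> v)) x = - inner (G x) ('D_v (xi a) x) (xi a x).
  rewrite eta_of_at /bracket derive_cst sub0r; exact: innerNl.
have E5 : inner (G x) ('D_v (xi a) x) (xi a x)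
    + inner (G x) (christoffel_form G x v (xi a x)) (xi a x) = 0.
  by rewrite -innerDl; exact: E3.
rewrite (metric_christoffelC Ux v) in E5.
have sum (b0 b1 b2 b3 b4 b5 : R) : b1 = 0 -> b2 = b3 + b4 -> b0 = - b5 -> b5 + b3 = 0 ->
  2 * (2^-1 * (b2 - b1 - b0)) = 0 -> b4 = 0 by move=> *; lra.
exact: sum E1 E2 E4 E5 H.
Qed.

(** What is required of the target at a point. D-pluriharmonicity requires the same of the
    source. *)
Definition point_target := [/\ geodesic p, quasi p & trace_free p].

Lemma point_target_P c :
  (forall u v, horizontal p u -> horizontal p v ->
     Pph p u v = (c * ip p u v) *: rb p) -> geodesic p -> point_target.
Proof.
by move=> PE gp; split=> //; [exact: P_quasi PE|exact: P_trace_free PE].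
Qed.

Lemma point_target_closed :
  (forall u v w,
    ip p v (nph p u w) + ip p w (nph p v u) + ip p u (nph p w v) = 0) ->
  geodesic p -> point_target.
Proof.
by move=> cl gp; split=> //; [exact: closed_quasi|exact: closed_trace_free].
Qed.

Lemma contact_at c : c != 0 -> d_eta_Omega M c ->
  point_target /\ forall u, u != 0 -> horizontal p u -> twisted p.
Proof.
move=> c0 dO; have dE := d_eta_Omega_at dO.
have gp : geodesic p.
  apply: geodesic_deta => v; rewrite dE.
  by rewrite ipC ip_ph_rb mulr0.
split; first exact: point_target_closed (contact_closed c0 dO) gp.
by move=> u u0 hu; exact: contact_twisted c0 u0 hu dE.
Qed.

Lemma class_A1_at : class_A1 M ->
  point_target /\ forall u, u != 0 -> horizontal p u -> twisted p.
Proof.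
have two0 : (2 : R) != 0 by rewrite pnatr_eq0.
case=> [[c c0 dO]|/quasi_contact_at[PE gp]|/quasi_K_Sasakian_at[PE gp]|].
- exact: contact_at c0 dO.
- split; first exact: point_target_P PE gp.
  by move=> u u0 hu; exact: (P_twisted PE two0 u0 hu).
- split; first exact: point_target_P PE gp.
  by move=> u u0 hu; exact: (P_twisted PE two0 u0 hu).
- case=> [[dO _]|[[c c0 dO] _]]; [exact: contact_at (oner_neq0 R) dO|].
  exact: contact_at c0 dO.
Qed.

Lemma class_A4_at : class_A4 M -> point_target.
Proof.
move=> [nM dO _].
exact: point_target_closed (d_Omega_zero_at dO) (normal_geodesic nM).
Qed.

Lemma almost_cosymplectic_at : d_eta_zero M -> d_Omega_zero M -> point_target.
Proof.
move=> de dO; apply: point_target_closed; first exact: d_Omega_zero_at.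
apply: geodesic_deta => v; rewrite -d_eta_at.
by rewrite (de a _ in_chart_cod _ _ (scst _) (scst _) x Ux) mulr0.
Qed.

Lemma nearly_cosymplectic_target : nearly_cosymplectic M -> point_target.
Proof.
move=> /nearly_cosymplectic_at K0; split.
- exact: nearly_geodesic K0.
- exact: nearly_quasi K0.
(* Polarization of K(u, u) = 0 gives the nearly Sasakian identity with constant 0. *)
- apply: (@nearly_trace_free _ _ p 0) => u v; rewrite scale0r.
  have := K0 (u + v); rewrite (affineD (nphPr p (u + v))).
  by rewrite ![nph p (u + v) _](affineD (fun b s t => nphPl p b s t _)) !K0
    add0r addr0 addrC.
Qed.

Lemma class_B1_at : class_B1 M -> point_target.
Proof.
case=> [[de dO _]|[de dO]|nc|[[nc _]|/quasi_K_cosymplectic_at[PE gp]]].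
- exact: almost_cosymplectic_at.
- exact: almost_cosymplectic_at.
- exact: nearly_cosymplectic_target.
- exact: nearly_cosymplectic_target.
- exact: point_target_P PE gp.
Qed.

Lemma class_A6_at : class_A6 M ->
  point_target /\ forall u, u != 0 -> horizontal p u -> twisted p.
Proof.
move=> /nearly_alpha_Sasakian_at[c c0 Q6]; split.
  split; [exact: nearly_Sasakian_geodesic Q6|exact: nearly_Sasakian_quasi Q6|].
  exact: nearly_trace_free Q6.
by move=> u u0 hu; exact: (nearly_Sasakian_twisted Q6 c0 u0 hu).
Qed.

End ClassesAtPoint.

(** * The almost Hermitian classes at a point *)

Section AhAt.
Variables (R : realType) (n : nat) (N : ah_manifold R n) (b : chart N).
Local Notation G := (metric b).
Local Notation U := (cod b).
Local Notation J := (acs b).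
Implicit Types (u v w : 'rV[R]_n.*2).

Let oU : open U := @cod_open _ _ _ b.

Lemma acs_smooth : smooth_mx_on U J.
Proof. by have [+ _] := acs_tensor N; apply. Qed.

Lemma acs_skew y : U y -> forall u v,
  inner (G y) (u *m J y) v = - inner (G y) u (v *m J y).
Proof.
move=> Uy u v; have := metric_acs Uy u (v *m J y).
by rewrite (acs_sq Uy v) innerNr => <-; rewrite opprK.
Qed.

Variables (x : 'rV[R]_n.*2) (Ux : U x).
Let Kx := cov_end G J x.
Let dJ : differentiable J x := smooth_mx_differentiable oU acs_smooth Ux.

Fact acs_at_linear c u v : (c *: u + v) *m J x = c *: (u *m J x) + v *m J x.
Proof. by rewrite mulmxDl scalemxAl. Qed.

Fact cov_acs u v : Kx u (v *m J x) = - (Kx u v *m J x).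
Proof.
have dJu : derivable J x u := diff_derivable dJ.
have dvJ := @derivable_vA _ _ N b J acs_smooth x Ux v u.
have E : v *m 'D_u J x *m J x = - (v *m J x *m 'D_u J x).
  apply/eqP; rewrite -addr_eq0; apply/eqP.
  have E0 : 'D_u (fun y => v *m J y *m J y) x = 0.
    apply: etrans (_ : 'D_u (fun=> - v) x = 0); last exact: derive_cst.
    by apply: (derive_eq_on oU u Ux) => y Uy; exact: acs_sq.
  apply: etrans _ E0; apply: etrans _ (esym (derive_mulmx dvJ dJu)).
  congr (_ *m _ + _); apply: esym.
  apply: etrans (derive_mulmx (derivable_cst v x u) dJu) _.
  by rewrite derive_cst mul0mx add0r.
rewrite /Kx /cov_end mulmxBl mulmxDl E (acs_sq Ux v) christoffel_formNr.
by rewrite (acs_sq Ux (christoffel_form _ _ _ _)) !opprD !opprK -!addrA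
  [- _ - _ in RHS]addrC.
Qed.

Definition ah_at : ah_point 'rV[R]_n.*2 :=
  @AhPoint _ _ (fun u => u *m J x) Kx acs_at_linear (acs_sq Ux)
    (fun c u v w => cov_endPl (metric b) c u v w dJ)
    (fun w c u v => cov_endPr (metric b) J x c u v w)
    cov_acs.

Let in_cod : in_chart b U. Proof. by split. Qed.
Let scst u : smooth_mx_on U (fun=> u). Proof. exact: smooth_mx_cst. Qed.

Lemma nabla_J_at X Y : smooth_mx_on U Y -> nabla_J b X Y x = Kx (X x) (Y x).
Proof.
move=> sY; apply: nabla_endE; first exact: dJ.
exact: (smooth_mx_differentiable oU sY Ux).
Qed.

(** [cyclic_quasi] with the trivial predicate in place of horizontality, since J^2 = -1 on all
    vectors. *)
Lemma almost_Kaehler_quasi : almost_Kaehler N -> quasi_J ah_at.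
Proof.
move=> aK u; pose Psi s t r := inner (G x) (Kx s t) r.
have cl : forall u v w, inner (G x) v (Kx u w) + inner (G x) w (Kx v u)
                + inner (G x) u (Kx w v) = 0.
  apply: (d_fundamental_form_closed acs_smooth acs_skew Ux) => s t r.
  exact: aK in_cod _ _ _ (scst s) (scst t) (scst r) x Ux.
apply: (@ip_ext _ _ (metric_at Ux)) => w; rewrite ipDl ip0l.
apply: (@cyclic_quasi _ _ (js ah_at) (fun=> True) Psi) => //.
- move=> s t r; have := cl s r t; rewrite /Psi.
  rewrite ![inner (G x) (Kx _ _) _](innerC _ _ (metric_sym Ux)).
  by rewrite -addrA [X in _ + X]addrC addrA.
- move=> s t r _ _; rewrite /Psi.
  have -> : Kx s (js ah_at t) = - (Kx s t *m J x) := cov_acs s t.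
  by rewrite innerNl (acs_skew Ux) opprK.
- by move=> s t r; exact: innerNr.
- by move=> s _; exact: js_js.
Qed.

Lemma class_C1_at : class_C1 N -> quasi_J ah_at.
Proof.
case=> [K0|nK|aK|qK].
- move=> u; have E s : KJ ah_at s s = 0.
    by have := K0 b _ in_cod _ _ (scst s) (scst s) x Ux; rewrite nabla_J_at.
  by rewrite !E addr0.
- move=> u; have E s : KJ ah_at s s = 0.
    by have := nK b _ in_cod _ (scst s) x Ux; rewrite nabla_J_at.
  by rewrite !E addr0.
- exact: almost_Kaehler_quasi.
- apply: quasi_J_alt => u; have := qK b _ in_cod _ (scst u) x Ux.
  rewrite nabla_J_at // nabla_J_at //.
  exact: (smooth_vA acs_smooth).
Qed.

End AhAt.

Lemma hess_end_reorder (V : zmodType) (d2 db dl g gl t gb : V) :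
  d2 + db - dl + g - gl =
  db + g - t + (d2 + t - gb) - (dl + gl - gb).
Proof.
rewrite !opprD opprK !addrA.
by rewrite [RHS](ACl (4*1*7*2*8*(3*5)*(6*9))) /= !addNr !addr0.
Qed.

(** * Second fundamental form of a map in charts *)

Section DeriveAlongField.
Variables (R : realType) (d p q : nat) (V : set 'rV[R]_d).
Variables (F : 'rV[R]_d -> 'M[R]_(p, q)) (Y : 'rV[R]_d -> 'rV[R]_d).
Hypotheses (oV : open V) (sF : smooth_mx_on V F) (sY : smooth_mx_on V Y).

Lemma derive_along_field x u : V x ->
  'D_u (fun y => 'D_(Y y) F y) x =
  'D_u (fun y => 'D_(Y x) F y) x + 'D_('D_u Y x) F x.
Proof.
move=> Vx; pose D k y := 'D_(basis_vec R k) F y.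
have dD k : derivable (D k) x u.
  exact: (smooth_mx_derivable oV (smooth_mx_derive_cst oV _ sF) Vx).
have dYk k : derivable (fun y => Y y 0 k) x u.
  exact: (diff_derivable (smooth_on_differentiable oV (sY 0 k) Vx)).
have dYD k : derivable (fun y => Y y 0 k *: D k y) x u.
  have -> : (fun y => Y y 0 k *: D k y) = (fun y => (Y y 0 k)%:M *m D k y).
    by apply/funext => y; rewrite mul_scalar_mx.
  by apply: derivable_mulmx; [exact: derivable_scalar_mx|exact: dD].
have dcD c k : derivable (fun y => c *: D k y) x u by exact: derivableZ.
have dF y : V y -> differentiable F y := fun Vy => smooth_mx_differentiable oV sF Vy.
have E1 : 'D_u (fun y => 'D_(Y y) F y) x =
    \sum_k ('D_u (fun y => Y y 0 k) x *: D k x + Y x 0 k *: 'D_u (D k) x).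
  apply: etrans (derive_eq_on oV u Vx (fun y Vy => derive_coords (Y y) (dF y Vy))) _.
  apply: etrans (derive_bigsum dYD) _; apply: eq_bigr => k _.
  exact: derive_scale.
have E2 : 'D_u (fun y => 'D_(Y x) F y) x = \sum_k Y x 0 k *: 'D_u (D k) x.
  apply: etrans (derive_eq_on oV u Vx (fun y Vy => derive_coords (Y x) (dF y Vy))) _.
  apply: etrans (derive_bigsum (fun k => dcD (Y x 0 k) k)) _.
  by apply: eq_bigr => k _; exact: deriveZ.
rewrite E1 E2 big_split /= addrC; congr (_ + _).
apply: etrans _ (esym (derive_coords _ (dF x Vx))); apply: eq_bigr => k _.
congr (_ *: _); apply: esym; apply: derive_entry.
exact: (smooth_mx_derivable oV sY Vx).
Qed.

End DeriveAlongField.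

Section MapAtPoint.
Variables (R : realType) (d e : nat) (M : riem_manifold R d) (N : riem_manifold R e).
Variables (a : chart M) (b : chart N) (W : set 'rV[R]_d).
Variable F : 'rV[R]_d -> 'rV[R]_e.
Hypotheses (oW : open W) (Wa : W `<=` cod a) (Wb : forall y, W y -> cod b (F y)).
Hypothesis sF : smooth_mx_on W F.
Local Notation G := (metric a).
Local Notation H := (metric b).
Implicit Types u v w : 'rV[R]_d.

(* The second fundamental form of [F] on the constant fields [u] and [v] *)
Definition hess x u v : 'rV[R]_e :=
  'D_u (fun y => 'D_v F y) x + christoffel_form H (F x) ('D_u F x) ('D_v F x)
  - 'D_(christoffel_form G x u v) F x.

Variables (x : 'rV[R]_d) (Wx : W x).

Let dF : differentiable F x := smooth_mx_differentiable oW sF Wx.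
Let Ux : cod a x := Wa Wx.
Let Vx : cod b (F x) := Wb Wx.

Lemma push_linear c u v : 'D_(c *: u + v) F x = c *: 'D_u F x + 'D_v F x.
Proof.
apply: etrans (deriveDv _ _ dF) _; congr (_ + _); exact: deriveZv.
Qed.

Lemma hessC u v : hess x u v = hess x v u.
Proof.
have E1 := smooth_mx_derive_comm oW v u sF Wx.
have E2 := metric_christoffelC Vx ('D_u F x) ('D_v F x).
have E3 := congr1 (fun w => 'D_w F x) (metric_christoffelC Ux u v).
exact: (congr2 (fun s t => s - t) (congr2 +%R E1 E2) E3).
Qed.

Lemma hessPl c u v w : hess x (c *: u + v) w = c *: hess x u w + hess x v w.
Proof.
have dw : differentiable (fun y => 'D_w F y) x.
  exact: (smooth_mx_differentiable oW (smooth_mx_derive_cst oW w sF) Wx).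
have E1 : 'D_(c *: u + v) (fun y => 'D_w F y) x =
    c *: 'D_u (fun y => 'D_w F y) x + 'D_v (fun y => 'D_w F y) x.
  apply: etrans (deriveDv _ _ dw) _; congr (_ + _); exact: deriveZv.
rewrite /hess E1 push_linear !christoffel_formPl push_linear.
rewrite [in RHS]scalerBr [in RHS]scalerDr; exact: addrACA_sub.
Qed.

(** The two parts of the second fundamental form differentiate [Y] in the same way, and these terms
    cancel. *)
Lemma second_fundamental_form_at V X Y : open V -> V `<=` W -> V x ->
  smooth_mx_on V Y ->
  second_fundamental_form G H F X Y x = hess x (X x) (Y x).
Proof.
move=> oV VW Vx' sY.
have sFV : smooth_mx_on V F := smooth_mx_sub VW sF.
rewrite /second_fundamental_form /pull_nabla /push /nabla /hess.
apply: etrans (congr1 (fun z => z + _ - _) (derive_along_field oV sFV sY (X x) Vx')) _.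
apply: etrans (congr1 (fun z => _ - z) (deriveDv _ _ dF)) _.
by rewrite opprD !addrA [LHS](ACl ((2*4)*1*3*5)) /= subrr add0r.
Qed.

(** The intertwining relation differentiated at a constant [v]. General [A] and [B] let it serve for
    contact and for Hermitian targets. *)
Lemma hess_end (A : 'rV[R]_d -> 'M[R]_d) (B : 'rV[R]_e -> 'M[R]_e) eps u v :
  smooth_mx_on (cod a) A -> smooth_mx_on (cod b) B ->
  (forall y, W y -> forall w,
     'D_(w *m A y) F y = eps *: ('D_w F y *m B (F y))) ->
  hess x u (v *m A x) =
  eps *: cov_end H B (F x) ('D_u F x) ('D_v F x)
  + eps *: (hess x u v *m B (F x)) - 'D_(cov_end G A x u v) F x.
Proof.
move=> sA sB AB.
have sAW : smooth_mx_on W A := smooth_mx_sub Wa sA.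
have dA : derivable A x u := smooth_mx_derivable oW sAW Wx.
have sBW : smooth_mx_on W (fun y => B (F y)).
  exact: (smooth_mx_comp oW (@cod_open _ _ _ b) Wb sF sB).
have svA : smooth_mx_on W (fun y => v *m A y).
  exact: (@smooth_mulmx _ _ _ oW _ _ _ (fun=> v) A (smooth_mx_cst oW v) sAW).
have sDv : smooth_mx_on W (fun y => 'D_v F y) := smooth_mx_derive_cst oW v sF.
have E1 := derive_along_field oW sF svA u Wx.
have E2 : 'D_u (fun y => v *m A y) x = v *m 'D_u A x.
  apply: etrans (derive_mulmx (derivable_cst v x u) dA) _.
  by rewrite derive_cst mul0mx add0r.
have dBF : differentiable B (F x).
  exact: (smooth_mx_differentiable (@cod_open _ _ _ b) sB Vx).
have E3 : 'D_u (fun y => 'D_(v *m A y) F y) x =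
    eps *: ('D_u (fun y => 'D_v F y) x *m B (F x)
            + 'D_v F x *m 'D_('D_u F x) B (F x)).
  apply: etrans (derive_eq_on oW u Wx (fun y Wy => AB y Wy v)) _.
  have d1 : derivable (fun y => 'D_v F y) x u := smooth_mx_derivable oW sDv Wx.
  have d2 : derivable (fun y => B (F y)) x u := smooth_mx_derivable oW sBW Wx.
  apply: etrans (deriveZ eps (derivable_mulmx d1 d2)) _; congr (_ *: _).
  apply: etrans (derive_mulmx d1 d2) _; congr (_ + _ *m _).
  exact: derive_compose.
rewrite E2 E3 in E1.
have {}E1 : 'D_u (fun y => 'D_(v *m A x) F y) x =
    eps *: ('D_u (fun y => 'D_v F y) x *m B (F x)
            + 'D_v F x *m 'D_('D_u F x) B (F x)) - 'D_(v *m 'D_u A x) F x.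
  by rewrite E1 addrK.
rewrite {1}/hess E1 (AB x Wx v) christoffel_formZr.
have lD := affineD push_linear; have lN := affineN push_linear.
have -> : 'D_(cov_end G A x u v) F x = 'D_(v *m 'D_u A x) F x +
    'D_(christoffel_form G x u (v *m A x)) F x
    - eps *: ('D_(christoffel_form G x u v) F x *m B (F x)).
  rewrite -(AB x Wx) -[- 'D_(_ *m A x) F x]lN -!lD //.
rewrite /hess /cov_end !mulmxBl !mulmxDl !scalerDr !scalerN.
exact: hess_end_reorder.
Qed.

End MapAtPoint.

(** * Holomorphic maps between almost contact manifolds and their Reeb factor *)

Section AcmMap.
Variables (R : realType) (m n : nat) (M : acm_manifold R m) (N : acm_manifold R n).
Variables (a : chart M) (b : chart N) (W : set 'rV[R]_m.*2.+1).
Variable F : 'rV[R]_m.*2.+1 -> 'rV[R]_n.*2.+1.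
Hypotheses (oW : open W) (Wa : W `<=` cod a) (Wb : forall y, W y -> cod b (F y)).
Hypothesis sF : smooth_mx_on W F.
Local Notation G := (metric a).
Local Notation H := (metric b).
Implicit Types u v w : 'rV[R]_m.*2.+1.
Variable eps : R.
Hypothesis eps2 : eps * eps = 1.
Hypothesis hol : forall y, W y -> forall u,
  'D_(u *m phi a y) F y = eps *: ('D_u F y *m phi b (F y)).

(* The function lambda with sigma o F_* = lambda eta *)
Definition reeb_factor y : R :=
  inner (H (F y)) ('D_(xi a y) F y) (xi b (F y)).

Lemma reeb_factor_smooth : smooth_on W reeb_factor.
Proof.
have sHF : smooth_mx_on W (fun y => H (F y)).
  exact: (smooth_mx_comp oW (@cod_open _ _ _ b) Wb sF (@metric_smooth _ _ N b)).
have sxF : smooth_mx_on W (fun y => xi b (F y)).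
  exact: (smooth_mx_comp oW (@cod_open _ _ _ b) Wb sF (@xi_smooth _ _ N b)).
have sxi : smooth_mx_on W (xi a) := smooth_mx_sub Wa (@xi_smooth _ _ M a).
exact: (inner_smooth oW sHF (smooth_mx_derive oW sxi sF) sxF).
Qed.

(** Write u = - phi^2 u + eta(u) xi. By holomorphy the first part is mapped into the image of the
    target phi, which is orthogonal to the target Reeb field. *)
Lemma push_eta y u : W y ->
  inner (H (F y)) ('D_u F y) (xi b (F y)) = reeb_factor y * inner (G y) u (xi a y).
Proof.
move=> Wy; have Uy := Wa Wy; have Vy := Wb Wy.
have lP := push_linear oW sF Wy.
have E : u = - (u *m phi a y *m phi a y) + inner (G y) u (xi a y) *: xi a y.
  by rewrite (phi_sq Uy) (eta_inner _ Uy) opprD opprK addrNK.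
rewrite [in LHS]E (affineD lP) (affineN lP) (affineZ lP) !hol // innerDl innerNl.
rewrite !innerZl -[inner _ (_ *m phi b _) _](eta_inner _ Vy) eta_phi //.
by rewrite mulr0 oppr0 add0r mulrC.
Qed.

Section AtPoint.
Variables (x : 'rV[R]_m.*2.+1) (Wx : W x).
Let p := acm_at (Wa Wx).
Let q := acm_at (Wb Wx).
Let L u := 'D_u F x.
Let B := hess a b F x.

Lemma push_eta_at u : ip q (L u) (rb q) = reeb_factor x * ip p u (rb p).
Proof. exact: push_eta. Qed.

(** The derivative of [push_eta] at a constant [v]; the source Christoffel terms on the two sides
    agree by [push_eta] at the vector Gamma(u, v). *)
Lemma hess_rb_at u v : ip q (B u v) (rb q) + ip q (nrb q (L u)) (L v) =
  'D_u reeb_factor x * ip p v (rb p) + reeb_factor x * ip p (nrb p u) v.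
Proof.
have Ux := Wa Wx; have Vx := Wb Wx.
have oV : open (cod b) := @cod_open _ _ _ b.
have sDv : smooth_mx_on W (fun y => 'D_v F y) := smooth_mx_derive_cst oW v sF.
have d1 : derivable (fun y => 'D_v F y) x u := smooth_mx_derivable oW sDv Wx.
have dF : differentiable F x := smooth_mx_differentiable oW sF Wx.
have dH : differentiable H (F x) := smooth_mx_differentiable oV (@metric_smooth _ _ N b) Vx.
have dxb : differentiable (xi b) (F x) :=
  smooth_mx_differentiable oV (@xi_smooth _ _ N b) Vx.
have dHF : derivable (fun y => H (F y)) x u.
  exact: (smooth_mx_derivable oW
    (smooth_mx_comp oW oV Wb sF (@metric_smooth _ _ N b)) Wx).
have dxF : derivable (fun y => xi b (F y)) x u.
  exact: (smooth_mx_derivable oW (smooth_mx_comp oW oV Wb sF (@xi_smooth _ _ N b)) Wx).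
have E1 : 'D_u (fun y => inner (H (F y)) ('D_v F y) (xi b (F y))) x =
    ip q (B u v) (rb q) + inner (H (F x)) (L (christoffel_form G x u v)) (rb q)
    + ip q (nrb q (L u)) (L v).
  apply: etrans (derive_inner dHF d1 dxF) _.
  rewrite (derive_compose u dF dH) (derive_compose u dF dxb).
  rewrite (metric_compatible Vx) [ip q (nrb q _) _]ipC.
  rewrite -[X in _ = X + _]innerDl /B /hess subrK innerDl.
  rewrite [ip q _ (nrb q _)]innerDr.
  have sum (r s t w : R) : r + s + t + w = t + r + (w + s) by ring.
  exact: sum.
have E2 : 'D_u (fun y => reeb_factor y * inner (G y) v (xi a y)) x =
    'D_u reeb_factor x * ip p v (rb p) + reeb_factor x *
     (inner (G x) (christoffel_form G x u v) (xi a x) + ip p (nrb p u) v).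
  have dr : derivable reeb_factor x u.
    exact: (diff_derivable (smooth_on_differentiable oW reeb_factor_smooth Wx)).
  have de : derivable (fun y => inner (G y) v (xi a y)) x u.
    have se := inner_smooth (@cod_open _ _ _ a) (@metric_smooth _ _ M a)
      (smooth_mx_cst (@cod_open _ _ _ a) v) (@xi_smooth _ _ M a).
    exact: (diff_derivable (smooth_on_differentiable (@cod_open _ _ _ a) se Ux)).
  apply: etrans (deriveM dr de) _; rewrite addrC; congr (_ + _).
    exact: mulrC.
  congr (_ * _); apply: etrans (derive_eta Ux u v) _.
  by congr (_ + _); exact: innerC (metric_sym Ux).
have E := derive_eq_on oW u Wx (fun y Wy => push_eta v Wy).
have {E1 E2}E := etrans (esym E1) (etrans E E2).
have E3 := push_eta_at (christoffel_form G x u v).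
have sum (t1 t2 t3 s1 s2 s3 r : R) : t1 + t2 + t3 = s1 + r * (s2 + s3) ->
  t2 = r * s2 -> t1 + t3 = s1 + r * s3.
  move=> E0 E1; apply: (addIr t2); rewrite addrAC E0 E1; ring.
exact: sum E E3.
Qed.

Lemma push_phi_at u : L (ph p u) = eps *: ph q (L u).
Proof. exact: hol. Qed.

Lemma hess_phi_at u v : B u (ph p v) =
  eps *: nph q (L u) (L v) + eps *: ph q (B u v) - L (nph p u v).
Proof.
exact: (hess_end oW Wa Wb sF Wx u v (@phi_smooth _ _ M a) (@phi_smooth _ _ N b) hol).
Qed.

Let LP := push_linear oW sF Wx.
Let BPl := hessPl a b oW sF Wx.
Let BC := hessC oW Wa Wb sF Wx.

Lemma reeb_factor_horizontal u : geodesic p -> geodesic q ->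
  horizontal p u -> 'D_u reeb_factor x = 0.
Proof.
move=> gp gq hu.
exact: (dlam_horizontal LP BC eps2 push_phi_at push_eta_at hess_rb_at gp gq hu).
Qed.

Lemma hess_reeb_at : geodesic p -> geodesic q ->
  B (rb p) (rb p) = 'D_(rb p) reeb_factor x *: rb q.
Proof.
exact: (hess_rb LP BPl BC eps2 push_phi_at hess_phi_at push_eta_at hess_rb_at).
Qed.

Lemma hess_horizontal_sum_at (I : finType) (e : I -> 'rV[R]_m.*2.+1) :
  quasi q -> trace_free q -> (forall i, horizontal p (e i)) ->
  ph p (\sum_i Pph p (e i) (e i)) = 0 ->
  \sum_i (ip p (nrb p (e i)) (e i)
           + ip p (nrb p (ph p (e i))) (ph p (e i))) = 0 ->
  \sum_i (B (e i) (e i) + B (ph p (e i)) (ph p (e i))) = 0.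
Proof.
exact: (hess_horizontal_sum LP BPl BC eps2 push_phi_at hess_phi_at push_eta_at hess_rb_at).
Qed.

End AtPoint.

(* d lambda = rho eta; for horizontal [u], [v] the antisymmetric part of the
   second derivative of lambda is rho d eta (u, v), so rho vanishes. *)
Lemma reeb_factor_constant x (Wx : W x) :
  (forall y (Uy : cod a y), geodesic (acm_at Uy)) ->
  (forall y (Vy : cod b y), geodesic (acm_at Vy)) ->
  twisted (acm_at (Wa Wx)) -> forall u, 'D_u reeb_factor x = 0.
Proof.
move=> gM gN [u [v [hu hv uv]]].
pose rho y := 'D_(xi a y) reeb_factor y.
have dr y : W y -> differentiable reeb_factor y.
  by move=> Wy; exact: (smooth_on_differentiable oW reeb_factor_smooth Wy).
(* [w - c *: xi a y] is horizontal, so [reeb_factor] varies along xi only. *)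
have E y w : W y -> 'D_w reeb_factor y = rho y * inner (G y) w (xi a y).
  move=> Wy; set c := inner _ _ _.
  have hw : horizontal (acm_at (Wa Wy)) (w - c *: xi a y).
    rewrite /horizontal ipDl ipNl ipZl.
    by rewrite [ip _ _ (rb _) in X in _ - X](ip_rb (acm_at (Wa Wy))) mulr1 subrr.
  have := reeb_factor_horizontal (gM _ _) (gN _ _) hw.
  have -> : 'D_(w - c *: xi a y) reeb_factor y =
      'D_w reeb_factor y - c * rho y.
    apply: etrans (deriveDv _ _ (dr y Wy)) _; congr (_ + _).
    apply: etrans (deriveNv _ (dr y Wy)) _; congr (- _).
    exact: (deriveZv c (xi a y) (dr y Wy)).
  by move=> /eqP; rewrite subr_eq0 mulrC => /eqP.
have srho : smooth_on W rho.
  have sxi : smooth_mx_on W (xi a) := smooth_mx_sub Wa (@xi_smooth _ _ M a).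
  have sr := (smooth_on_mx11 oW reeb_factor).1 reeb_factor_smooth.
  have sD := smooth_mx_derive oW sxi sr 0 0.
  apply: (smooth_on_eq oW _ sD) => y Wy.
  apply: etrans (derive_entry 0 0 (smooth_mx_derivable oW sr Wy)) _.
  congr ('D_(xi a y) _ y); apply/funext => z; by rewrite mxE eqxx.
(* As eta(t) = 0 at [x], the derivative of [rho] drops out; the Christoffel part is symmetric in [s]
   and [t] and disappears in the comparison below. *)
have DE s t : horizontal (acm_at (Wa Wx)) t ->
    'D_s ('D_t reeb_factor) x =
    rho x * (inner (G x) (christoffel_form G x s t) (xi a x)
             + ip (acm_at (Wa Wx)) (nrb (acm_at (Wa Wx)) s) t).
  move=> ht; have Ux := Wa Wx.
  have drho : derivable rho x s.
    exact: (diff_derivable (smooth_on_differentiable oW srho Wx)).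
  have de : derivable (fun y => inner (G y) t (xi a y)) x s.
    have se := inner_smooth (@cod_open _ _ _ a) (@metric_smooth _ _ M a)
      (smooth_mx_cst (@cod_open _ _ _ a) t) (@xi_smooth _ _ M a).
    exact: (diff_derivable (smooth_on_differentiable (@cod_open _ _ _ a) se Ux)).
  apply: etrans (derive_eq_on oW s Wx (fun y Wy => E y t Wy)) _.
  have ht0 : inner (G x) t (xi a x) = 0 := ht.
  apply: etrans (deriveM drho de) _; rewrite ht0 scale0r addr0; congr (_ * _).
  apply: etrans (derive_eta Ux s t) _.
  by congr (_ + _); exact: innerC (metric_sym Ux).
have C := smooth_derive_comm oW u v reeb_factor_smooth Wx.
have E1 := DE v u hu; have E2 := DE u v hv.
rewrite (metric_christoffelC (Wa Wx) v u) in E1.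
have rho0 : rho x = 0.
  have sum (r d s t : R) : r * (d + s) = r * (d + t) -> t - s != 0 -> r = 0.
    move=> rst ts; apply: (mulIf ts); rewrite mul0r.
    by move: rst; rewrite mulrBr !mulrDr => /addrI ->; rewrite subrr.
  exact: (sum _ _ _ _ (etrans (esym E1) (etrans C E2)) uv).
by move=> w; apply: etrans (E x w Wx) _; rewrite rho0 mul0r.
Qed.

End AcmMap.

Lemma sum_double (V : nmodType) (F : nat -> V) k :
  \sum_(0 <= j < k.*2) F j = \sum_(i < k) (F i.*2 + F i.*2.+1).
Proof.
elim: k => [|k IH]; first by rewrite big_geq // big_ord0.
by rewrite doubleS !big_nat_recr //= IH big_ord_recr /= -addrA.
Qed.

(** * Metric traces *)

Section MetricTrace.
Variables (R : realType) (d : nat) (W : lmodType R).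
Variables (B : 'rV[R]_d -> 'rV[R]_d -> W).
Hypothesis BPl : forall c u v w, B (c *: u + v) w = c *: B u w + B v w.
Hypothesis BPr : forall w c u v, B w (c *: u + v) = c *: B w u + B w v.

Definition metric_trace (G : 'M[R]_d) : W :=
  \sum_i \sum_j invmx G i j *: B (basis_vec R i) (basis_vec R j).

Lemma bilinear_coords u v :
  B u v = \sum_i \sum_j (u 0 i * v 0 j) *: B (basis_vec R i) (basis_vec R j).
Proof.
rewrite {1}[u]row_sum_delta (affine_sum _ (fun c s t => BPl c s t v)).
apply: eq_bigr => i _; rewrite (affineZ (fun c s t => BPl c s t v)).
rewrite {1}[v]row_sum_delta (affine_sum _ (BPr _)) scaler_sumr.
by apply: eq_bigr => j _; rewrite (affineZ (BPr _)) scalerA.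
Qed.

(** The square matrix [E] of an orthonormal family satisfies E G E^T = 1, and a one-sided inverse is
    two-sided, so the inverse metric is E^T E. *)
Lemma metric_trace_orthonormal (G : 'M[R]_d) (e : 'I_d -> 'rV[R]_d) :
  (forall k l, inner G (e k) (e l) = (k == l)%:R) ->
  metric_trace G = \sum_k B (e k) (e k).
Proof.
move=> one; pose E : 'M[R]_d := \matrix_(k, i) e k 0 i.
have rE k : row k E = e k by apply/rowP => i; rewrite !mxE.
have EGE : E *m G *m E^T = 1%:M.
  apply/matrixP => k l; rewrite [RHS]mxE -one inner_mulmx -!rE.
  by rewrite -row_mul !mxE; apply: eq_bigr => i _; rewrite !mxE.
have EE : E^T *m E *m G = 1%:M by rewrite -mulmxA; exact: mulmx1C.
have GE : invmx G = E^T *m E.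
  have uG : G \in unitmx by have /mulmx1_unit[] := EE.
  by rewrite -[RHS](mulmxK uG) EE mul1mx.
rewrite /metric_trace (eq_bigr _ (fun k _ => bilinear_coords (e k) (e k))).
rewrite [RHS]exchange_big; apply: eq_bigr => i _ /=.
rewrite [RHS]exchange_big; apply: eq_bigr => j _ /=.
by rewrite GE mxE scaler_suml; apply: eq_bigr => k _; rewrite !mxE.
Qed.

End MetricTrace.

(** * Smooth local phi-frames *)

Section Frames.
Variables (R : realType) (m : nat) (M : acm_manifold R m) (a : chart M).
Notation D := m.*2.+1.
Local Notation G := (metric a).
Local Notation U := (cod a).
Notation field := ('rV[R]_D -> 'rV[R]_D).

Let oU : open U := @cod_open _ _ _ a.

(** A partial phi-frame; the remaining relations for phi(e i) follow from metric compatibility.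
    Indexing by [nat] keeps the type fixed while [k] grows. *)
Definition orthonormal_at k (e : nat -> 'rV[R]_D) y :=
  forall i, (i < k)%N -> inner (G y) (e i) (xi a y) = 0 /\
    forall j, (j < k)%N -> inner (G y) (e i) (e j) = (i == j)%:R /\
                           inner (G y) (e i) (e j *m phi a y) = 0.

(** The order is e 0, phi(e 0), e 1, phi(e 1), and so on, with xi at the last index [m.*2]. *)
Definition frame_vec (e : nat -> 'rV[R]_D) y (j : nat) : 'rV[R]_D :=
  if j == m.*2 then xi a y
  else if odd j then e j./2 *m phi a y else e j./2.

Lemma frame_vec_orthonormal e y : U y -> orthonormal_at m e y ->
  forall k l : 'I_D, inner (G y) (frame_vec e y k) (frame_vec e y l) = (k == l)%:R.
Proof.
move=> Uy one k l.
have GC u v : inner (G y) u v = inner (G y) v u := innerC u v (metric_sym Uy).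
have x1 : inner (G y) (xi a y) (xi a y) = 1 by rewrite -(eta_inner _ Uy) (eta_xi Uy).
have phx u : inner (G y) (u *m phi a y) (xi a y) = 0.
  by rewrite -(eta_inner _ Uy) eta_phi.
have half (j : 'I_D) : nat_of_ord j != m.*2 -> (j./2 < m)%N.
  move=> jm; rewrite ltn_half_double; have := ltn_ord j.
  by rewrite ltnS leq_eqVlt (negPf jm).
have hx (j : 'I_D) : nat_of_ord j != m.*2 -> inner (G y) (frame_vec e y j) (xi a y) = 0.
  move=> jm; rewrite /frame_vec (negPf jm); case: ifP => _; first exact: phx.
  by have [] := one _ (half j jm).
have [km|km] := eqVneq (nat_of_ord k) m.*2; have [lm|lm] := eqVneq (nat_of_ord l) m.*2.
- by rewrite -val_eqE /= km lm eqxx /frame_vec !eqxx.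
- rewrite GC -val_eqE /= km [m.*2 == _]eq_sym (negPf lm) {2}/frame_vec eqxx.
  exact: hx.
- rewrite -val_eqE /= lm (negPf km) {2}/frame_vec eqxx; exact: hx.
- rewrite -val_eqE /= /frame_vec (negPf km) (negPf lm).
  have [zk /(_ _ (half l lm))[okl pkl]] := one _ (half k km).
  have [zl /(_ _ (half k km))[olk plk]] := one _ (half l lm).
  have -> : (nat_of_ord k == l) = (odd k == odd l) && (k./2 == l./2).
    apply/eqP/andP => [->//|[/eqP ok /eqP hk]].
    by rewrite -[LHS]odd_double_half -[RHS]odd_double_half ok hk.
  case: (odd k); case: (odd l) => //=.
  + by rewrite (metric_phi Uy) !(eta_inner _ Uy) zk mul0r subr0.
  + by rewrite GC plk.
Qed.

Lemma metric_trace_frame (W : lmodType R) (B : 'rV[R]_D -> 'rV[R]_D -> W) e y :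
  (forall c u v w, B (c *: u + v) w = c *: B u w + B v w) ->
  (forall w c u v, B w (c *: u + v) = c *: B w u + B w v) ->
  U y -> orthonormal_at m e y ->
  metric_trace B (G y) =
  \sum_(i < m) (B (e i) (e i) + B (e i *m phi a y) (e i *m phi a y))
  + B (xi a y) (xi a y).
Proof.
move=> BPl BPr Uy one.
rewrite (metric_trace_orthonormal BPl BPr (frame_vec_orthonormal Uy one)).
rewrite -(big_mkord xpredT (fun j => B (frame_vec e y j) (frame_vec e y j))).
have fx : frame_vec e y m.*2 = xi a y by rewrite /frame_vec eqxx.
rewrite big_nat_recr //= !fx sum_double; congr (_ + _).
apply: eq_bigr => i _; rewrite /frame_vec.
rewrite [i.*2 == _]ltn_eqF ?ltn_double ?ltn_ord //.
rewrite [i.*2.+1 == _]ltn_eqF ?ltn_Sdouble ?ltn_ord //.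
by rewrite oddS odd_double /= doubleK uphalf_double.
Qed.

(** A dimension count: there are 2k + 1 linear conditions on a space of dimension 2m + 1, and k <
    m. *)
Lemma orthogonal_vector k x (e : nat -> 'rV[R]_D) : (k < m)%N ->
  exists2 u, u != 0 & inner (G x) u (xi a x) = 0 /\ forall j, (j < k)%N ->
    inner (G x) u (e j) = 0 /\ inner (G x) u (e j *m phi a x) = 0.
Proof.
move=> km; pose vec (j : nat) := if (j < k)%N then e j
  else if (j < k + k)%N then e (j - k)%N *m phi a x else xi a x.
pose A : 'M[R]_(D, (k + k).+1) := \matrix_(i, j) (G x *m (vec j)^T) i 0.
have : kermx A != 0.
  rewrite kermx_eq0 /row_free neq_ltn; apply/orP; left.
  by apply: leq_ltn_trans (rank_leq_col A) _; rewrite addnn ltnS ltn_double.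
case/rowV0Pn => u /sub_kermxP uA u0; exists u => //.
have vec0 (j : nat) : (j < (k + k).+1)%N -> inner (G x) u (vec j) = 0.
  move=> jk; have <- : (u *m A) 0 (Ordinal jk) = 0 by rewrite uA mxE.
  by rewrite inner_mulmx -mulmxA !mxE; apply: eq_bigr => i _; rewrite !mxE.
split=> [|j jk].
  have := vec0 (k + k)%N (ltnSn _).
  by rewrite /vec ltnn ltnNge leq_addr.
have <- : vec (k + j)%N = e j *m phi a x.
  by rewrite /vec ltnNge leq_addr /= ltn_add2l jk addKn.
have <- : vec j = e j by rewrite /vec jk.
by split; apply: vec0; rewrite ltnS ?leq_add2l ltnW // ltn_addr.
Qed.

Lemma orthonormal_project k y (e : nat -> 'rV[R]_D) u : U y ->
  orthonormal_at k e y ->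
  let w := u - \sum_(i < k) (inner (G y) u (e i) *: e i
     + inner (G y) u (e i *m phi a y) *: (e i *m phi a y))
     - inner (G y) u (xi a y) *: xi a y in
  inner (G y) w (xi a y) = 0 /\ forall j, (j < k)%N ->
    inner (G y) w (e j) = 0 /\ inner (G y) w (e j *m phi a y) = 0.
Proof.
move=> Uy one w; pose p := acm_at Uy.
have wE t : inner (G y) w t = inner (G y) u t
    - \sum_(i < k) (inner (G y) u (e i) * inner (G y) (e i) t
     + inner (G y) u (e i *m phi a y) * inner (G y) (e i *m phi a y) t)
    - inner (G y) u (xi a y) * inner (G y) (xi a y) t.
  rewrite /w !innerDl !innerNl innerZl; congr (_ - _ - _).
  apply: etrans (ip_suml p _ t) _; apply: eq_bigr => i _.
  by apply: etrans (innerDl _ _ _ _) _; rewrite !innerZl.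
have phx t : inner (G y) (t *m phi a y) (xi a y) = 0 by exact: (ip_ph_rb p).
have xph t : inner (G y) (xi a y) (t *m phi a y) = 0.
  by rewrite (innerC _ _ (metric_sym Uy)).
have x1 : inner (G y) (xi a y) (xi a y) = 1 by exact: (ip_rb p).
split=> [|j jk].
  rewrite wE x1 mulr1 big1 ?subr0 ?subrr // => i _.
  by have [-> _] := one i (ltn_ord i); rewrite phx !mulr0 addr0.
have [zj _] := one j jk.
have xj : inner (G y) (xi a y) (e j) = 0 by rewrite (innerC _ _ (metric_sym Uy)).
split; rewrite wE (bigD1 (Ordinal jk)) //= big1 => [|i ij].
- have [_ /(_ j jk)[-> _]] := one j jk.
  have -> : inner (G y) (e j *m phi a y) (e j) = 0.
    by rewrite (innerC _ _ (metric_sym Uy)); have [_ /(_ j jk)[]] := one j jk.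
  by rewrite xj eqxx !mulr0 mulr1 !addr0 subrr subr0.
- have [_ /(_ j jk)[-> _]] := one i (ltn_ord i).
  have -> : inner (G y) (e i *m phi a y) (e j) = 0.
    rewrite (innerC _ _ (metric_sym Uy)).
    by have [_ /(_ i (ltn_ord i))[]] := one j jk.
  by rewrite -val_eqE /= in ij; rewrite (negPf ij) !mulr0 addr0.
- have [_ /(_ j jk)[jj1 ->]] := one j jk.
  rewrite (metric_phi Uy) !(eta_inner _ Uy) zj !mulr0 subr0 jj1 eqxx mulr1.
  by rewrite add0r addr0 subrr xph mulr0 subr0.
- have [_ /(_ j jk)[ij1 ->]] := one i (ltn_ord i).
  rewrite (metric_phi Uy) !(eta_inner _ Uy) zj !mulr0 subr0 ij1 add0r.
  by rewrite -val_eqE /= in ij; rewrite (negPf ij) mulr0.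
Qed.

(** One Gram-Schmidt step: a constant [u], orthogonal to the partial frame at [x], is projected off
    the frame and normalized. The image of the new vector under phi fits automatically, phi being
    skew and the projection phi-invariant. *)
Lemma extend_orthonormal k V (E : nat -> field) x :
  (k < m)%N -> in_chart a V -> V x ->
  (forall i, (i < k)%N -> smooth_mx_on V (E i)) ->
  (forall y, V y -> orthonormal_at k (E ^~ y) y) ->
  exists V' E', [/\ in_chart a V', V' x,
    forall i, (i < k.+1)%N -> smooth_mx_on V' (E' i)
    & forall y, V' y -> orthonormal_at k.+1 (E' ^~ y) y].
Proof.
move=> km [oV VU] Vx sE oE.
have [u u0 [ux uE]] := @orthogonal_vector k x (E ^~ x) km.
pose v y := u - \sum_(i < k) (inner (G y) u (E i y) *: E i y
     + inner (G y) u (E i y *m phi a y) *: (E i y *m phi a y))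
     - inner (G y) u (xi a y) *: xi a y.
have sG : smooth_mx_on V G := smooth_mx_sub VU (@metric_smooth _ _ M a).
have sphi : smooth_mx_on V (phi a) := smooth_mx_sub VU (@phi_smooth _ _ M a).
have sxi : smooth_mx_on V (xi a) := smooth_mx_sub VU (@xi_smooth _ _ M a).
have su : smooth_mx_on V (fun=> u) := smooth_mx_cst oV u.
have sv : smooth_mx_on V v.
  have sT (i : 'I_k) : smooth_mx_on V (fun y => inner (G y) u (E i y) *: E i y
      + inner (G y) u (E i y *m phi a y) *: (E i y *m phi a y)).
    have sEi := sE i (ltn_ord i).
    have sEp : smooth_mx_on V (fun y => E i y *m phi a y).
      exact: (@smooth_mulmx _ _ _ oV _ _ _ (E i) (phi a) sEi sphi).
    exact: (smooth_mxD oV (smooth_mxZ oV (inner_smooth oV sG su sEi) sEi)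
                          (smooth_mxZ oV (inner_smooth oV sG su sEp) sEp)).
  have sC := smooth_mxZ oV (inner_smooth oV sG su sxi) sxi.
  exact: (smooth_mxD oV (smooth_mxD oV su (smooth_mxN oV (smooth_mx_sum oV sT)))
                        (smooth_mxN oV sC)).
pose q y := inner (G y) (v y) (v y).
have sq : smooth_on V q := inner_smooth oV sG sv sv.
(* All projection coefficients vanish at [x] by the choice of [u], so [v] is nonzero there and, by
   continuity, nearby. *)
have vx : v x = u.
  rewrite /v ux scale0r subr0 big1 ?subr0 // => i _.
  by have [-> ->] := uE i (ltn_ord i); rewrite !scale0r addr0.
have qx : 0 < q x by rewrite /q vx; exact: metric_pos (VU _ Vx) _ u0.
pose V' := [set y | V y /\ 0 < q y].
have V'V : V' `<=` V by move=> y [].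
have oV' : open V'.
  rewrite openE => y [Vy qy].
  have cq : {for y, continuous q}.
    by apply/differentiable_continuous/(smooth_on_differentiable oV sq Vy).
  have nq : \forall z \near y, 0 < q z by exact: cvgr_gt cq _ qy.
  by apply: filterS2 (near_in oV Vy) nq => z Vz qz; split.
pose nv y := (Num.sqrt (q y))^-1 *: v y.
have q0 y : V' y -> Num.sqrt (q y) != 0 by case=> _ qy; rewrite gt_eqF // sqrtr_gt0.
have snv : smooth_mx_on V' nv.
  have sv' := smooth_mx_sub V'V sv.
  have sq' : smooth_on V' q by move=> s y V'y; apply: sq; exact: V'V.
  have qpos y : V' y -> 0 < q y by case.
  exact: (smooth_mxZ oV' (smooth_onV oV' q0 (smooth_on_sqrt oV' qpos sq')) sv').
exists V', (fun i => if i == k then nv else E i); split=> //.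
- by split=> // y /V'V/VU.
- move=> i; rewrite ltnS leq_eqVlt; case: eqP => [_ _|_ /= ik]; first exact: snv.
  exact: smooth_mx_sub V'V (sE i ik).
- move=> y V'y; have Vy := V'V y V'y; have Uy := VU y Vy.
  have [vxi vE] := orthonormal_project u Uy (oE y Vy).
  have GC s t : inner (G y) s t = inner (G y) t s := innerC s t (metric_sym Uy).
  have vskew s t := inner_phi_skew s t Uy.
  move=> i ik; have [ei|ni] := eqVneq i k.
    rewrite /nv innerZl vxi mulr0; split=> // j jk; have [ej|nj] := eqVneq j k.
      rewrite ei ej eqxx -scalemxAl !innerZl !innerZr mulrA; split.
        rewrite -expr2 exprVn sqr_sqrtr; last by case: V'y => _ /ltW.
        by rewrite mulVf // gt_eqF //; case: V'y.
      have := vskew (v y) (v y); rewrite GC => /eqP.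
      by rewrite -addr_eq0 -mulr2n mulrn_eq0 => /eqP ->; rewrite !mulr0.
    have {}jk : (j < k)%N by move: jk; rewrite ltnS leq_eqVlt (negPf nj).
    have [h1 h2] := vE j jk.
    by rewrite !innerZl h1 h2 ei eq_sym (negPf nj) mulr0.
  have {}ik : (i < k)%N by move: ik; rewrite ltnS leq_eqVlt (negPf ni).
  have [eix eiE] := oE y Vy i ik; split=> // j jk; have [ej|nj] := eqVneq j k.
    have [h1 h2] := vE i ik.
    rewrite ej (negPf ni) /nv -scalemxAl !innerZr [inner _ _ (v y)]GC h1 mulr0.
    by split=> //; rewrite -[inner _ _ _]opprK -vskew GC h2 oppr0 mulr0.
  by apply: eiE; move: jk; rewrite ltnS leq_eqVlt (negPf nj).
Qed.

Lemma smooth_frame x : U x -> exists V E, [/\ in_chart a V, V x,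
    forall i, (i < m)%N -> smooth_mx_on V (E i)
    & forall y, V y -> orthonormal_at m (E ^~ y) y].
Proof.
move=> Ux; suff H k : (k <= m)%N -> exists V (E : nat -> field),
    [/\ in_chart a V, V x, forall i, (i < k)%N -> smooth_mx_on V (E i)
    & forall y, V y -> orthonormal_at k (E ^~ y) y] by exact: H.
elim: k => [_|k IH km].
  by exists U, (fun _ _ => 0); split=> //; exact: in_chart_cod.
have [V [E [cV Vx sE oE]]] := IH (ltnW km).
exact: extend_orthonormal km cV Vx sE oE.
Qed.

Lemma orthonormal_horizontal x (Ux : U x) e : orthonormal_at m e x ->
  forall i, (i < m)%N -> e i != 0 /\ horizontal (acm_at Ux) (e i).
Proof.
move=> one i im; have [h /(_ i im)[ee _]] := one i im; split=> //.
apply/eqP => e0; move: ee; rewrite e0 inner0l eqxx => /esym/eqP.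
by rewrite oner_eq0.
Qed.

End Frames.

Lemma antisym_sum (R : realFieldType) d (f : 'I_d -> 'I_d -> R) :
  (forall i j, f i j = - f j i) -> \sum_i \sum_j f i j = 0.
Proof.
move=> fN; have E : \sum_i \sum_j f i j = - \sum_i \sum_j f i j.
  rewrite {1}exchange_big -sumrN; apply: eq_bigr => i _; rewrite -sumrN.
  by apply: eq_bigr => j _.
lra.
Qed.

Lemma addr_insert (V : zmodType) (a b c e : V) :
  b + c - e = - a + b + (a - e) + c.
Proof. by rewrite !addrA [RHS](ACl ((1*3)*2*5*4)) /= addNr add0r. Qed.

(** * Inverse metric and logarithmic derivative of the volume density *)

Section InverseMetric.
Variables (R : realType) (d : nat) (M : riem_manifold R d) (a : chart M).
Local Notation G := (metric a).
Local Notation U := (cod a).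
Implicit Types u v w : 'rV[R]_d.

Let oU : open U := @cod_open _ _ _ a.
Let sG : smooth_mx_on U G := @metric_smooth _ _ M a.

Lemma metric_unit y : U y -> G y \in unitmx.
Proof. by move=> Uy; exact/posdef_unitmx/(metric_pos Uy). Qed.

Lemma invmx_metric_smooth : smooth_mx_on U (fun y => invmx (G y)).
Proof. exact: (smooth_invmx oU metric_unit sG). Qed.

Lemma invmx_metric_sym y : U y -> (invmx (G y))^T = invmx (G y).
Proof. by move=> Uy; rewrite trmx_inv metric_sym. Qed.

Lemma invmx_metric_symE y i j : U y -> invmx (G y) i j = invmx (G y) j i.
Proof. by move=> Uy; rewrite -[in LHS](invmx_metric_sym Uy) mxE. Qed.

(* [w] applied to log (sqrt (det G)), written without the determinant *)
Definition log_density_form w y : R := 2^-1 * \tr (invmx (G y) *m 'D_w G y).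

Lemma derive_invmx_metric y v : U y ->
  'D_v (fun z => invmx (G z)) y = - (invmx (G y) *m 'D_v G y *m invmx (G y)).
Proof.
move=> Uy; have dG : derivable G y v := smooth_mx_derivable oU sG Uy.
have dI : derivable (fun z => invmx (G z)) y v.
  exact: (smooth_mx_derivable oU invmx_metric_smooth Uy).
have E : 'D_v (fun z => invmx (G z) *m G z) y = 0.
  apply: etrans (_ : 'D_v (fun=> 1%:M) y = 0); last exact: derive_cst.
  by apply: (derive_eq_on oU v Uy) => z Uz; exact/mulVmx/metric_unit.
have {}E := etrans (esym (derive_mulmx dI dG)) E.
move/(congr1 (mulmx^~ (invmx (G y)))) : E.
rewrite mulmxDl (mulmxK (metric_unit Uy)) mul0mx => /eqP.
by rewrite addr_eq0 => /eqP.
Qed.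

Lemma smooth_trace n (A : 'rV[R]_d -> 'M[R]_n) :
  smooth_mx_on U A -> smooth_on U (fun y => \tr (A y)).
Proof. by move=> sA; exact: (smooth_on_sum oU (fun i => sA i i)). Qed.

Lemma derive_trace n (A : 'rV[R]_d -> 'M[R]_n) y v :
  smooth_mx_on U A -> U y -> 'D_v (fun z => \tr (A z)) y = \tr ('D_v A y).
Proof.
move=> sA Uy; have dA i : derivable (fun z => A z i i) y v.
  exact: (diff_derivable (smooth_on_differentiable oU (sA i i) Uy)).
apply: etrans (derive_bigsum dA) _; apply: eq_bigr => i _; apply: esym.
exact: (derive_entry i i (smooth_mx_derivable oU sA Uy)).
Qed.

Lemma log_density_form_smooth w : smooth_on U (log_density_form w).
Proof.
apply: (smooth_onM oU (smooth_on_cst oU 2^-1)); apply: smooth_trace.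
exact: (smooth_mulmx oU invmx_metric_smooth (smooth_mx_derive_cst oU w sG)).
Qed.

(** Besides the second derivatives of [G], which commute, differentiating the inverse metric yields
    the trace of a product of two matrices, symmetric by cyclicity of the trace. *)
Lemma log_density_form_closed y v w : U y ->
  'D_v (log_density_form w) y = 'D_w (log_density_form v) y.
Proof.
move=> Uy.
have E s t : 'D_s (log_density_form t) y = 2^-1 *
    (\tr (invmx (G y) *m 'D_s (fun z => 'D_t G z) y)
     - \tr (invmx (G y) *m 'D_s G y *m (invmx (G y) *m 'D_t G y))).
  have sDt := smooth_mx_derive_cst oU t sG.
  have sP := smooth_mulmx oU invmx_metric_smooth sDt.
  have dI := smooth_mx_derivable oU (v := s) invmx_metric_smooth Uy.
  have dD := smooth_mx_derivable oU (v := s) sDt Uy.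
  have dT : derivable (fun z => \tr (invmx (G z) *m 'D_t G z)) y s.
    exact: (diff_derivable (smooth_on_differentiable oU (smooth_trace sP) Uy)).
  apply: etrans (deriveZ 2^-1 dT) _; congr (_ * _).
  apply: etrans (derive_trace s sP Uy) _.
  apply: etrans (congr1 mxtrace (derive_mulmx dI dD)) _.
  by rewrite derive_invmx_metric // mxtraceD mulNmx raddfN /= addrC mulmxA.
have E1 := congr1 (fun B => \tr (invmx (G y) *m B))
  (smooth_mx_derive_comm oU w v sG Uy).
have E2 := mxtrace_mulC (invmx (G y) *m 'D_v G y) (invmx (G y) *m 'D_w G y).
exact: (etrans (E v w) (etrans (congr1 (fun r => 2^-1 * r)
  (congr2 (fun s t => s - t) E1 E2)) (esym (E w v)))).
Qed.

Lemma inner_derive_linear y u v c s t : U y ->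
  inner ('D_(c *: s + t) G y) u v = c * inner ('D_s G y) u v + inner ('D_t G y) u v.
Proof.
move=> Uy; have dG : differentiable G y := smooth_mx_differentiable oU sG Uy.
have -> : 'D_(c *: s + t) G y = c *: 'D_s G y + 'D_t G y.
  by apply: etrans (deriveDv _ _ dG) _; congr (_ + _); exact: deriveZv.
by rewrite inner_mxPl.
Qed.

Lemma sum_invmx_inner y (f : 'rV[R]_d -> 'rV[R]_d) : U y ->
  \sum_i \sum_j invmx (G y) i j * inner (G y) (f (basis_vec R i)) (basis_vec R j)
  = \sum_i f (basis_vec R i) 0 i.
Proof.
move=> Uy; apply: eq_bigr => i _.
rewrite -[in RHS](mulmxK (metric_unit Uy) (f _)) [RHS]mxE.
apply: eq_bigr => j _; rewrite inner_basis mulrC; congr (_ * _).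
exact: invmx_metric_symE.
Qed.

(** In the Koszul formula two of the three terms are antisymmetric in the traced indices and vanish
    against the symmetric inverse metric. *)
Lemma christoffel_trace y w : U y ->
  \sum_i christoffel_form G y (basis_vec R i) w 0 i = log_density_form w y.
Proof.
move=> Uy; rewrite -(sum_invmx_inner (fun u => christoffel_form G y u w) Uy).
pose g i j := invmx (G y) i j; pose b (i : 'I_d) : 'rV[R]_d := basis_vec R i.
have K i j : 2 * (g i j * inner (G y) (christoffel_form G y (b i) w) (b j)) =
    g i j * inner ('D_w G y) (b i) (b j)
    + (g i j * inner ('D_(b i) G y) w (b j) - g i j * inner ('D_(b j) G y) w (b i)).
  rewrite mulrCA.
  apply: etrans (congr1 _ (Koszul oU sG (@metric_sym _ _ M a)
    (@metric_pos _ _ M a) Uy (b i) w (b j))) _.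
  have sum (r s t z z' : R) : z = z' -> r * (s + t - z) = r * t + (r * s - r * z').
    by move=> ->; ring.
  apply: sum.
  exact: (innerC (b i) w (symm_derive_metric oU sG (@metric_sym _ _ M a) Uy (b j))).
have A0 : \sum_i \sum_j (g i j * inner ('D_(b i) G y) w (b j)
    - g i j * inner ('D_(b j) G y) w (b i)) = 0.
  by apply: antisym_sum => i j; rewrite opprB /g (invmx_metric_symE i j Uy).
have two0 : (2 : R) != 0 by rewrite pnatr_eq0.
apply: (mulfI two0); rewrite /log_density_form mulVKf // mulr_sumr.
apply: (@etrans _ _ (\sum_i \sum_j g i j * inner ('D_w G y) (b i) (b j))).
  rewrite -[RHS]addr0 -[X in _ = _ + X]A0 -big_split /=; apply: eq_bigr => i _.
  rewrite mulr_sumr -big_split /=; apply: eq_bigr => j _; exact: K.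
rewrite /mxtrace; apply: eq_bigr => i _; rewrite [RHS]mxE; apply: eq_bigr => j _.
congr (_ * _); rewrite inner_basis /b /basis_vec -rowE mxE.
by rewrite -[in RHS](symm_derive_metric oU sG (@metric_sym _ _ M a) Uy w) mxE.
Qed.

End InverseMetric.

(** * The double divergence of a skew endomorphism field vanishes *)

Section SkewDivergence.
Variables (R : realType) (d : nat) (M : riem_manifold R d) (a : chart M).
Local Notation G := (metric a).
Local Notation U := (cod a).
Variable A : 'rV[R]_d -> 'M[R]_d.
Hypothesis sA : smooth_mx_on U A.
Hypothesis skewA : forall y, U y -> forall u v,
  inner (G y) (u *m A y) v = - inner (G y) u (v *m A y).
Implicit Types u v w : 'rV[R]_d.

Let oU : open U := @cod_open _ _ _ a.
Let sG : smooth_mx_on U G := @metric_smooth _ _ M a.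
Let b (i : 'I_d) : 'rV[R]_d := basis_vec R i.

(* [A] with its lower index raised, a skew bivector *)
Definition raised y : 'M[R]_d := invmx (G y) *m A y.

Lemma raised_smooth : smooth_mx_on U raised.
Proof. exact: (smooth_mulmx oU (@invmx_metric_smooth _ _ M a) sA). Qed.

Lemma raised_skew y i j : U y -> raised y i j = - raised y j i.
Proof.
move=> Uy; have uG := metric_unit Uy.
have AG : G y *m (A y)^T = - (A y *m G y).
  have <- : (A y *m G y)^T = G y *m (A y)^T by rewrite trmx_mul metric_sym.
  apply/matrixP => k l; have := skewA Uy (b l) (b k).
  rewrite [inner _ (b l) _](innerC _ _ (metric_sym Uy)) !inner_basis.
  by rewrite /b /basis_vec -!mulmxA -!rowE [row _ _ _ _]mxE [row _ _ _ _]mxE !mxE.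
have E : (raised y)^T = - raised y.
  rewrite /raised trmx_mul (invmx_metric_sym Uy) -[LHS](mulKmx uG).
  rewrite [G y *m (_ *m _)]mulmxA AG.
  by rewrite mulNmx mulmxN mulmxK.
have := congr1 (fun B : 'M[R]_d => B j i) E.
by rewrite [X in X = _ -> _]mxE [X in _ = X -> _]mxE.
Qed.

(* The divergence of [A]; in terms of the bivector [raised] it involves no
   Christoffel symbols besides the logarithmic derivative of the density, so that
   its own divergence is a sum of antisymmetric terms. *)
Definition trace_cov_end y : 'rV[R]_d := metric_trace (cov_end G A y) (G y).

Lemma metric_trace_row (W : lmodType R) (B : 'rV[R]_d -> 'rV[R]_d -> W) y :
  (forall w c u v, B w (c *: u + v) = c *: B w u + B w v) ->
  metric_trace B (G y) = \sum_i B (b i) (b i *m invmx (G y)).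
Proof.
move=> BPr; apply: eq_bigr => i _.
rewrite [b i *m _]row_sum_delta (affine_sum _ (BPr _)); apply: eq_bigr => j _.
by rewrite (affineZ (BPr _)) /b /basis_vec -rowE mxE.
Qed.

(** The classical formula g^{ij} Gamma^k_{ij} = - (1/sqrt g) d_i(sqrt g g^{ik}), with the derivative
    of the inverse metric expanded. *)
Lemma trace_christoffel y : U y ->
  (\row_k log_density_form a (b k) y) *m invmx (G y) =
  \sum_i (b i *m invmx (G y) *m 'D_(b i) G y *m invmx (G y)
          - christoffel_form G y (b i) (b i *m invmx (G y))).
Proof.
move=> Uy; have uG := metric_unit Uy; set I := invmx (G y).
apply: (can_inj (mulmxK uG)); apply/rowP => l; rewrite -!inner_basis -/(b l).
have sum (k r s t : R) : 2 * k = r + s - t -> r - k = 2^-1 * (r - s + t) by lra.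
pose p := metric_at Uy.
apply: etrans _ (esym (ip_suml p _ (b l))).
apply: (@etrans _ _ (log_density_form a (b l) y)).
  by rewrite inner_basis mulmxKV // mxE.
have E i : inner (G y) (b i *m I *m 'D_(b i) G y *m I
      - christoffel_form G y (b i) (b i *m I)) (b l) =
    2^-1 * (inner ('D_(b i) G y) (b i *m I) (b l)
      - inner ('D_(b i *m I) G y) (b i) (b l) + inner ('D_(b l) G y) (b i) (b i *m I)).
  have K := Koszul oU sG (@metric_sym _ _ M a) (@metric_pos _ _ M a) Uy
    (b i) (b i *m I) (b l).
  rewrite innerDl innerNl {1}inner_basis mulmxKV //.
  rewrite -[in LHS](inner_basis ('D_(b i) G y) (b i *m I) l) -/(b l).
  exact: sum K.
rewrite (eq_bigr _ (fun i _ => E i)) -mulr_sumr; congr (_ * _).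
rewrite big_split /= sumrB.
have E1 : \sum_i inner ('D_(b i *m I) G y) (b i) (b l) =
    \sum_i inner ('D_(b i) G y) (b i *m I) (b l).
  pose f u v := inner ('D_u G y) v (b l).
  have fl (c : R) u v t : f (c *: u + v) t = c *: f u t + f v t.
    exact: inner_derive_linear.
  have fr w (c : R) u v : f w (c *: u + v) = c *: f w u + f w v.
    exact: innerPl.
  have R1 i : f (b i *m I) (b i) = \sum_j I i j * f (b j) (b i).
    rewrite [b i *m I]row_sum_delta (affine_sum _ (fun c u v => fl c u v _)).
    apply: eq_bigr => j _; rewrite (affineZ (fun c u v => fl c u v _)).
    by rewrite /b /basis_vec -rowE mxE.
  have R2 i : f (b i) (b i *m I) = \sum_j I i j * f (b i) (b j).
    rewrite [b i *m I]row_sum_delta (affine_sum _ (fr _)).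
    apply: eq_bigr => j _; rewrite (affineZ (fr _)).
    by rewrite /b /basis_vec -rowE mxE.
  apply: etrans (eq_bigr _ (fun i _ => R1 i))
    (etrans _ (esym (eq_bigr _ (fun i _ => R2 i)))).
  rewrite [LHS]exchange_big /=; apply: eq_bigr => i _; apply: eq_bigr => j _.
  exact: (congr1 (fun r => r * f (b i) (b j)) (invmx_metric_symE j i Uy)).
have sum2 (s t z : R) : t = s -> s - t + z = z by move=> ->; rewrite subrr add0r.
apply: etrans _ (esym (sum2 _ _ _ E1)); apply: eq_bigr => i _; apply: esym.
apply: etrans (innerC (b i) _ (symm_derive_metric oU sG (@metric_sym _ _ M a) Uy (b l))) _.
by rewrite inner_basis /b /basis_vec -!mulmxA -rowE mxE.
Qed.

(** The divergence formula (1/sqrt g) d_i(sqrt g P^{ik}) for the bivector P = [raised]. *)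
Lemma trace_cov_endE y : U y -> trace_cov_end y =
  \sum_i b i *m 'D_(b i) raised y + (\row_k log_density_form a (b k) y) *m raised y.
Proof.
move=> Uy; rewrite /trace_cov_end metric_trace_row; last first.
  by move=> w c u v; exact: cov_endPr.
rewrite {2}/raised mulmxA trace_christoffel //; set I := invmx (G y).
rewrite mulmx_suml -big_split /=.
(* Symmetric Christoffel symbols contracted with the skew bivector. *)
have S0 : \sum_i christoffel_form G y (b i) (b i *m raised y) = 0.
  apply/rowP => k; rewrite summxE mxE.
  apply: etrans (@antisym_sum _ _ (fun i j =>
    raised y i j * christoffel_form G y (b i) (b j) 0 k) _).
    apply: eq_bigr => i _; rewrite [b i *m raised y]row_sum_delta.
    rewrite (affine_sum _ (fun c u v => christoffel_formPr G y c u v (b i))) summxE.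
    apply: eq_bigr => j _; rewrite christoffel_formZr mxE.
    by rewrite /b /basis_vec -rowE mxE.
  by move=> i j; rewrite raised_skew // mulNr (metric_christoffelC Uy (b i) (b j)).
rewrite -[RHS]addr0 -[X in _ = _ + X]S0 -big_split /=; apply: eq_bigr => i _.
have -> : 'D_(b i) raised y = - (I *m 'D_(b i) G y *m I) *m A y + I *m 'D_(b i) A y.
  have dI : derivable (fun z => invmx (G z)) y (b i).
    exact: (smooth_mx_derivable oU (@invmx_metric_smooth _ _ M a) Uy).
  have dA : derivable A y (b i) := smooth_mx_derivable oU sA Uy.
  apply: etrans (derive_mulmx dI dA) _; congr (_ *m _ + _).
  exact: derive_invmx_metric.
rewrite /cov_end mulmxDr mulmxBl mulNmx mulmxN /raised -/I !mulmxA.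
exact: addr_insert.
Qed.

(** This is (1/sqrt g) d_j d_i(sqrt g P^{ij}) = 0 expanded by the product rule. The terms with d d
    P, P d w and w w P vanish by skewness of P, the last two also using that w is closed or commutes
    with itself; the two mixed sums w d P cancel each other. *)
Lemma divergence_trace_cov_end y : U y ->
  \sum_j ('D_(b j) trace_cov_end y 0 j
          + log_density_form a (b j) y * trace_cov_end y 0 j) = 0.
Proof.
move=> Uy; pose P i k z := raised z i k; pose w i := log_density_form a (b i).
have sP i k : smooth_on U (P i k) := raised_smooth i k.
have sDP l i k : smooth_on U ('D_(b l) (P i k)) := smooth_on_derive_cst oU _ (sP i k).
have sw i : smooth_on U (w i) := log_density_form_smooth (b i).
have ds f v : smooth_on U f -> derivable f y v.
  by move=> sf; exact: (diff_derivable (smooth_on_differentiable oU sf Uy)).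
have PN i k z : U z -> P i k z = - P k i z := @raised_skew z i k.
have DPN l i k z : U z -> 'D_(b l) (P i k) z = - 'D_(b l) (P k i) z.
  move=> Uz; apply: etrans (derive_eq_on oU _ Uz (PN i k)) _; apply: deriveN.
  exact: (diff_derivable (smooth_on_differentiable oU (sP k i) Uz)).
have VE j z : U z -> trace_cov_end z 0 j =
    \sum_i 'D_(b i) (P i j) z + \sum_k w k z * P k j z.
  move=> Uz; rewrite trace_cov_endE // mxE summxE; congr (_ + _); last first.
    by rewrite mxE; apply: eq_bigr => k _; rewrite mxE.
  apply: eq_bigr => i _; rewrite /b /basis_vec -rowE mxE.
  exact: (derive_entry i j (smooth_mx_derivable oU raised_smooth Uz)).
have sV : smooth_mx_on U trace_cov_end.
  move=> o j; rewrite ord1; apply: (smooth_on_eq oU (u := fun z =>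
    \sum_i 'D_(b i) (P i j) z + \sum_k w k z * P k j z)).
    by move=> z Uz; rewrite VE.
  apply: (smooth_onD oU); apply: (smooth_on_sum oU) => k; first exact: sDP.
  exact: (smooth_onM oU).
have DV j : 'D_(b j) trace_cov_end y 0 j = \sum_i 'D_(b j) ('D_(b i) (P i j)) y
    + \sum_k (w k y * 'D_(b j) (P k j) y + P k j y * 'D_(b j) (w k) y).
  apply: etrans (derive_entry 0 j (smooth_mx_derivable oU sV Uy)) _.
  apply: etrans (derive_eq_on oU _ Uy (VE j)) _.
  have d1 i : derivable ('D_(b i) (P i j)) y (b j) by exact: ds.
  have d2 k : derivable (fun z => w k z * P k j z) y (b j).
    by apply: ds; exact: (smooth_onM oU).
  apply: etrans (deriveD (derivable_bigsum d1) (derivable_bigsum d2)) _.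
  apply: etrans (congr2 +%R (derive_bigsum d1) (derive_bigsum d2)) _.
  congr (_ + _); apply: eq_bigr => k _.
  exact: (deriveM (ds _ _ (sw k)) (ds _ _ (sP k j))).
have S1 : \sum_j \sum_i 'D_(b j) ('D_(b i) (P i j)) y = 0.
  apply: (@antisym_sum _ _ (fun j i => 'D_(b j) ('D_(b i) (P i j)) y)) => j i.
  have C := smooth_derive_comm oU (b i) (b j) (sP i j) Uy.
  have D1 := derive_eq_on oU (b i) Uy (DPN j i j).
  have D2 := deriveN (ds _ (b i) (sDP j j i)).
  exact: (etrans C (etrans D1 D2)).
have S2 : \sum_j \sum_k P k j y * 'D_(b j) (w k) y = 0.
  apply: (@antisym_sum _ _ (fun j k => P k j y * 'D_(b j) (w k) y)) => j k.
  have C := log_density_form_closed (b j) (b k) Uy.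
  exact: (etrans (congr2 *%R (PN k j y Uy) C) (mulNr _ _)).
have S5 : \sum_j \sum_k w j y * (w k y * P k j y) = 0.
  apply: (@antisym_sum _ _ (fun j k => w j y * (w k y * P k j y))) => j k.
  have sum (r s t t' : R) : t = - t' -> r * (s * t) = - (s * (r * t')).
    by move=> ->; ring.
  exact: sum (PN k j y Uy).
have S34 : \sum_j \sum_k w k y * 'D_(b j) (P k j) y
    + \sum_j w j y * (\sum_i 'D_(b i) (P i j) y) = 0.
  rewrite [X in _ + X](_ : _ = \sum_j \sum_k w k y * 'D_(b j) (P j k) y).
    rewrite -big_split big1 // => j _ /=; rewrite -big_split big1 // => k _ /=.
    apply: etrans (congr1 (fun r => w k y * r + _) (DPN j k j y Uy)) _.
    by rewrite mulrN addNr.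
  rewrite [RHS]exchange_big; apply: eq_bigr => j _ /=.
  by rewrite mulr_sumr.
apply: etrans (eq_bigr _ (fun j _ => congr2 +%R (DV j)
  (congr1 ( *%R (w j y)) (VE j y Uy)))) _.
have T j : \sum_i 'D_(b j) ('D_(b i) (P i j)) y
    + \sum_k (w k y * 'D_(b j) (P k j) y + P k j y * 'D_(b j) (w k) y)
    + w j y * (\sum_i 'D_(b i) (P i j) y + \sum_k w k y * P k j y) =
  \sum_i 'D_(b j) ('D_(b i) (P i j)) y
  + \sum_k P k j y * 'D_(b j) (w k) y
  + \sum_k w j y * (w k y * P k j y)
  + (\sum_k w k y * 'D_(b j) (P k j) y + w j y * (\sum_i 'D_(b i) (P i j) y)).
  have sum (r x s t wj z y0 q : R) : x = s + t -> wj * y0 = q ->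
      r + x + wj * (z + y0) = r + t + q + (s + wj * z) by move=> -> <-; ring.
  by apply: sum; [exact: big_split|exact: mulr_sumr].
rewrite (eq_bigr _ (fun j _ => T j)) !big_split /= S1 S2 S5 S34.
by rewrite !addr0.
Qed.

End SkewDivergence.

(** * Pointwise conditions on the source *)

Section HarmonicSource.
Variables (R : realType) (m : nat) (M : acm_manifold R m) (a : chart M).
Notation D := m.*2.+1.
Local Notation G := (metric a).
Local Notation U := (cod a).

Let oU : open U := @cod_open _ _ _ a.

(** [quasi] and [trace_free] are weakened to traces over one phi-frame, in order to include
    semi-Sasakian manifolds. *)
Definition harmonic_source x (Ux : U x) : Prop :=
  let p := acm_at Ux in
  [/\ geodesic p, twisted p & exists e : nat -> 'rV[R]_D,
    [/\ orthonormal_at a m e x,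
        ph p (\sum_(i < m) Pph p (e i) (e i)) = 0
      & \sum_(i < m) (ip p (nrb p (e i)) (e i)
          + ip p (nrb p (ph p (e i))) (ph p (e i))) = 0]].

Lemma exists_orthonormal x : U x -> exists e, orthonormal_at a m e x.
Proof.
move=> Ux; have [V [E [_ Vx _ oE]]] := smooth_frame Ux.
by exists (E ^~ x); exact: oE.
Qed.

(** [0 < m] supplies the nonzero horizontal vector [e 0] from which [twisted] is obtained. *)
Lemma point_source x (Ux : U x) : (0 < m)%N -> point_target Ux ->
  (forall u, u != 0 -> horizontal (acm_at Ux) u -> twisted (acm_at Ux)) ->
  harmonic_source Ux.
Proof.
move=> m0 [gp qp tp] tw; have [e oe] := exists_orthonormal Ux.
have he := orthonormal_horizontal Ux oe; split=> //.
  by have [e0 h0] := he 0%N m0; exact: tw e0 h0.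
exists e; split=> //.
- rewrite (affine_sum _ (phP (acm_at Ux))) big1 // => i _; apply: qp.
  by have [] := he i (ltn_ord i).
- by rewrite big1 // => i _; apply: tp; have [] := he i (ltn_ord i).
Qed.

Section SemiSasakian.
Hypothesis semiM : semi_Sasakian M.

(** Normality makes the Reeb curves geodesics, so delta Omega reduces to the sum of the P(e_i, e_i).
    The class condition speaks of smooth frames, hence the frame is taken on a neighbourhood. *)
Lemma semi_Sasakian_frame x (Ux : U x) : exists e, orthonormal_at a m e x /\
  \sum_(i < m) Pph (acm_at Ux) (e i) (e i) = (2 * m%:R) *: xi a x.
Proof.
have [nM dM] := semiM; have gp := normal_geodesic Ux nM.
have [V [E [cV Vx sE oE]]] := smooth_frame Ux; exists (E ^~ x).
split; first exact: oE.
pose p := acm_at Ux; pose E' (i : 'I_m) := E i.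
have fE : phi_frame a V E'.
  split=> [i|y Vy]; first exact: sE.
  have Uy : U y by case: cV => _; apply.
  have oy := oE y Vy; split; [|split].
  - move=> i j; have [zi /(_ j (ltn_ord j))[ij pij]] := oy i (ltn_ord i).
    split=> //; rewrite /g_of /phi_of /app_end (metric_phi Uy).
    by rewrite !(eta_inner _ Uy) zi mul0r subr0.
  - move=> i; have [zi _] := oy i (ltn_ord i); split=> //.
    by rewrite /g_of /phi_of /app_end -(eta_inner _ Uy) eta_phi.
  - by rewrite /g_of -(eta_inner _ Uy) (eta_xi Uy).
apply: (@ip_ext _ _ p) => w.
have sw : smooth_mx_on V (fun=> w) by apply: smooth_mx_cst; case: cV.
have := dM a V cV E' _ fE sw x Vx; rewrite /delta_Omega /g_of eta_of_at.
have -> : phi_of a (nabla_acm a (xi a) (xi a)) x = 0.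
  rewrite /phi_of /app_end (_ : nabla_acm a (xi a) (xi a) x = 0) ?mul0mx //.
rewrite oppr0 add0r => E1.
rewrite ipZl [ip p (xi a x) w]ipC; apply: etrans _ E1.
rewrite /= ; congr (inner _ _ _); apply: eq_bigr => i _; apply: esym.
exact: (P_acm_at Ux _ cV Vx (sE i (ltn_ord i))).
Qed.

(* 2m div xi = div (div phi) = 0 *)
Lemma semi_Sasakian_divergence x (Ux : U x) : (0 < m)%N ->
  metric_trace (fun u v => ip (acm_at Ux) (nrb (acm_at Ux) u) v : R^o) (G x) = 0.
Proof.
move=> m0; have [nM _] := semiM.
have skew y (Uy : U y) u v :
  inner (G y) (u *m phi a y) v = - inner (G y) u (v *m phi a y) :=
  inner_phi_skew u v Uy.
(* The trace of nabla phi over a phi-frame is the sum of the P(e_i, e_i) plus (nabla_xi phi) xi = 0.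
   It is computed at every point of [U], with a frame depending on the point, since the identity is
   differentiated afterwards. *)
have TE y : U y -> trace_cov_end a (phi a) y = (2 * m%:R) *: xi a y.
  move=> Uy; have [e [oe <-]] := semi_Sasakian_frame Uy.
  pose p := acm_at Uy; have gp := normal_geodesic Uy nM.
  apply: etrans (metric_trace_frame (nphPl p) (nphPr p) Uy oe) _.
  by rewrite [X in _ + X](geodesic_K0 gp) addr0.
have c0 : 2 * m%:R != 0 :> R by rewrite mulf_neq0 // pnatr_eq0 -?lt0n.
have sx := @xi_smooth _ _ M a.
have dx v : derivable (xi a) x v := smooth_mx_derivable oU sx Ux.
have := divergence_trace_cov_end (@phi_smooth _ _ M a) skew Ux.
have DT j : 'D_(basis_vec R j) (trace_cov_end a (phi a)) x 0 j
    + log_density_form a (basis_vec R j) x * trace_cov_end a (phi a) x 0 j =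
  (2 * m%:R) * ('D_(basis_vec R j) (xi a) x 0 j
    + xi a x 0 j * log_density_form a (basis_vec R j) x).
  have E1 : 'D_(basis_vec R j) (trace_cov_end a (phi a)) x =
      (2 * m%:R) *: 'D_(basis_vec R j) (xi a) x.
    by apply: etrans (derive_eq_on oU _ Ux TE) _; exact: deriveZ.
  rewrite E1 (TE x Ux) 2![(_ *: _ : 'rV_D) 0 j]mxE mulrCA -mulrDr.
  by congr (_ * (_ + _)); exact: mulrC.
rewrite (eq_bigr _ (fun j _ => DT j)) -mulr_sumr => /eqP.
rewrite mulf_eq0 (negPf c0) /= => /eqP E; apply: etrans _ E.
apply: etrans (sum_invmx_inner (cov_vec G (xi a) x) Ux) _.
rewrite [RHS]big_split /=.
have -> : \sum_j xi a x 0 j * log_density_form a (basis_vec R j) x =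
    \sum_i christoffel_form G x (basis_vec R i) (xi a x) 0 i.
  have CE i : christoffel_form G x (basis_vec R i) (xi a x) 0 i =
      \sum_j xi a x 0 j * christoffel_form G x (basis_vec R i) (basis_vec R j) 0 i.
    rewrite {1}[xi a x]row_sum_delta.
    rewrite (affine_sum _ (fun c u v => christoffel_formPr G x c u v _)) summxE.
    by apply: eq_bigr => j _; rewrite christoffel_formZr mxE.
  rewrite [RHS](eq_bigr _ (fun i _ => CE i)) [RHS]exchange_big /=.
  by apply: eq_bigr => j _; rewrite -(christoffel_trace _ Ux) mulr_sumr.
by rewrite -big_split; apply: eq_bigr => i _; rewrite mxE.
Qed.

Lemma semi_Sasakian_source x (Ux : U x) : (0 < m)%N -> harmonic_source Ux.
Proof.
move=> m0; have [nM _] := semiM; pose p := acm_at Ux.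
have gp := normal_geodesic Ux nM; have [e [oe PE]] := semi_Sasakian_frame Ux.
have he := orthonormal_horizontal Ux oe.
have div0 := semi_Sasakian_divergence Ux m0.
split=> //.
(* If d eta vanished on ker eta, each P(e_i, e_i) would have zero Reeb component, but their sum is
   2m xi. *)
- apply: contrapT => ntw.
  have E : ip p (\sum_(i < m) Pph p (e i) (e i)) (rb p) = 0.
    rewrite ip_suml big1 // => i _; have [_ hi] := he i (ltn_ord i).
    rewrite ip_Pph_rb //; apply/eqP/negPn/negP => nz; apply: ntw.
    by exists (ph p (e i)), (e i); split=> //; exact: horizontal_ph.
  move: E; rewrite PE ipZl ip_rb mulr1 => /eqP.
  by rewrite mulf_eq0 !pnatr_eq0 /= => /eqP m00; rewrite m00 in m0.
- exists e; split=> //.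
    by rewrite PE (affineZ (phP p)) ph_rb scaler0.
  have Bl (c : R) u v w : (ip p (nrb p (c *: u + v)) w : R^o) =
      c *: (ip p (nrb p u) w : R^o) + ip p (nrb p v) w.
    by rewrite nrbP ipP.
  have Br w (c : R) u v : (ip p (nrb p w) (c *: u + v) : R^o) =
      c *: (ip p (nrb p w) u : R^o) + ip p (nrb p w) v.
    by rewrite ipDr ipZr.
  have := metric_trace_frame Bl Br Ux oe; rewrite div0.
  by rewrite [X in _ = _ + X](nrb_rb p) addr0 => /esym.
Qed.

End SemiSasakian.

Lemma source_at x (Ux : U x) : (0 < m)%N ->
  [\/ class_A1 M, class_A6 M | class_A7 M] -> harmonic_source Ux.
Proof.
move=> m0 [/(class_A1_at Ux)[pt tw]|/(class_A6_at Ux)[pt tw]|semiM].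
- exact: point_source.
- exact: point_source.
- exact: semi_Sasakian_source.
Qed.

End HarmonicSource.

(** * Tension field and pluriharmonicity in charts *)

Section LocalRepresentation.
Variables (R : realType) (d e : nat) (M : riem_manifold R d) (N : riem_manifold R e).
Variables (f : M -> N) (a : chart M) (b : chart N).
Hypothesis smf : smooth_map f.
Local Notation W := (local_dom f a b).
Local Notation F := (local_rep f a b).

Lemma local_dom_open : open W.
Proof.
rewrite openE => x [cx dx].
have cf : {for x, continuous (fun y => f (par a y))}.
  have [contf _] := smf.
  exact: continuous_comp (par_continuous cx) (contf _).
have nd : \forall y \near x, dom b (f (par a y)).
  by apply: cf; apply: open_nbhs_nbhs; split=> //; exact: dom_open.
by apply: filterS2 (near_in (@cod_open _ _ _ a) cx) nd => y cy dy; split.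
Qed.

Lemma local_dom_cod : W `<=` cod a. Proof. by move=> x []. Qed.

Lemma local_rep_cod x : W x -> cod b (F x).
Proof. by case=> _ dx; exact: crd_cod. Qed.

Lemma local_rep_smooth : smooth_mx_on W F.
Proof. by have [_] := smf; apply. Qed.

Local Notation hessF := (hess a b F).

Lemma tension_metric_trace x : W x ->
  tension (metric a) (metric b) F x = metric_trace (hessF x) (metric a x).
Proof.
move=> Wx; apply: eq_bigr => i _; apply: eq_bigr => j _.
have sj := smooth_mx_cst local_dom_open (basis_vec R j).
apply: (congr1 (fun t => invmx (metric a x) i j *: t)).
exact: (second_fundamental_form_at a b local_dom_open local_rep_smooth Wx
  (coord_field i) local_dom_open (@subset_refl _ _) Wx sj).
Qed.

End LocalRepresentation.

Section SourceFrames.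
Variables (R : realType) (m e : nat) (M : acm_manifold R m) (N : riem_manifold R e).
Variables (f : M -> N) (a : chart M) (b : chart N).
Hypothesis smf : smooth_map f.
Local Notation W := (local_dom f a b).
Local Notation F := (local_rep f a b).
Local Notation oW := (@local_dom_open _ _ _ _ _ _ a b smf).
Local Notation Wa := (@local_dom_cod _ _ _ M N f a b).
Local Notation Wb := (@local_rep_cod _ _ _ M N f a b).
Local Notation sF := (@local_rep_smooth _ _ _ _ _ _ a b smf).
Local Notation hessF := (hess a b F).

Lemma tension_frame x (Wx : W x) v :
  orthonormal_at a m v x ->
  tension (metric a) (metric b) F x =
  \sum_(i < m) (hessF x (v i) (v i)
                + hessF x (v i *m phi a x) (v i *m phi a x))
  + hessF x (xi a x) (xi a x).
Proof.
move=> ov; rewrite tension_metric_trace //.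
have BPl := hessPl a b oW sF Wx; have BC := hessC oW Wa Wb sF Wx.
apply: metric_trace_frame => //; last exact: local_dom_cod Wx.
by move=> w c s t; rewrite !(BC w) BPl.
Qed.

Lemma pluriharmonic_hess V X x : in_chart a V -> V `<=` W ->
  smooth_mx_on V X -> V x ->
  second_fundamental_form (metric a) (metric b) F X X x
  + second_fundamental_form (metric a) (metric b) F (phi_of a X) (phi_of a X) x
  = hessF x (X x) (X x) + hessF x (X x *m phi a x) (X x *m phi a x).
Proof.
move=> cV VW sX Vx; have [oV VU] := cV; have Wx := VW x Vx.
have E Y : smooth_mx_on V Y ->
    second_fundamental_form (metric a) (metric b) F Y Y x = hessF x (Y x) (Y x).
  by move=> sY; exact: (second_fundamental_form_at a b oW sF Wx Y oV VW Vx sY).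
exact: (congr2 +%R (E X sX) (E _ (phi_of_smooth cV sX))).
Qed.

End SourceFrames.

(** * Harmonicity for almost contact targets *)

Section AcmTarget.
Variables (R : realType) (m n : nat) (M : acm_manifold R m) (N : acm_manifold R n).
Variable f : M -> N.
Hypothesis smf : smooth_map f.
Variable eps : R.
Hypothesis eps2 : eps * eps = 1.
Hypothesis hol : intertwines f eps (@phi R m M) (@phi R n N).
Hypothesis srcM : forall (a : chart M) x (Ux : cod a x), harmonic_source Ux.
Hypothesis tgtN : forall (b : chart N) y (Vy : cod b y), point_target Vy.

Section Charts.
Variables (a : chart M) (b : chart N).
Local Notation W := (local_dom f a b).
Local Notation F := (local_rep f a b).
Let oW : open W := @local_dom_open _ _ _ _ _ _ a b smf.
Let Wa : W `<=` cod a := @local_dom_cod _ _ _ M N f a b.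
Let Wb y : W y -> cod b (F y) := @local_rep_cod _ _ _ M N f a b y.
Let sF : smooth_mx_on W F := @local_rep_smooth _ _ _ _ _ _ a b smf.
Let holF y : W y -> forall u,
  'D_(u *m phi a y) F y = eps *: ('D_u F y *m phi b (F y)) := @hol a b y.

Lemma reeb_factor_derive0 x : W x -> forall u, 'D_u (reeb_factor a b F) x = 0.
Proof.
move=> Wx; apply: (reeb_factor_constant oW Wb sF eps2 holF (Wa := Wa) (Wx := Wx)).
- by move=> y Uy; have [] := srcM Uy.
- by move=> y Vy; have [] := tgtN Vy.
- by have [] := srcM (Wa Wx).
Qed.

Lemma tension_zero x : W x -> tension (metric a) (metric b) F x = 0.
Proof.
move=> Wx; have [gp tw [v [ov PE NE]]] := srcM (Wa Wx).
have [gq qq tq] := tgtN (Wb Wx).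
rewrite (tension_frame smf Wx ov).
have hv (i : 'I_m) : horizontal (acm_at (Wa Wx)) (v i).
  by have [] := orthonormal_horizontal (Wa Wx) ov (ltn_ord i).
have S := hess_horizontal_sum_at oW sF eps2 holF (Wa := Wa) (Wb := Wb) (Wx := Wx)
  qq tq hv PE NE.
have S' := hess_reeb_at oW sF eps2 holF (Wa := Wa) (Wb := Wb) (Wx := Wx) gp gq.
apply: etrans (congr2 +%R S S') _.
by rewrite reeb_factor_derive0 // scale0r addr0.
Qed.

End Charts.

Lemma acm_harmonic : harmonic_map f.
Proof. by move=> a b x; exact: tension_zero. Qed.

Lemma acm_D_pluriharmonic :
  (forall (a : chart M) x (Ux : cod a x), point_target Ux) -> D_pluriharmonic f.
Proof.
move=> ptM a b V cV VW X sX hX x Vx.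
rewrite (pluriharmonic_hess smf cV VW sX Vx).
have Wx := VW x Vx; have Ux : cod a x := local_dom_cod Wx.
pose Wa := @local_dom_cod _ _ _ M N f a b.
pose Wb := @local_rep_cod _ _ _ M N f a b.
have [gp qp tp] := ptM a x (Wa x Wx).
have [gq qq tq] := tgtN (Wb x Wx).
have hXx : horizontal (acm_at (Wa x Wx)) (X x).
  by rewrite /horizontal -eta_of_at; exact: hX.
(* For a family with one member the trace hypotheses are the pointwise ones. *)
have := @hess_horizontal_sum_at _ _ _ M N a b _ _ (@local_dom_open _ _ _ _ _ _ a b smf) Wa Wb
  (@local_rep_smooth _ _ _ _ _ _ a b smf) eps eps2 (@hol a b) x Wx 'I_1 (fun=> X x) qq tq
  (fun=> hXx).
by rewrite !big_ord1; apply; [exact: qp|exact: tp].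
Qed.

End AcmTarget.

(** * Harmonicity for almost Hermitian targets *)

Section HermitianTargetMap.
Variables (R : realType) (m n : nat) (M : acm_manifold R m) (N : ah_manifold R n).
Variable f : M -> N.
Hypothesis smf : smooth_map f.
Variable eps : R.
Hypothesis eps2 : eps * eps = 1.
Hypothesis hol : intertwines f eps (@phi R m M) (@acs R n N).
Hypothesis tgtN : forall (b : chart N) y (Vy : cod b y), quasi_J (ah_at Vy).

Section Charts.
Variables (a : chart M) (b : chart N).
Local Notation W := (local_dom f a b).
Local Notation F := (local_rep f a b).
Let oW : open W := @local_dom_open _ _ _ _ _ _ a b smf.
Let Wa : W `<=` cod a := @local_dom_cod _ _ _ M N f a b.
Let Wb y : W y -> cod b (F y) := @local_rep_cod _ _ _ M N f a b y.
Let sF : smooth_mx_on W F := @local_rep_smooth _ _ _ _ _ _ a b smf.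
Variables (x : 'rV[R]_m.*2.+1) (Wx : W x).
Let p := acm_at (Wa Wx).
Let q := ah_at (Wb Wx).
Let B := hess a b F x.

Let LP := push_linear oW sF Wx.
Let BPl := hessPl a b oW sF Wx.
Let BC := hessC oW Wa Wb sF Wx.
Let Lph u : 'D_(ph p u) F x = eps *: js q ('D_u F x) := hol Wx u.
Let Bph u v : B u (ph p v) =
  eps *: KJ q ('D_u F x) ('D_v F x) + eps *: js q (B u v) - 'D_(nph p u v) F x :=
  hess_end oW Wa Wb sF Wx u v (@phi_smooth _ _ M a) (@acs_smooth _ _ N b)
    (@hol a b).

Lemma hess_sum_hermitian_at (I : finType) (v : I -> 'rV[R]_m.*2.+1) :
  (forall i, horizontal p (v i)) -> ph p (\sum_i Pph p (v i) (v i)) = 0 ->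
  \sum_i (B (v i) (v i) + B (ph p (v i)) (ph p (v i))) = 0.
Proof.
exact: (hess_horizontal_sum_hermitian LP BPl BC eps2 Lph Bph (tgtN (Wb Wx))).
Qed.

Lemma hess_reeb_hermitian_at : geodesic p -> B (rb p) (rb p) = 0.
Proof. exact: (hess_rb_hermitian LP BPl BC eps2 Lph Bph). Qed.

End Charts.

Lemma hermitian_harmonic :
  (forall (a : chart M) x (Ux : cod a x), harmonic_source Ux) -> harmonic_map f.
Proof.
move=> srcM a b x Wx; pose Wa := @local_dom_cod _ _ _ M N f a b.
have [gp _ [v [ov PE _]]] := srcM a x (Wa x Wx).
rewrite (tension_frame smf Wx ov).
have hv (i : 'I_m) : horizontal (acm_at (Wa x Wx)) (v i).
  by have [] := orthonormal_horizontal (Wa x Wx) ov (ltn_ord i).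
apply: etrans (congr2 +%R (hess_sum_hermitian_at hv PE)
  (hess_reeb_hermitian_at gp)) _.
exact: addr0.
Qed.

Lemma hermitian_D_pluriharmonic :
  (forall (a : chart M) x (Ux : cod a x), point_target Ux) -> D_pluriharmonic f.
Proof.
move=> ptM a b V cV VW X sX hX x Vx.
rewrite (pluriharmonic_hess smf cV VW sX Vx).
have Wx := VW x Vx; pose Wa := @local_dom_cod _ _ _ M N f a b.
have [gp qp tp] := ptM a x (Wa x Wx).
have hXx : horizontal (acm_at (Wa x Wx)) (X x).
  by rewrite /horizontal -eta_of_at; exact: hX.
have := @hess_sum_hermitian_at a b x Wx 'I_1 (fun=> X x) (fun=> hXx).
by rewrite !big_ord1; apply; exact: qp.
Qed.

End HermitianTargetMap.

(** * Weakly conformal maps: homothety and minimality *)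

Lemma zero_derive_constant_on_ball (R : realType) d (u : 'rV[R]_d -> R) x r y :
  (forall z, ball x r z -> differentiable u z) ->
  (forall z, ball x r z -> forall v, 'D_v u z = 0) ->
  ball x r y -> u y = u x.
Proof.
move=> du Du xy.
have seg t : `|t| <= `|1 : R| -> ball x r (t *: (y - x) + x).
  rewrite normr1 => t1; rewrite -ball_normE /= opprD addrCA subrr addr0 normrN.
  rewrite normrZ; apply: le_lt_trans (ler_piMl (normr_ge0 _) t1) _.
  by rewrite distrC; move: xy; rewrite -ball_normE.
have [|c c1 E] := @mean_value_line _ _ u x (y - x) 1.
  by move=> t t1; apply/diff_derivable/du/seg.
move: E; rewrite scale1r subrK Du ?mulr0; last exact: seg.
by move=> /eqP; rewrite subr_eq0 => /eqP.
Qed.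

Lemma connected_locally_constant (T : topologicalType) (S : Type) (g : T -> S) :
  connected [set: T] -> (forall p, \forall q \near p, g q = g p) ->
  forall p q, g p = g q.
Proof.
move=> cT lc p q; pose A := [set r | g r = g p].
have oA : open A.
  by rewrite openE => r /= Ar; apply: filterS (lc r) => s; rewrite Ar.
have cA : closed A.
  rewrite -[A]setCK; apply: open_closedC; rewrite openE => r /= Ar.
  by apply: filterS (lc r) => s sr As; apply: Ar; rewrite /A /= -sr.
have -> : g p = g q; last by [].
have : A q; last by move=> ->.
suff -> : A = setT by [].
by apply: cT; [exists p|exists A; rewrite ?setTI|exists A; rewrite ?setTI].
Qed.

Section LocallyConstant.
Variables (R : realType) (d e : nat) (M : riem_manifold R d) (N : riem_manifold R e).
Variable f : M -> N.
Hypothesis smf : smooth_map f.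

Lemma locally_constant_charts (S : Type) (g : M -> S) :
  (forall a b x, local_dom f a b x -> exists2 r : R, 0 < r & forall y,
     ball x r y -> local_dom f a b y -> g (par a y) = g (par a x)) ->
  forall p, \forall q \near p, g q = g p.
Proof.
move=> loc p; have [a ap] := dom_cover p; have [b bp] := dom_cover (f p).
have cx := crd_cod ap; pose x := crd a p.
have px : par a x = p by exact: crdK.
have Wx : local_dom f a b x by split; rewrite ?px.
have [r r0 H] := loc a b x Wx.
have n1 : \forall q \near p, dom a q by apply: open_nbhs_nbhs; split=> //; exact: dom_open.
have n2 : \forall q \near p, ball x r (crd a q).
  by apply: (crd_continuous ap); exact: nbhsx_ballx.
have n3 : \forall q \near p, dom b (f q).
  have [cf _] := smf.
  by apply: (cf p); apply: open_nbhs_nbhs; split=> //; exact: dom_open.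
apply: filterS3 n1 n2 n3 => q aq rq bq.
have := H (crd a q) rq; rewrite px crdK //; apply.
by split; [exact: crd_cod|rewrite crdK].
Qed.

End LocallyConstant.

Section WeaklyConformal.
Variables (R : realType) (m n : nat) (M : acm_manifold R m) (N : acm_manifold R n).
Variable f : M -> N.
Hypothesis smf : smooth_map f.
Variable eps : R.
Hypothesis eps2 : eps * eps = 1.
Hypothesis hol : intertwines f eps (@phi R m M) (@phi R n N).
Hypothesis srcM : forall (a : chart M) x (Ux : cod a x), harmonic_source Ux.
Hypothesis tgtN : forall (b : chart N) y (Vy : cod b y), point_target Vy.
Hypothesis cM : connected [set: M].
Variable mu : M -> R.
Hypothesis muf : conformal_with f mu.

(** Evaluate conformality on the unit vector xi, whose image is lambda times the unit Reeb vector of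
    the target. *)
Lemma conformal_reeb_factor a b x : local_dom f a b x ->
  mu (par a x) ^+ 2 = reeb_factor a b (local_rep f a b) x ^+ 2.
Proof.
move=> Wx; have [_ cf] := muf.
pose oW := @local_dom_open _ _ _ _ _ _ a b smf.
pose Wa := @local_dom_cod _ _ _ M N f a b.
pose Wb := @local_rep_cod _ _ _ M N f a b.
pose sF := @local_rep_smooth _ _ _ _ _ _ a b smf.
have L : 'D_(xi a x) (local_rep f a b) x =
    reeb_factor a b (local_rep f a b) x *: xi b (local_rep f a b x).
  exact: (push_rb (push_linear oW sF Wx) eps2
    (push_phi_at Wa Wb (@hol a b) Wx) (push_eta_at oW Wa Wb sF (@hol a b) Wx)).
have := cf a b x Wx (xi a x) (xi a x).
rewrite L innerZl innerZr.
have -> : inner (metric a x) (xi a x) (xi a x) = 1 := ip_rb (acm_at (Wa x Wx)).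
have -> : inner (metric b (local_rep f a b x)) (xi b (local_rep f a b x))
  (xi b (local_rep f a b x)) = 1 := ip_rb (acm_at (Wb x Wx)).
by rewrite !mulr1 expr2 => <-.
Qed.

(** lambda belongs to a pair of charts, so its local constancy is transferred to the global function
    [mu], whose sign condition allows squares to be compared; connectedness then gives a single
    value. *)
Lemma conformal_factor_constant p q : mu p = mu q.
Proof.
apply: connected_locally_constant cM _ p q => p.
apply: (locally_constant_charts smf) => a b x Wx.
pose oW := @local_dom_open _ _ _ _ _ _ a b smf.
have /nbhs_ballP[r /= r0 rW] := near_in oW Wx; exists r => // y xy Wy.
have [mu0 _] := muf.
apply/eqP; rewrite -(@eqrXn2 _ 2) ?mu0 //.
rewrite (conformal_reeb_factor Wy) (conformal_reeb_factor Wx).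
apply/eqP; congr (_ ^+ 2).
apply: (zero_derive_constant_on_ball _ _ xy) => z /rW Wz.
  have Wa := @local_dom_cod _ _ _ M N f a b.
  have Wb := @local_rep_cod _ _ _ M N f a b.
  have sF := @local_rep_smooth _ _ _ _ _ _ a b smf.
  exact: (smooth_on_differentiable oW (reeb_factor_smooth oW Wa Wb sF) Wz).
exact: (reeb_factor_derive0 smf eps2 hol srcM tgtN Wz).
Qed.

Lemma weakly_conformal_homothetic : homothetic f.
Proof.
(* On an empty [M] any constant will do; 0 is taken. *)
have [[p _]|nM] := pselect (exists p : M, True).
  exists (mu p); have [mu0 cf] := muf; split=> // a b x Wx u v.
  by rewrite (cf a b x Wx) (conformal_factor_constant (par a x) p).
exists 0; split=> // a b x Wx; exfalso; apply: nM; by exists (par a x).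
Qed.

End WeaklyConformal.

Section MinimalImage.
Variables (R : realType) (d e : nat) (M : riem_manifold R d) (N : riem_manifold R e).
Variable f : M -> N.
Hypothesis smf : smooth_map f.
Hypothesis cM : connected [set: M].
Hypothesis hf : harmonic_map f.

Lemma zero_homothety_constant : conformal_with f (fun=> 0) ->
  forall p q, f p = f q.
Proof.
move=> [_ cf]; apply: connected_locally_constant cM _ => p.
apply: (locally_constant_charts smf (g := f)) => a b x Wx.
pose oW := @local_dom_open _ _ _ _ _ _ a b smf.
have sF := @local_rep_smooth _ _ _ _ _ _ a b smf.
have /nbhs_ballP[r /= r0 rW] := near_in oW Wx; exists r => // y xy Wy.
suff E : local_rep f a b y = local_rep f a b x.
  have [_ dy] := Wy; have [_ dx] := Wx.
  by rewrite -(crdK dy) -(crdK dx); congr (par b _).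
apply/rowP => j.
apply: (zero_derive_constant_on_ball (u := fun z => local_rep f a b z 0 j) _ _ xy)
  => z /rW Wz.
  exact: (smooth_on_differentiable oW (sF 0 j) Wz).
move=> v; apply: etrans (esym (derive_entry 0 j (smooth_mx_derivable oW sF Wz))) _.
have Vz := local_rep_cod Wz.
have := cf a b z Wz v v; rewrite expr0n /= mul0r => /(ip_eq0 (p := metric_at Vz)) ->.
by rewrite mxE.
Qed.

(** The pulled-back metric is [c ^+ 2] times the source metric, so the mean curvature trace is the
    tension field divided by [c ^+ 2], up to vectors tangent to the image, which are orthogonal to
    [nu]. *)
Lemma homothetic_minimal c : c != 0 -> conformal_with f (fun=> c) ->
  immersion f /\
  forall a b x, local_dom f a b x -> forall nu : 'rV[R]_e,
     (forall u, inner (metric b (local_rep f a b x))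
                  ('D_u (local_rep f a b) x) nu = 0) ->
     inner (metric b (local_rep f a b x))
       (mean_curvature_trace (metric b) (local_rep f a b) x) nu = 0.
Proof.
move=> c0 [_ cf]; have c20 : c ^+ 2 != 0 by rewrite expf_neq0.
split=> [a b x Wx u Du|a b x Wx nu hnu].
  have Ux : cod a x by case: Wx.
  have := cf a b x Wx u u; rewrite Du inner0l => /esym/eqP.
  by rewrite mulf_eq0 (negPf c20) /= => /eqP /(ip_eq0 (p := metric_at Ux)).
have Ux : cod a x by case: Wx.
have Vx := local_rep_cod Wx; pose q := metric_at Vx.
have PM : pull_metric (metric b) (local_rep f a b) x = c ^+ 2 *: metric a x.
  apply/matrixP => i j; rewrite mxE [RHS]mxE; apply: etrans (cf a b x Wx _ _) _.
  by congr (_ * _); rewrite inner_basis /coord_field /basis_vec -rowE mxE.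
rewrite /mean_curvature_trace PM.
have -> : invmx (c ^+ 2 *: metric a x) = (c ^+ 2)^-1 *: invmx (metric a x).
  rewrite invmxZ // unitmxE detZ unitrM unitrX ?unitfE //= -unitfE -unitmxE.
  exact: metric_unit.
have T := hf Wx.
apply: etrans (ip_suml q _ nu) _.
have TE : \sum_i \sum_j ip q ((c ^+ 2)^-1 *: (invmx (metric a x) i j *:
   second_fundamental_form (metric a) (metric b) (local_rep f a b)
      (@coord_field R d i) (@coord_field R d j) x)) nu = 0.
  apply: etrans (_ : ip q ((c ^+ 2)^-1 *: tension (metric a) (metric b)
    (local_rep f a b) x) nu = 0); last by rewrite T scaler0 ip0l.
  rewrite ipZl /tension ip_suml mulr_sumr; apply: eq_bigr => i _.
  by rewrite ip_suml mulr_sumr; apply: eq_bigr => j _; rewrite ipZl.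
apply: etrans _ TE; apply: eq_bigr => i _.
apply: etrans (ip_suml q _ nu) _; apply: eq_bigr => j _.
rewrite mxE -scalerA !ipZl; congr (_ * (_ * _)).
apply: esym; rewrite /second_fundamental_form ipDl ipNl.
by rewrite [X in _ - X]hnu subr0.
Qed.

End MinimalImage.

Theorem corollary4p1 (R : realType) (m : nat) (m_pos : (0 < m)%N)
    (M : acm_manifold R m) :
  (forall (n : nat) (N : acm_manifold R n) (f : M -> N),
     smooth_map f ->
     pm_holomorphic f (@phi R m M) (@phi R n N) ->
     [/\ class_A1 M -> [\/ class_A1 N, class_A4 N | class_B1 N] ->
           harmonic_map f /\ D_pluriharmonic f,
         class_A6 M \/ class_A7 M ->
           [\/ class_A1 N, class_A4 N | class_B1 N] ->
           harmonic_map f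
       & connected [set: M] ->
           [\/ class_A1 M, class_A6 M | class_A7 M] ->
           class_A1 N \/ class_A4 N ->
           weakly_conformal f ->
           [/\ homothetic f, harmonic_map f & minimal_image f]]) /\
  (forall (n : nat) (N : ah_manifold R n) (f : M -> N),
     smooth_map f ->
     pm_holomorphic f (@phi R m M) (@acs R n N) ->
     (class_A1 M -> class_C1 N -> harmonic_map f /\ D_pluriharmonic f) /\
     (class_A6 M \/ class_A7 M -> class_C1 N -> harmonic_map f)).
Proof.
have signs : (1 * 1 = 1 :> R) * (-1 * -1 = 1 :> R) by rewrite mulrNN mulr1.
have src : [\/ class_A1 M, class_A6 M | class_A7 M] ->
    forall (a : chart M) x (Ux : cod a x), harmonic_source Ux.
  by move=> cM a x Ux; exact: source_at.
have A1_pt : class_A1 M ->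
    forall (a : chart M) x (Ux : cod a x), point_target Ux.
  by move=> A1 a x Ux; have [] := class_A1_at Ux A1.
split=> n N f smf hol.
- have [eps eps2 {}hol] : exists2 eps : R, eps * eps = 1
      & intertwines f eps (@phi R m M) (@phi R n N).
    by case: hol => hol; [exists 1|exists (-1)] => //; rewrite signs.
  have tgt : [\/ class_A1 N, class_A4 N | class_B1 N] ->
      forall (b : chart N) y (Vy : cod b y), point_target Vy.
    case=> cN b y Vy; [|exact: class_A4_at|exact: class_B1_at].
    by have [] := class_A1_at Vy cN.
  split=> [A1 /tgt ptN|A67 /tgt ptN|cM cls A14 [mu muf]].
  + split; last exact: (acm_D_pluriharmonic smf eps2 hol ptN (A1_pt A1)).
    by apply: (acm_harmonic smf eps2 hol _ ptN); apply: src; constructor 1.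
  + apply: (acm_harmonic smf eps2 hol _ ptN); apply: src.
    by case: A67; [constructor 2|constructor 3].
  + have ptN : forall (b : chart N) y (Vy : cod b y), point_target Vy.
      by apply: tgt; case: A14; [constructor 1|constructor 2].
    have hf : harmonic_map f := acm_harmonic smf eps2 hol (src cls) ptN.
    have [c cf] : homothetic f.
      exact: (weakly_conformal_homothetic smf eps2 hol (src cls) ptN cM muf).
    split=> //; first by exists c.
    (* For [c = 0] the map is constant, with value taken at some point of [M]; if [M] is empty, the
       immersion alternative holds vacuously. *)
    have [c0|c0] := eqVneq c 0; last by right; exact: (homothetic_minimal hf c0 cf).
    have [[p _]|nM] := pselect (exists p : M, True); [left|right].
      exists (f p) => q; rewrite c0 in cf.
      exact: (zero_homothety_constant smf cM cf).
    by split=> a b x; have : False by apply: nM; exists (par a x).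
- have [eps eps2 {}hol] : exists2 eps : R, eps * eps = 1
      & intertwines f eps (@phi R m M) (@acs R n N).
    by case: hol => hol; [exists 1|exists (-1)] => //; rewrite signs.
  have tgt : class_C1 N -> forall (b : chart N) y (Vy : cod b y), quasi_J (ah_at Vy).
    by move=> C1 b y Vy; exact: class_C1_at.
  split=> [A1 /tgt qN|A67 /tgt qN].
  + split; last exact: (hermitian_D_pluriharmonic smf eps2 hol qN (A1_pt A1)).
    by apply: (hermitian_harmonic smf eps2 hol qN); apply: src; constructor 1.
  + apply: (hermitian_harmonic smf eps2 hol qN); apply: src.
    by case: A67; [constructor 2|constructor 3].
Qed.
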